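(* Let $k\in\{3,4\}$. Every finite simple graph $G$ with $\rho_G^k\le 2-\sigma_G^k$ is SE $k$-choosable.
   Context: For a graph $G$, $V_1(G)$ is the set of vertices of degree $1$, and for $A\subseteq V(G)$, $\|G[A]\|$ is the number of edges of the induced subgraph $G[A]$. Set $\varepsilon_3=6$, $\varepsilon_4=4$, $\nu_k=\varepsilon_k+1$. For $A\subseteq V(G)$ define $\rho_G^k(A)=\varepsilon_k\|G[A]\|-\nu_k|A|+\frac{\varepsilon_k}{2}|A\cap V_1(G)|$, and $\rho_G^k=\max_{A\subseteq V(G)}\rho_G^k(A)$ (the maximum includes $A=\emptyset$, so $\rho_G^k\ge0$). Set $\sigma_G^3=0$ and $\sigma_G^4=|V_1(G)|\bmod 2$. A $k$-list assignment $L$ for $G$ assigns to each vertex $v$ a set $L(v)$ of exactly $k$ colors; an $L$-coloring is a proper vertex coloring $f$ with $f(v)\in L(v)$ for all $v$. For an integer $n$ and $k\ge1$, $n\bmod^* k$ is the unique $m\in\{1,\dots,k\}$ with $n\equiv m\pmod k$. If $|V(G)|=n\ge 1$, an $L$-coloring $f$ of $G$ is strongly equitable (SE) if every color class has at most $\lceil n/k\rceil$ vertices and the number of colors whose class has exactly $\lceil n/k\rceil$ vertices (the full classes) is at most $n\bmod^* k$; the empty graph is regarded as SE $L$-colorable. $G$ is SE $k$-choosable if it has an SE $L$-coloring for every $k$-list assignment $L$. *)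

(* Defs.v *)
From mathcomp Require Import all_boot all_order all_algebra.
Set Implicit Arguments. Unset Strict Implicit. Unset Printing Implicit Defensive.
Import Order.TTheory GRing.Theory Num.Theory.

(* A finite simple graph: vertex type T : finType, adjacency e : rel T,
   assumed symmetric and irreflexive (hypotheses of the theorem). *)
Section Graph.
Variables (T : finType) (e : rel T).

Definition deg (v : T) : nat := #|[set w | e v w]|.
Definition V1 : {set T} := [set v | deg v == 1%N].

Definition is_edge (E : {set T}) : bool :=
  [exists x, exists y, (E == [set x; y]) && e x y].
Definition induced_edges (A : {set T}) : nat :=
  #|[set E : {set T} | is_edge E & E \subset A]|.

Definition eps (k : nat) : int := if k == 3%N then 6 else 4.
Definition nu (k : nat) : int := eps k + 1.
Definition half_eps (k : nat) : int := if k == 3%N then 3 else 2.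

Local Open Scope ring_scope.

Definition rhoA (k : nat) (A : {set T}) : int :=
  eps k * (induced_edges A)%:Z - nu k * (#|A|)%:Z
  + half_eps k * (#|A :&: V1|)%:Z.

(* maximum over all A (including the empty set, whence >= 0) *)
Definition rho (k : nat) : int := \big[Order.max/0]_(A : {set T}) rhoA k A.

Definition sigma (k : nat) : int := if k == 3%N then 0 else (odd #|V1|)%:Z.

Local Close Scope ring_scope.

(* n mod* k, for k >= 1 : the unique m in {1..k} with n = m mod k *)
Definition modstar (n k : nat) : nat := ((n + k - 1) %% k).+1.
Definition ceildiv (n k : nat) : nat := (n + k - 1) %/ k.

Definition SE_Lcoloring (k : nat) (C : finType) (L : T -> {set C}) (f : T -> C) :=
  (forall v, f v \in L v) /\
  (forall v w, e v w -> f v != f w) /\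
  (#|T| = 0 \/
   ((forall c : C, #|[set v | f v == c]| <= ceildiv #|T| k) /\
    #|[set c : C | #|[set v | f v == c]| == ceildiv #|T| k]| <= modstar #|T| k)).

Definition SE_choosable (k : nat) : Prop :=
  forall (C : finType) (L : T -> {set C}),
    (forall v, #|L v| = k) -> exists f : T -> C, SE_Lcoloring k L f.
End Graph.

(* Main.v *)
(* For a set W of vertices let b(W) be the sum of max(d(v) - 2, 0) in the subgraph
   induced by W, plus the number of its components that are cycles.  On a union of
   components without isolated vertices and without cycle components the potential is
   (eps_k / 2) b - |W|, and b has the parity of |V_1|; so the hypothesis bounds b(V)
   by a function of |V| that decreases by exactly k - 2 when k vertices are removed.
   The bound on small subgraphs is used only through 2-degeneracy.
   If y_1, ..., y_k are such that y_i has at most k - i neighbours outside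
   {y_1, ..., y_k}, then an SE colouring of the rest extends with distinct new colours,
   so by induction it suffices to find such vertices whose removal decreases b by k - 2.
   If there are none, every vertex of degree at least 3 pays for its neighbours of
   degree at most 2, and the total charge left leaves only a few graphs: a component
   K_{2,3} and subdivided cubic multigraphs on four vertices for k = 3, and, for both k,
   two vertices joined by 2k - 2 paths of length 3.  These are coloured by hand. *)
Require Import Defs.
From mathcomp Require Import all_boot all_order all_algebra.
From mathcomp Require Import zify.
From Stdlib Require Classical_Prop.
Set Implicit Arguments. Unset Strict Implicit. Unset Printing Implicit Defensive.

(** * Degrees inside a vertex set, and the charge under deletion of vertices *)

Section Degrees.
Variables (T : finType) (e : rel T).

(** The obstacle is that deleting a vertex may create a new cycle component. Such a cycle passes
    through a former neighbour of degree 3, whose lost unit of excess pays for it, so the charge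
    never grows and suitable deletions lower it. For k = 3 a gain of 1 is enough. For k = 4 the gain
    of 2 comes either from a triple and one more vertex, or from four vertices chosen together. The
    total charge left after discharging is at most 2, the bound on the potential, plus 1 for an
    isolated vertex; amounts are doubled to keep payments integral, so the working bound is 4. In
    two hubs joined by 2k - 2 paths the hub colours are found by counting: there are at least k(k -
    1) ordered pairs of distinct colours, and each path excludes at most one pair. *)

Definition nbr (W : {set T}) (v : T) : {set T} := [set w in W | e v w].
Definition dg (W : {set T}) (v : T) : nat := #|nbr W v|.

Lemma in_nbr W v w : (w \in nbr W v) = (w \in W) && e v w.
Proof. by rewrite inE. Qed.

Lemma nbrW W v w : w \in nbr W v -> w \in W.
Proof. by rewrite in_nbr => /andP[]. Qed.

Lemma nbrE W v w : w \in nbr W v -> e v w.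
Proof. by rewrite in_nbr => /andP[]. Qed.

Lemma nbr_sub W v : nbr W v \subset W.
Proof. by apply/subsetP=> w; apply: nbrW. Qed.

Lemma nbrS (W W' : {set T}) v : W' \subset W -> nbr W' v \subset nbr W v.
Proof.
move=> sub; apply/subsetP=> w; rewrite !in_nbr => /andP[wW ->].
by rewrite (subsetP sub).
Qed.

Lemma dgS (W W' : {set T}) v : W' \subset W -> dg W' v <= dg W v.
Proof. by move=> sub; rewrite subset_leq_card // nbrS. Qed.

Lemma dg0 v : dg set0 v = 0.
Proof. by apply: eq_card0 => x; rewrite !inE. Qed.

Lemma dg_del1 (W : {set T}) y v : y \in W -> dg (W :\ y) v + e v y = dg W v.
Proof.
move=> yW; rewrite /dg (cardsD1 y (nbr W v)) in_nbr yW addnC /=.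
by congr (_ + _); apply: eq_card => x; rewrite !inE andbA.
Qed.

Lemma dgD (W : {set T}) (s : seq T) v : uniq s -> {subset s <= W} ->
  dg (W :\: [set x in s]) v + count (e v) s = dg W v.
Proof.
elim: s W => [|y s IH] W /=.
  by move=> _ _; rewrite addn0; congr (dg _ v); apply/setP=> x; rewrite !inE.
case/andP=> ys us sW.
have yW : y \in W by apply: sW; rewrite inE eqxx.
rewrite -(dg_del1 v yW) -(IH (W :\ y) us); last first.
  move=> x xs; rewrite !inE sW ?inE ?xs ?orbT // andbT.
  by apply: contraNneq ys => <-.
have -> : W :\: [set x in y :: s] = (W :\ y) :\: [set x in s].
  by apply/setP=> x; rewrite !inE; case: (x == y); case: (x \in s).
lia.
Qed.

Definition degenerate2 := forall A : {set T}, A != set0 -> exists2 v, v \in A & dg A v <= 2.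

Definition excess (W : {set T}) := \sum_(v in W) (dg W v - 2).

(** A nonempty union of cycle components: degree 2 and closure under neighbours stand in for
    connectedness. *)
Definition cyclic (W K : {set T}) :=
  [&& K != set0, K \subset W
    & [forall x in K, (dg W x == 2) && (nbr W x \subset K)]].

Definition hits (W X : {set T}) :=
  forall K : {set T}, cyclic W K -> ~~ [disjoint K & X].

(* The least possible [#|X|] is the number of components of [W] that are cycles. *)
Definition charge_le (W : {set T}) (m : nat) :=
  exists2 X : {set T}, hits W X & excess W + #|X| <= m.

Lemma cyclicP (W K : {set T}) : reflect
  [/\ K != set0, K \subset W &
      forall x, x \in K -> dg W x = 2 /\ nbr W x \subset K] (cyclic W K).
Proof.
apply: (iffP and3P) => -[K0 KW H]; split=> //.
  by move=> x xK; move/forall_inP: H => /(_ x xK) /andP[/eqP].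
by apply/forall_inP=> x xK; case: (H x xK) => -> ->.
Qed.

Lemma charge_leW W m m' : m <= m' -> charge_le W m -> charge_le W m'.
Proof. by move=> mm [X hX le]; exists X => //; apply: leq_trans mm. Qed.

Hypotheses (esym : symmetric e) (eirr : irreflexive e).

Lemma nbr_sym (W : {set T}) v w : v \in W -> w \in nbr W v -> v \in nbr W w.
Proof. by rewrite !in_nbr esym => -> /andP[]. Qed.

Lemma nbr_neq W v w : w \in nbr W v -> w != v.
Proof. by move/nbrE; apply: contraTneq => ->; rewrite eirr. Qed.

(** The vertex takes its own excess away, and each neighbour of degree at least 3 loses one unit. *)
Lemma excess_del (W : {set T}) y : y \in W ->
  excess W = excess (W :\ y) + (dg W y - 2) + #|[set w in nbr W y | 2 < dg W w]|.
Proof.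
move=> yW; rewrite /excess (big_setD1 y) //= addnC addnAC; congr (_ + _).
have -> : #|[set w in nbr W y | 2 < dg W w]|
          = \sum_(v in W :\ y) (e v y && (2 < dg W v) : nat).
  rewrite -sum1_card big_mkcond [RHS]big_mkcond; apply: eq_bigr => v _.
  rewrite !inE (esym v); case: eqP => [->|_]; first by rewrite eirr andbF.
  by case: (v \in W); case: (e y v); case: (2 < _).
rewrite -big_split; apply: eq_bigr => v _ /=.
by rewrite -(dg_del1 v yW); case: (e v y) => /=; lia.
Qed.

Definition three (W : {set T}) y := [set w in nbr W y | dg W w == 3].

(* A cyclic set created by deleting [y] contains a neighbour of [y] of degree 3, whose
   lost excess pays for a new element of [X]. *)
Lemma hits_del (W X : {set T}) y K : y \in W -> hits W X -> cyclic (W :\ y) K ->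
  [disjoint K & X :\ y] -> ~~ [disjoint K & three W y].
Proof.
move=> yW hX /cyclicP[K0 KW HK] dX; apply/negP=> d3.
have dW x : x \in K -> ~~ e x y.
  move=> xK; apply/negP=> exy; have [d2 _] := HK x xK.
  suff : x \in three W y by rewrite (disjointFr d3 xK).
  have := dg_del1 x yW; rewrite exy d2 /three !inE esym exy => <-.
  by move: (subsetP KW _ xK); rewrite !inE => /andP[_ ->].
have : cyclic W K.
  apply/cyclicP; split=> //; first by apply: subset_trans KW (subsetDl _ _).
  move=> x xK; have [d2 nK] := HK x xK; split.
    by rewrite -(dg_del1 x yW) d2 (negbTE (dW x xK)).
  apply/subsetP=> w; rewrite in_nbr => /andP[wW exw].
  apply: (subsetP nK); rewrite !inE wW exw !andbT.
  by apply: contraTneq exw => ->; apply: dW.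
move/hX/pred0Pn=> [x /andP[/= xK xX]].
have := disjointFr dX xK; rewrite !inE xX andbT.
by move: (subsetP KW _ xK); rewrite !inE => /andP[-> _].
Qed.

(** The degree-3 neighbours of [y] drop to degree 2; every new cycle component contains one of
    them. *)
Definition shifted W X y := (X :\ y) :|: three W y.

Lemma hits_shifted (W X : {set T}) y : y \in W -> hits W X -> hits (W :\ y) (shifted W X y).
Proof.
move=> yW hX K cK; rewrite -setI_eq0 setIUr setU_eq0 !setI_eq0 negb_and.
case: (boolP [disjoint K & X :\ y]) => //= dX.
exact: hits_del yW hX cK dX.
Qed.

(** A neighbour of degree 3 spends its lost unit of excess on joining the hitting set; a neighbour
    of higher degree leaves it as a gain. *)
Lemma charge_shifted (W X : {set T}) y : y \in W ->
  excess (W :\ y) + #|shifted W X y| + (dg W y - 2) + (y \in X)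
    + #|[set w in nbr W y | 3 < dg W w]| <= excess W + #|X|.
Proof.
move=> yW; have leX := leq_of_leqif (leq_card_setU (X :\ y) (three W y)).
have -> : #|X| = (y \in X) + #|X :\ y| by rewrite [LHS](cardsD1 y).
rewrite (excess_del yW) -(cardsID [set w | dg W w == 3] [set w in nbr W y | 2 < dg W w]).
have -> : [set w in nbr W y | 2 < dg W w] :&: [set w | dg W w == 3] = three W y.
  by apply/setP=> w; rewrite !inE; case: eqP => [->|]; rewrite ?andbT ?andbF.
have -> : [set w in nbr W y | 2 < dg W w] :\: [set w | dg W w == 3]
          = [set w in nbr W y | 3 < dg W w].
  by apply/setP=> w; rewrite !inE; case: (w \in W); case: (e y w) => /=; lia.
by rewrite /shifted; lia.
Qed.

Lemma charge_del (W X : {set T}) y : y \in W -> hits W X ->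
  charge_le (W :\ y)
    (excess W + #|X| - (dg W y - 2) - (y \in X)
     - #|[set w in nbr W y | 3 < dg W w]|).
Proof.
move=> yW hX; exists (shifted W X y); first exact: hits_shifted.
by have := charge_shifted X yW; lia.
Qed.

(** After the deletion of [a], the vertex [b] still has degree at least 3, unless it had degree 3
    and was adjacent to [a]; then it has joined the hitting set, and deleting it saves that unit. *)
Lemma charge_del2 (W : {set T}) a b m : a \in W -> b \in W -> a != b ->
  2 < dg W a -> 2 < dg W b -> charge_le W m -> charge_le ((W :\ a) :\ b) (m - 2).
Proof.
move=> aW bW ab da db [X hX le].
have bWa : b \in W :\ a by rewrite in_setD1 eq_sym ab.
apply: charge_leW (charge_del bWa (hits_shifted aW hX)).
have := charge_shifted X aW; have := dg_del1 b aW.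
case eba : (e b a); last by lia.
have [db3|] : dg W b = 3 \/ 3 < dg W b by lia.
  have -> : b \in shifted W X a by rewrite !inE bW esym eba db3 /= orbT.
  lia.
lia.
Qed.

Lemma charge_le_del (W : {set T}) y m : y \in W -> charge_le W m ->
  charge_le (W :\ y) (m - (dg W y - 2) - #|[set w in nbr W y | 3 < dg W w]|).
Proof.
move=> yW [X hX le]; apply: charge_leW (charge_del yW hX).
by lia.
Qed.

Lemma charge_le_sub (W W' : {set T}) m : W' \subset W -> charge_le W m -> charge_le W' m.
Proof.
move En: #|W :\: W'| => n; elim: n W En => [|n IH] W En sub ch.
  suff -> : W' = W by [].
  by apply/eqP; rewrite eqEsubset sub -setD_eq0 -cards_eq0 En.
have [y yD] : exists y, y \in W :\: W' by apply/set0Pn; rewrite -cards_eq0 En.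
have /setDP[yW yW'] := yD.
apply: (IH (W :\ y)).
- by move: En; rewrite setDDl setUC -setDDl (cardsD1 y) yD => -[].
- by rewrite subsetD1 sub.
by apply: charge_leW (charge_le_del yW ch); lia.
Qed.

(* Either deleting [y] pays for its neighbour [w] of degree 3, or [w] is the
   attachment of a pendant cycle, and then it starts a path w, v, u whose last
   two vertices have degree 2. *)
Lemma charge_del_three (W X : {set T}) y w : y \in W -> hits W X -> w \in three W y ->
  charge_le (W :\ y) (excess W + #|X| - 1) \/
  exists v u, [/\ [/\ v \in W, u \in W & u != w], e w v, e v u,
                  dg W v = 2 & dg W u = 2].
Proof.
move=> yW hX w3; have [wN dw3] : w \in nbr W y /\ dg W w = 3.
  by move: w3; rewrite inE => /andP[? /eqP].
pose X1 := (X :\ y) :|: (three W y :\ w).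
case: (boolP [forall K, cyclic (W :\ y) K ==> ~~ [disjoint K & X1]]) => [H|].
  left; exists X1; first by move=> K cK; apply: (implyP (forallP H K)).
  have leX := leq_of_leqif (leq_card_setU (X :\ y) (three W y :\ w)).
  have := subset_leq_card (subsetDl X [set y]).
  have := cardsD1 w (three W y); rewrite w3 => c3 cX.
  rewrite (excess_del yW).
  have : three W y \subset [set w in nbr W y | 2 < dg W w].
    by apply/subsetP=> x; rewrite !inE => /andP[-> /eqP->].
  move/subset_leq_card; rewrite /X1; lia.
rewrite negb_forall => /existsP[K]; rewrite negb_imply negbK => /andP[cK dK].
have : [disjoint K & X :\ y] /\ [disjoint K & three W y :\ w].
  by move: dK; rewrite -!setI_eq0 setIUr setU_eq0 => /andP[].
case=> dX dt; right.
(* A cyclic [K] missed by [X1] meets the degree-3 neighbours of [y] only in [w], so all its other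
   vertices have degree 2 in [W] as well. *)
have wK : w \in K.
  have /pred0Pn[x /andP[/= xK x3]] := hits_del yW hX cK dX.
  have := disjointFr dt xK; rewrite in_setD1 x3 andbT => /negbT.
  by rewrite negbK => /eqP <-.
have /cyclicP[_ KW HK] := cK.
have deg2 x : x \in K -> x != w -> dg W x = 2.
  move=> xK xw; have [d2 _] := HK x xK; rewrite -(dg_del1 x yW) d2.
  case exy: (e x y) => //.
  have xW : x \in W by move: (subsetP KW _ xK); rewrite !inE => /andP[].
  have : x \in three W y :\ w.
    by rewrite !inE xw xW esym exy -(dg_del1 x yW) d2 exy.
  by rewrite (disjointFr dt xK).
have KW' x : x \in K -> x \in W by move/(subsetP KW); rewrite !inE => /andP[].
have [dw nw] := HK w wK.
have [v vN] : exists v, v \in nbr (W :\ y) w by apply/card_gt0P; rewrite -/(dg _ _) dw.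
have vK := subsetP nw _ vN; have [dv nv] := HK v vK.
have [u uN] : exists u, u \in nbr (W :\ y) v :\ w.
  by apply/card_gt0P; have := cardsD1 w (nbr (W :\ y) v); rewrite -/(dg _ _) dv; clear; lia.
have [uw uN'] : u != w /\ u \in nbr (W :\ y) v by move: uN; rewrite in_setD1 => /andP[].
have uK := subsetP nv _ uN'.
exists v, u; split; rewrite ?deg2 ?KW' ?(nbrE vN) ?(nbrE uN') //.
exact: nbr_neq vN.
Qed.

End Degrees.

(** * Balanced colourings and their greedy extension by k distinct colours *)

Section Colouring.
Variables (T : finType) (e : rel T).
Hypotheses (esym : symmetric e) (eirr : irreflexive e).
Variables (k : nat) (C : finType) (L : T -> {set C}).
Hypothesis hL : forall v, #|L v| = k.

Definition proper_on (W : {set T}) (f : T -> C) :=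
  {in W, forall v, f v \in L v} /\ {in W &, forall v w, e v w -> f v != f w}.

Definition cls (W : {set T}) (f : T -> C) (c : C) : {set T} := [set v in W | f v == c].

(* For [#|W| = q * k + r] with [r < k], at most [r] classes have size [q + 1] and no
   class is larger; when [k] divides [#|W|] this says that no class exceeds [q]. *)
Definition balanced (W : {set T}) (f : T -> C) :=
  (forall c, #|cls W f c| <= (#|W| %/ k).+1) /\
  #|[set c | #|cls W f c| == (#|W| %/ k).+1]| <= #|W| %% k.

Definition good (W : {set T}) (f : T -> C) := proper_on W f /\ balanced W f.

Lemma proper_on_add (W : {set T}) (s : seq T) f g :
  proper_on W f -> {in s, forall y, y \notin W} -> {in s &, injective g} ->
  {in s, forall y, g y \in L y} ->
  {in s, forall y, {in nbr e W y, forall w, f w != g y}} ->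
  exists f', [/\ proper_on (W :|: [set x in s]) f', {in W, f' =1 f} & {in s, f' =1 g}].
Proof.
move=> [fL fP] sW gi gL gN; exists (fun x => if x \in s then g x else f x).
have fW x : x \in W -> (x \in s) = false by move=> xW; apply: contraTF xW => /sW.
split; last 2 first.
- by move=> x /fW ->.
- by move=> x ->.
split.
  move=> v; rewrite inE inE; case: ifP => [vs _|vs]; first exact: gL.
  by rewrite orbF => /fL.
have mix v w : v \in W -> w \in s -> e v w -> f v != g w.
  by move=> vW ws evw; apply: gN => //; rewrite in_nbr vW esym.
move=> v w; rewrite !inE; case vs: (v \in s); case ws: (w \in s); rewrite ?orbF.
- by move=> _ _ evw; apply: contraTneq evw => /gi -> //; rewrite eirr.
- by move=> _ wW evw; rewrite eq_sym mix // esym.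
- by move=> vW _ evw; rewrite mix.
- exact: fP.
Qed.

(** Adding [k] vertices raises the quotient by one and keeps the remainder, while each class grows
    by at most one; so a class of the new top size already had the old top size. *)
Lemma balanced_add (W Q : {set T}) f :
  0 < k -> #|Q| = k -> [disjoint W & Q] -> {in Q &, injective f} ->
  balanced W f -> balanced (W :|: Q) f.
Proof.
move=> k0 cQ dWQ fi [le cnt]; rewrite /balanced.
have -> : #|W :|: Q| = #|W| + k by rewrite cardsU (disjoint_setI0 dWQ) cards0 cQ subn0.
have q1 : (#|W| + k) %/ k = (#|W| %/ k).+1 by rewrite divnDr // divnn k0 addn1.
have clsQ c : #|cls (W :|: Q) f c| <= #|cls W f c| + 1.
  have -> : cls (W :|: Q) f c = cls W f c :|: cls Q f c.
    by apply/setP=> x; rewrite !inE andb_orl.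
  apply: leq_trans (leq_of_leqif (leq_card_setU _ _)) _; rewrite leq_add2l.
  apply/card_le1P=> x; rewrite inE => /andP[xQ /eqP fx] y.
  rewrite !inE; apply/andP/eqP => [[yQ /eqP fy]|->]; last by rewrite fx.
  by apply: fi => //; rewrite fx fy.
split=> [c|]; first by rewrite q1; have := clsQ c; have := le c; lia.
rewrite modnDr; apply: leq_trans cnt; apply: subset_leq_card.
apply/subsetP=> c; rewrite !inE q1 => /eqP H; apply/eqP.
by have := clsQ c; have := le c; lia.
Qed.

Lemma balanced_eq (W : {set T}) f f' : {in W, f =1 f'} -> balanced W f -> balanced W f'.
Proof.
move=> ff; have clsE c : cls W f c = cls W f' c.
  by apply/setP=> x; rewrite !inE; case xW: (x \in W) => //=; rewrite ff.
case=> le cnt; split=> [c|]; first by rewrite -clsE.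
by apply: leq_trans cnt; apply: subset_leq_card; apply/subsetP=> c; rewrite !inE clsE.
Qed.

Lemma good_add (W : {set T}) (s : seq T) f g : 0 < k ->
  good W f -> uniq s -> size s = k ->
  {in s, forall y, y \notin W} -> {in s &, injective g} ->
  {in s, forall y, g y \in L y} ->
  {in s, forall y, {in nbr e W y, forall w, f w != g y}} ->
  exists f', [/\ good (W :|: [set x in s]) f', {in W, f' =1 f} & {in s, f' =1 g}].
Proof.
move=> k0 [fP fB] us ss sW gi gL gN.
have [f' [f'P f'W f's]] := proper_on_add fP sW gi gL gN.
exists f'; split=> //; split=> //; apply: balanced_add => //.
- by rewrite cardsE (card_uniqP us).
- rewrite disjoint_sym -setI_eq0; apply/eqP/setP=> x; rewrite !inE.
  by case xs: (x \in s) => //=; rewrite (negbTE (sW x xs)).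
- by move=> x y; rewrite !inE => xs ys; rewrite !f's //; apply: gi.
- by apply: balanced_eq fB => x xW; rewrite f'W.
Qed.

Lemma balanced_inj (W : {set T}) f : #|W| < k -> {in W &, injective f} -> balanced W f.
Proof.
move=> lt fi; rewrite /balanced divn_small // modn_small //.
have cls1 c : #|cls W f c| <= 1.
  apply/card_le1P=> x; rewrite inE => /andP[xQ /eqP fx] y.
  rewrite !inE; apply/andP/eqP => [[yQ /eqP fy]|->]; last by rewrite fx.
  by apply: fi => //; rewrite fx fy.
split=> //; apply: leq_trans (leq_imset_card f W); apply: subset_leq_card.
apply/subsetP=> c; rewrite inE => /eqP/eqP; rewrite eqn_leq => /andP[_].
by case/card_gt0P=> x; rewrite inE => /andP[xW /eqP <-]; rewrite imset_f.
Qed.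

(** For [size s = k], the i-th vertex has to avoid i - 1 colours already used in [s] and those of at
    most k - i neighbours in [W], hence at most k - 1 in all. Edges inside [s] cost nothing, because
    its colours are distinct. *)
Fixpoint greedy (W : {set T}) (s : seq T) : bool :=
  if s is y :: s' then (dg e W y <= size s') && greedy W s' else true.

(** [U] holds the colours spent on earlier vertices, which makes the induction go through; [c0] is
    the default value at the empty sequence. *)
Lemma greedy_pick (W : {set T}) (s : seq T) f (U : {set C}) (c0 : C) :
  uniq s -> #|U| + size s <= k -> greedy W s ->
  exists g : T -> C,
    [/\ {in s &, injective g}, {in s, forall y, g y \in L y},
        {in s, forall y, g y \notin U} &
        {in s, forall y, {in nbr e W y, forall w, f w != g y}}].
Proof.
elim: s U => [|y s IH] U /=; first by exists (fun _ => c0).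
case/andP=> ys us leU /andP[dy gs].
have [c] : exists c, c \in L y :\: (U :|: f @: nbr e W y).
  apply/card_gt0P; rewrite cardsD.
  have := leq_of_leqif (leq_card_setU U (f @: nbr e W y)).
  have := leq_imset_card f (nbr e W y); rewrite -/(dg e W y) => le1 le2.
  have := subset_leq_card (subsetIr (L y) (U :|: f @: nbr e W y)).
  by rewrite hL; lia.
rewrite !inE negb_or -andbA => /and3P[cU cN cL].
have leU1 : #|c |: U| + size s <= k by rewrite cardsU1 cU; lia.
  have [g [gi gL gU gN]] := IH (c |: U) us leU1 gs.
exists (fun x => if x == y then c else g x).
have sy x : x \in s -> (x == y) = false by move=> xs; apply: contraNF ys => /eqP <-.
split.
- move=> x x'; rewrite !inE; case: eqP => [->|_] /=.
    case: eqP => [->|_] //= _ x's cg; case/negP: (gU x' x's).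
    by rewrite -cg !inE eqxx.
  case: eqP => [->|_] //= xs x's cg; last exact: gi.
  by case/negP: (gU x xs); rewrite cg !inE eqxx.
- by move=> x; rewrite inE; case: eqP => [->|_] //= xs; apply: gL.
- move=> x; rewrite inE; case: eqP => [->|_] //= xs.
  by have := gU x xs; rewrite !inE negb_or => /andP[].
- move=> x; rewrite inE; case: eqP => [->|_] //= xs w wN; last exact: gN.
  by apply: contraNneq cN => <-; apply: imset_f.
Qed.

Definition colourable (W : {set T}) := exists f, good W f.

Lemma greedy_colourable (W : {set T}) (s : seq T) :
  0 < k -> uniq s -> size s = k -> {subset s <= W} -> greedy (W :\: [set x in s]) s ->
  colourable (W :\: [set x in s]) -> colourable W.
Proof.
move=> k0 us ss sW gs [f fG].
case: s us ss sW gs fG => [|y s'] us ss sW gs fG; first by rewrite -ss in k0.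
set s := y :: s' in us ss sW gs fG *.
have [|g [gi gL _ gN]] := @greedy_pick (W :\: [set x in s]) s f set0 (f y) us _ gs.
  by rewrite cards0 ss.
have [|f' [f'G _ _]] := good_add k0 fG us ss _ gi gL gN.
  by move=> x xs; rewrite inE in_set xs.
exists f'; suff <- : (W :\: [set x in s]) :|: [set x in s] = W by [].
apply/setP=> x; rewrite !inE; case xs: (x == y) => /=.
  by rewrite (eqP xs) sW // inE eqxx.
by case x's: (x \in s') => //=; rewrite ?orbF // sW // inE x's orbT.
Qed.

Lemma greedy_set0 s : greedy set0 s.
Proof. by elim: s => //= y s ->; rewrite dg0. Qed.

Lemma colourable_small (W : {set T}) (c0 : C) : #|W| < k -> colourable W.
Proof.
move=> lt; have [|g [gi gL _ _]] :=
  @greedy_pick set0 (enum W) (fun _ => c0) set0 c0 (enum_uniq _) _ (greedy_set0 _).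
  by rewrite cards0 -cardE ltnW.
have gi' : {in W &, injective g} by move=> x y xW yW; apply: gi; rewrite mem_enum.
exists g; split; last exact: balanced_inj.
split=> [x xW|x y xW yW exy]; first by apply: gL; rewrite mem_enum.
by apply: contraTneq exy => /gi' -> //; rewrite eirr.
Qed.

End Colouring.

(** * Removable sequences *)

Section Reductions.
Variables (T : finType) (e : rel T).
Hypotheses (esym : symmetric e) (eirr : irreflexive e) (degen : degenerate2 e).

Definition reducible k (W : {set T}) m := exists s : seq T,
  [/\ uniq s, size s = k, {subset s <= W}, greedy e (W :\: [set x in s]) s
    & charge_le e (W :\: [set x in s]) (m - (k - 2))].

(** The end of a greedy order: at most 2, 1 and 0 neighbours outside the triple, expressed through
    degrees in [W]. *)
Definition triple (W : {set T}) y1 y2 y3 :=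
  [/\ uniq [:: y1; y2; y3], [/\ y1 \in W, y2 \in W & y3 \in W],
      dg e W y1 <= 2 + (e y1 y2 + e y1 y3),
      dg e W y2 <= 1 + (e y2 y1 + e y2 y3)
    & dg e W y3 <= e y3 y1 + e y3 y2].

Lemma triple_greedy (W : {set T}) y1 y2 y3 : triple W y1 y2 y3 ->
  greedy e (W :\: [set x in [:: y1; y2; y3]]) [:: y1; y2; y3].
Proof.
case=> us [W1 W2 W3] d1 d2 d3.
have sub : {subset [:: y1; y2; y3] <= W}.
  by move=> x; rewrite !inE => /or3P[]/eqP->.
have := dgD e y1 us sub; have := dgD e y2 us sub; have := dgD e y3 us sub.
rewrite /= !eirr /= => E3 E2 E1; apply/and4P; split=> //.
- by move: E1 d1; clear; lia.
- by move: E2 d2; clear; lia.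
- by move: E3 d3; clear; lia.
Qed.

Lemma greedyS (W W' : {set T}) s : W' \subset W -> greedy e W s -> greedy e W' s.
Proof.
move=> sub; elim: s => //= y s IH /andP[dy /IH ->]; rewrite andbT.
exact: leq_trans (dgS e y sub) dy.
Qed.

(** Among the vertices of degree above [t], degeneracy gives one with at most two neighbours of that
    kind; having more than two neighbours, it has a light one. *)
Lemma exists_light_nbr (W : {set T}) t h : 2 <= t -> h \in W -> t < dg e W h ->
  exists v u, [/\ v \in W, t < dg e W v, u \in nbr e W v & dg e W u <= t].
Proof.
move=> t2 hW dh; pose A := [set v in W | t < dg e W v].
have [|v vA dv] := degen (A := A); first by apply/set0Pn; exists h; rewrite inE hW.
have := vA; rewrite inE => /andP[vW dgv].
have [u] : exists u, u \in nbr e W v :\: A.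
  apply/card_gt0P; rewrite cardsD.
  suff -> : nbr e W v :&: A = nbr e A v by move: dgv dv; rewrite /dg; lia.
  by apply/setP=> x; rewrite !inE; case: (x \in W); case: (e v x); rewrite ?andbF ?andbT.
rewrite in_setD inE => /andP[uA uN]; exists v, u; split=> //.
by move: uA; rewrite (nbrW uN) -leqNgt.
Qed.

(* For [k = 4] this supplies the fourth vertex, to be coloured before a triple. *)
Lemma charge_del_light (W : {set T}) m : W != set0 -> charge_le e W m ->
  exists y, [/\ y \in W, dg e W y <= 3 & charge_le e (W :\ y) (m - 1)].
Proof.
move=> W0 chW; have [X hX le] := chW.
have [ex0|/eqP ex0] := eqVneq (excess e W) 0.
  have dW v : v \in W -> dg e W v <= 2.
    move=> vW; have := ex0; rewrite /excess (bigD1 v) //=; lia.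
  (* With zero excess, either [X] misses [W], so that there are no cycle components and the charge
     is 0, or deleting a vertex of [X] saves its unit. *)
  have [XW|] := boolP [disjoint W & X].
    have [v vW _] := degen W0; exists v; split=> //; first by have := dW v vW; lia.
    suff : charge_le e W 0 by move/(charge_le_sub esym eirr (subD1set W v)); apply: charge_leW.
    exists set0; last by rewrite ex0 cards0.
    move=> K cK; have := hX K cK; have /cyclicP[_ KW _] := cK.
    by rewrite (disjointWl KW XW).
  case/pred0Pn=> y /andP[/= yW yX]; exists y; split=> //.
    by have := dW y yW; lia.
  by apply: charge_leW (charge_del esym eirr yW hX); rewrite yX; lia.
have [v3 /andP[v3W /eqP dv3]|no3] := pickP [pred v in W | dg e W v == 3].
  exists v3; split=> //; first by rewrite dv3.
  by apply: charge_leW (charge_le_del esym eirr v3W chW); rewrite dv3; lia.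
have [v0 /andP[v0W v04]] : exists v0, (v0 \in W) && (3 < dg e W v0).
  apply/existsP; apply: contraT => /existsPn H; case: ex0.
  rewrite /excess big1 // => v vW.
  by have := no3 v; have := H v; rewrite /= vW /=; lia.
(* No degree equals 3 here, so [u] has degree at most 2. Its deletion gains a unit at [v], whose
   degree stays at least 3 and so opens no new cycle. *)
have [v [u [vW v4 uN du3]]] := exists_light_nbr (leqnSn 2) v0W v04.
have [uW evu] := (nbrW uN, nbrE uN).
have du : dg e W u <= 2 by have := no3 u; rewrite /= uW /=; lia.
exists u; split=> //.
have : v \in [set w in nbr e W u | 3 < dg e W w] by rewrite !inE vW esym evu v4.
move=> vin; apply: charge_leW (charge_le_del esym eirr uW chW).
have : 0 < #|[set w in nbr e W u | 3 < dg e W w]| by apply/card_gt0P; exists v.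
lia.
Qed.

Lemma triple_reducible k (W : {set T}) m y1 y2 y3 :
  k = 3 \/ k = 4 -> k < #|W| -> triple W y1 y2 y3 ->
  charge_le e (W :\: [set x in [:: y1; y2; y3]]) (m - 1) -> reducible k W m.
Proof.
move=> k34 ltk tr ch; have [us [W1 W2 W3] _ _ _] := tr.
have gr := triple_greedy tr; set s := [:: y1; y2; y3] in us ch gr *.
have sub : {subset s <= W} by move=> x; rewrite !inE => /or3P[]/eqP->.
have cs : #|[set x in s]| = 3 by rewrite cardsE (card_uniqP us).
case: k34 => k34; rewrite {}k34 in ltk *; first by exists s; split=> //.
have W'0 : W :\: [set x in s] != set0.
  rewrite -card_gt0 cardsD.
  by have := subset_leq_card (subsetIr W [set x in s]); rewrite cs; lia.
have [y [yW' dy chy]] := charge_del_light W'0 ch.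
have [ys yW] : y \notin s /\ y \in W.
  by move: yW'; rewrite in_setD in_set => /andP[].
have eqD : W :\: [set x in y :: s] = (W :\: [set x in s]) :\ y.
  by apply/setP=> x; rewrite in_setD1 !in_setD !in_set inE negb_or andbA.
exists (y :: s); split=> //.
- by rewrite /= ys.
- by move=> x; rewrite inE => /orP[/eqP->|/sub].
- rewrite eqD /= -/s; apply/andP; split; first exact: leq_trans (dgS _ _ (subD1set _ _)) dy.
  exact: greedyS (subD1set _ _) gr.
- by rewrite eqD; apply: charge_leW chy; clear; lia.
Qed.

End Reductions.

(** * What a triple implies in an irreducible set *)

Section Irreducible.
Variables (T : finType) (e : rel T).
Hypotheses (esym : symmetric e) (eirr : irreflexive e) (degen : degenerate2 e).
Variables (k : nat) (W : {set T}) (m : nat).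
Hypotheses (k34 : k = 3 \/ k = 4) (ltk : k < #|W|).
Hypotheses (chW : charge_le e W m) (irr : ~ reducible e k W m).

Notation N := (nbr e W).
Notation d := (dg e W).

Lemma no_paying_triple y1 y2 y3 :
  triple e W y1 y2 y3 -> ~ charge_le e (W :\: [set x in [:: y1; y2; y3]]) (m - 1).
Proof. by move=> tr /(triple_reducible esym eirr degen k34 ltk tr). Qed.

(** Further deletions never raise the charge, so one profitable member would make the whole triple
    profitable. *)
Lemma triple_del y y1 y2 y3 : y \in [:: y1; y2; y3] -> triple e W y1 y2 y3 ->
  ~ charge_le e (W :\ y) (m - 1).
Proof.
move=> ys tr ch; apply: (no_paying_triple tr); apply: charge_le_sub ch => //.
by apply: setDS; apply/subsetP=> x /set1P ->; rewrite in_set.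
Qed.

Lemma triple_small y y1 y2 y3 : y \in [:: y1; y2; y3] -> triple e W y1 y2 y3 -> d y <= 2.
Proof.
move=> ys tr; rewrite leqNgt; apply/negP=> dy; apply: (triple_del ys tr).
have yW : y \in W.
  by case: tr => _ [W1 W2 W3] _ _ _; move: ys; rewrite !inE => /or3P[]/eqP->.
by apply: charge_leW (charge_le_del esym eirr yW chW); lia.
Qed.

(** Deleting [y] gains a unit at a neighbour [w] of degree at least 4. At degree 3 the gain can fail
    only if [w] carries a pendant cycle, and then [w, u, v] on that cycle is a triple with a member
    of degree 3. *)
Lemma triple_far y w y1 y2 y3 : y \in [:: y1; y2; y3] -> triple e W y1 y2 y3 ->
  w \in N y -> d w <= 2.
Proof.
move=> ys tr wN; rewrite leqNgt; apply/negP=> dw.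
have yW : y \in W.
  by case: tr => _ [W1 W2 W3] _ _ _; move: ys; rewrite !inE => /or3P[]/eqP->.
have nch := triple_del ys tr; have [dw3|dw4] : d w = 3 \/ 3 < d w by lia.
  have [X hX le] := chW; have w3 : w \in three e W y by rewrite inE wN dw3 /=.
  case: (charge_del_three esym eirr yW hX w3) => [|[v [u [[vW uW uw] ewv evu dv du]]]].
    by move=> ch; apply: nch; apply: charge_leW ch; lia.
  have tr' : triple e W w u v.
    have ne x z : e x z -> x != z by apply: contraTneq => ->; rewrite eirr.
    split; rewrite ?dw3 ?du ?dv ?vW ?uW ?(nbrW wN) //=.
    - by rewrite !inE (eq_sym w) negb_or uw (ne _ _ ewv) (eq_sym u) (ne _ _ evu).
    - by rewrite ewv; case: (e w u).
    - by rewrite (esym u v) evu; case: (e u w).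
    - by rewrite (esym v w) ewv evu.
  by have := triple_small (mem_head w _) tr'; rewrite dw3.
have win : w \in [set w in N y | 3 < d w] by rewrite inE wN.
apply: nch; apply: charge_leW (charge_le_del esym eirr yW chW).
have : 0 < #|[set w in N y | 3 < d w]| by apply/card_gt0P; exists w.
lia.
Qed.

(** A vertex of the hitting set on a cycle ends a triple that starts with its two neighbours, and
    its deletion saves a unit. *)
Lemma no_cyclic K : ~~ cyclic e W K.
Proof.
apply/negP=> cK; have [X hX le] := chW.
have /pred0Pn[x /andP[/= xK xX]] := hX K cK.
have /cyclicP[_ /subsetP KW HK] := cK.
have [dx /subsetP Nx] := HK x xK.
have /eqP/cards2P[p [q [pq defN]]] : #|N x| = 2 by [].
have [pN qN] : p \in N x /\ q \in N x by rewrite defN !inE !eqxx orbT.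
have [dp _] := HK p (Nx p pN); have [dq _] := HK q (Nx q qN).
have tr : triple e W p q x.
  split; rewrite ?dp ?dq ?dx ?(KW _ xK) ?(KW _ (Nx _ pN)) ?(KW _ (Nx _ qN)) //=.
  - by rewrite !inE negb_or pq (nbr_neq eirr pN) (nbr_neq eirr qN).
  - by rewrite (esym q x) (nbrE qN); case: (e q p).
  - by rewrite (nbrE pN) (nbrE qN).
have xin : x \in [:: p; q; x] by rewrite !inE eqxx !orbT.
apply: (triple_del xin tr).
by apply: charge_leW (charge_del esym eirr (KW _ xK) hX); rewrite xX; lia.
Qed.

End Irreducible.

(** * Local structure of an irreducible set *)

Section Structure.
Variables (T : finType) (e : rel T).
Hypotheses (esym : symmetric e) (eirr : irreflexive e) (degen : degenerate2 e).
Variables (k : nat) (W : {set T}) (m : nat).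
Hypotheses (k34 : k = 3 \/ k = 4) (ltk : k < #|W|).
Hypotheses (chW : charge_le e W m) (irr : ~ reducible e k W m).

Notation N := (nbr e W).
Notation d := (dg e W).

Lemma card_gt3 : 3 < #|W|. Proof. by case: k34 ltk => ->; lia. Qed.

Lemma nbr_nonempty x : 0 < d x -> exists y, y \in N x.
Proof. by move/card_gt0P. Qed.

Lemma tripleI y1 y2 y3 : y1 \in W -> y2 \in W -> y3 \in W ->
  y1 != y2 -> y1 != y3 -> y2 != y3 ->
  d y1 <= 2 + (e y1 y2 + e y1 y3) -> d y2 <= 1 + (e y1 y2 + e y2 y3) ->
  d y3 <= e y1 y3 + e y2 y3 -> triple e W y1 y2 y3.
Proof.
move=> W1 W2 W3 n12 n13 n23 d1 d2 d3; split=> //.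
- by rewrite /= !inE negb_or n12 n13 n23.
- by rewrite (esym y2 y1).
- by rewrite (esym y3 y1) (esym y3 y2).
Qed.

Lemma triple_contra y w y1 y2 y3 : triple e W y1 y2 y3 -> y \in [:: y1; y2; y3] ->
  w \in W -> (w == y) || e y w -> 2 < d w -> False.
Proof.
move=> tr ys wW /orP[/eqP->|eyw] dw.
  by have := triple_small esym eirr degen k34 ltk chW irr ys tr; lia.
have wN : w \in N y by rewrite in_nbr wW.
by have := triple_far esym eirr degen k34 ltk chW irr ys tr wN; lia.
Qed.

(** Degeneracy of the remaining set supplies a first vertex for any triple that is to end in [a] and
    [b]. *)
Lemma light2 a b : a \in W -> b \in W -> a != b ->
  exists y, [/\ y \in W, y != a, y != b & d y <= 2 + (e y a + e y b)].
Proof.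
move=> aW bW ab; have us : uniq [:: a; b] by rewrite /= inE ab.
have sub : {subset [:: a; b] <= W} by move=> x; rewrite !inE => /orP[]/eqP->.
have [|y] := degen (A := W :\: [set x in [:: a; b]]).
  rewrite -card_gt0 cardsD; have := card_gt3.
  have cs : #|[set x in [:: a; b]]| = 2 by rewrite cardsE (card_uniqP us).
  by have := subset_leq_card (subsetIr W [set x in [:: a; b]]); rewrite cs; lia.
rewrite in_setD in_set !inE negb_or => /andP[/andP[ya yb] yW] dy.
exists y; split=> //; have := dgD e y us sub; rewrite [count _ _]/=; move: dy; clear; lia.
Qed.

Lemma light3 a b c : a \in W -> b \in W -> c \in W -> uniq [:: a; b; c] ->
  exists y, [/\ y \in W, y \notin [:: a; b; c] & d y <= 2 + (e y a + (e y b + e y c))].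
Proof.
move=> aW bW cW us.
have sub : {subset [:: a; b; c] <= W} by move=> x; rewrite !inE => /or3P[]/eqP->.
have [|y] := degen (A := W :\: [set x in [:: a; b; c]]).
  rewrite -card_gt0 cardsD; have := card_gt3.
  have cs : #|[set x in [:: a; b; c]]| = 3 by rewrite cardsE (card_uniqP us).
  by have := subset_leq_card (subsetIr W [set x in [:: a; b; c]]); rewrite cs; lia.
rewrite in_setD in_set => /andP[ys yW] dy.
exists y; split=> //; have := dgD e y us sub; rewrite [count _ _]/=; move: dy; clear; lia.
Qed.

Lemma neq_nbr x y : y \in N x -> (x != y) * (y != x) * e x y * e y x * (y \in W).
Proof.
move=> yN; have n := nbr_neq eirr yN; rewrite (eq_sym x) n.
by rewrite (esym y) (nbrE yN) (nbrW yN).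
Qed.

Lemma no_cyc K : ~~ cyclic e W K.
Proof. by apply: (no_cyclic esym eirr degen k34 ltk chW irr). Qed.

(** Otherwise the charge is 0, so any triple would be profitable; but maximum degree 2 without cycle
    components leaves vertices of degree at most 1, with which a triple can end. *)
Lemma exists_big : exists2 h, h \in W & 2 < d h.
Proof.
case: (boolP [exists h in W, 2 < d h]) => [/exists_inP[h hW dh]|nbig].
  by exists h.
have dW x : x \in W -> d x <= 2.
  by move=> xW; rewrite leqNgt; apply: contra nbig => dx; apply/exists_inP; exists x.
have W0 : charge_le e W 0.
  exists set0; first by move=> K cK; case/negP: (no_cyc K).
  by rewrite cards0 addn0 leqn0 /excess big1 // => v /dW; lia.
have none y1 y2 y3 : ~ triple e W y1 y2 y3.
  move=> /(no_paying_triple esym eirr degen k34 ltk irr); apply.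
  apply: charge_leW (charge_le_sub esym eirr (subsetDl _ _) W0); lia.
have [y3 y3W d3] : exists2 y3, y3 \in W & d y3 <= 1.
  apply/exists_inP; apply: contraT => /exists_inPn H; case/negP: (no_cyc W).
  apply/cyclicP; split=> //; first by rewrite -card_gt0; have := card_gt3; lia.
  by move=> x xW; rewrite nbr_sub; have := H x xW; have := dW x xW; split=> //; lia.
(* A leaf is preceded by its neighbour. An isolated vertex is preceded by another vertex of degree
   at most 1, which exists since otherwise the rest would be a union of cycles. *)
have [d30|d30] := posnP (d y3); last first.
  have [x xN] := nbr_nonempty d30; have neq := neq_nbr xN.
  have [|y [yW y3n yx dy]] := @light2 y3 x y3W (nbrW xN); first by rewrite neq.
  have [dy' dx] := (dW y yW, dW x (nbrW xN)).
  by case: (@none y x y3); apply: tripleI; rewrite ?neq //; move: dy' dx d3; clear; lia.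
have none3 x : x \in W -> e x y3 = false.
  move=> xW; apply/negP=> ex3; move: d30; apply/eqP; rewrite -lt0n.
  by apply/card_gt0P; exists x; rewrite in_nbr xW esym.
have [y2 [y2W n23 d2]] : exists y2, [/\ y2 \in W, y2 != y3 & d y2 <= 1].
  have [y /and3P[? ? ?]|H] := pickP [pred y in W | (y != y3) && (d y <= 1)].
    by exists y.
  case/negP: (no_cyc (W :\ y3)); apply/cyclicP; split.
  - by rewrite -card_gt0; have := cardsD1 y3 W; have := card_gt3; lia.
  - exact: subD1set.
  move=> x; rewrite in_setD1 => /andP[x3 xW]; split.
    by have := H x; rewrite /= xW x3 /=; have := dW x xW; lia.
  apply/subsetP=> z zN; rewrite in_setD1 (nbrW zN) andbT.
  by apply: contraTneq (nbrE zN) => ->; rewrite none3.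
have [|y1 [y1W n12 n13 d1]] := @light2 y2 y3 y2W y3W; first by [].
by case: (@none y1 y2 y3); apply: tripleI => //; move: d1 d2 d30; clear; lia.
Qed.

Definition big := [set v in W | 2 < d v].
Definition small := W :\: big.

Lemma in_big v : (v \in big) = (v \in W) && (2 < d v).
Proof. by rewrite inE. Qed.

Lemma in_small v : (v \in small) = (v \in W) && (d v <= 2).
Proof. by rewrite in_setD in_big; case: (v \in W); rewrite ?andbF //= -leqNgt andbT. Qed.

Lemma exists_small_big : exists u h, [/\ h \in W, 2 < d h, u \in N h & d u <= 2].
Proof.
have [h hW dh] := exists_big.
have [v [u [vW dv uN du]]] := exists_light_nbr degen (leqnn 2) hW dh.
by exists u, v.
Qed.

(** An isolated vertex can end any triple, so only two vertices with at most 2 and 1 outside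
    neighbours have to be found near [h]. *)
Lemma isolated_struct z u h : z \in W -> d z = 0 -> h \in W -> 2 < d h -> u \in N h ->
  d u <= 2 -> d u = 2 /\ forall x, x \in N u -> 3 < d x.
Proof.
move=> zW dz hW dh uN du; have neq := neq_nbr uN.
have z0 x : x \in W -> e x z = false.
  move=> xW; apply/negP=> ex3; move: dz; apply/eqP; rewrite -lt0n.
  by apply/card_gt0P; exists x; rewrite in_nbr xW esym.
have uz : u != z by apply: contraTneq (nbrE uN) => ->; rewrite z0.
have uW := nbrW uN.
have d2 : d u = 2.
  apply/eqP; rewrite eqn_leq du /= ltnNge; apply/negP=> du1.
  have [y [yW yu yz dy]] := light2 uW zW uz.
  have tr : triple e W y u z by apply: tripleI => //; move: dy du1 dz; clear; lia.
  by apply: (triple_contra (y := u) (w := h) tr); rewrite ?neq ?inE ?eqxx ?orbT.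
split=> // x xN; rewrite ltnNge; apply/negP=> dx; have nx := neq_nbr xN.
have xz : x != z by apply: contraTneq (nbrE xN) => ->; rewrite z0.
have tr : triple e W x u z by apply: tripleI => //; rewrite ?nx ?d2 //; move: dx dz; clear; lia.
by apply: (triple_contra (y := u) (w := h) tr); rewrite ?neq ?inE ?eqxx ?orbT.
Qed.

(** Two isolated vertices complete any small vertex to a triple, in particular one with a big
    neighbour. *)
Lemma isolated_unique z z' : z \in W -> z' \in W -> d z = 0 -> d z' = 0 -> z = z'.
Proof.
move=> zW z'W dz dz'; apply/eqP; apply: contraT => zz'.
have [u [h [hW dh uN du]]] := exists_small_big; have neq := neq_nbr uN.
have uW := nbrW uN.
have du0 : 0 < d u by apply/card_gt0P; exists h; rewrite in_nbr hW neq.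
have [uz uz'] : u != z /\ u != z' by split; apply: contraTneq du0 => ->; lia.
have tr : triple e W u z z' by apply: tripleI => //; move: du dz dz'; clear; lia.
by case: (triple_contra (y := u) (w := h) tr); rewrite ?neq ?inE ?eqxx ?orbT.
Qed.

Lemma two_nbrs x : d x = 2 -> exists p q, [/\ p != q, p \in N x, q \in N x & N x = [set p; q]].
Proof.
by move/eqP/cards2P=> [p [q [pq E]]]; exists p, q; rewrite E !inE !eqxx orbT.
Qed.

Lemma one_nbr x p : d x = 1 -> p \in N x -> N x = [set p].
Proof.
by move/eqP/cards1P=> [q E]; rewrite E inE => /eqP ->.
Qed.

Lemma small_has_big x : x \in W -> d x <= 2 -> 0 < d x -> exists2 h, h \in N x & 2 < d h.
Proof.
(* A small neighbour [p] and the leaf [y] end a triple. Either [p] has a big neighbour, or the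
   triple is started with a small neighbour of some big vertex. *)
have leaf_case y : y \in W -> d y = 1 -> exists2 h, h \in N y & 2 < d h.
  move=> yW dy; have [|p pN] := @nbr_nonempty y; first by rewrite dy.
  have np := neq_nbr pN; have [dp|dp] := ltnP 2 (d p); first by exists p.
  exfalso; have pW := nbrW pN; have py : p != y by rewrite np.
  case: (boolP [exists h in N p, 2 < d h]) => [/exists_inP[h hN dh]|nobig].
    have [q [qW qp qy dq]] := light2 pW yW py.
    have tr : triple e W q p y by apply: tripleI => //; rewrite ?np //; move: dq dp dy; clear; lia.
    by case: (triple_contra (y := p) (w := h) tr); rewrite ?(nbrW hN) ?(nbrE hN) ?inE ?eqxx ?orbT.
  have [u [h [hW dh uN du]]] := exists_small_big; have neq := neq_nbr uN.
  have hNu : h \in N u by rewrite in_nbr hW neq.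
  have uy : u != y.
    apply: contraTneq dh => uy; move: hNu; rewrite uy (one_nbr dy pN) inE => /eqP->; lia.
  have up : u != p.
    apply: contraNneq nobig => up; apply/exists_inP; exists h => //; by rewrite -up.
  have tr : triple e W u p y by apply: tripleI => //; rewrite ?np ?(nbrW uN) //; move: du dp dy; clear; lia.
  by case: (triple_contra (y := u) (w := h) tr); rewrite ?neq ?inE ?eqxx ?orbT.
move=> xW dx d0; case: (boolP [exists h in N x, 2 < d h]) => [/exists_inP//|nobig].
(* This set is cyclic: the neighbours [p] and [q] of such a [v] are small, so [p, q, v] is a triple
   and the neighbours of [p] and [q] are small too. *)
exfalso; pose K := [set v in W | (d v == 2) && ~~ [exists h in N v, 2 < d h]].
have xK : x \in K.
  rewrite inE xW nobig andbT /=; apply: contraNT nobig => dx2.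
  by apply/exists_inP; apply: leaf_case => //; lia.
case/negP: (no_cyc K); apply/cyclicP; split; first by apply/set0Pn; exists x.
  by apply/subsetP=> v; rewrite inE => /andP[].
move=> v; rewrite inE => /and3P[vW /eqP dv nb]; split=> //.
have small_nbr w : w \in N v -> d w <= 2.
  by move=> wN; rewrite leqNgt; apply: contra nb => dw; apply/exists_inP; exists w.
have [p [q [pq pN qN Nv]]] := two_nbrs dv.
have [np nq] := (neq_nbr pN, neq_nbr qN).
have tr : triple e W p q v.
  by apply: tripleI; rewrite ?np ?nq ?dv //; have := small_nbr p pN; have := small_nbr q qN; clear; lia.
apply/subsetP=> w wN; rewrite inE (nbrW wN) /=.
have wpq : w \in [:: p; q; v] by move: wN; rewrite Nv !inE => /orP[]->; rewrite ?orbT.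
have nbw : ~~ [exists h in N w, 2 < d h].
  apply/exists_inPn=> h hN; rewrite -leqNgt.
  exact: (triple_far esym eirr degen k34 ltk chW irr wpq tr hN).
rewrite nbw andbT; have := small_nbr w wN; have nw := neq_nbr wN.
have : 0 < d w by apply/card_gt0P; exists v; rewrite in_nbr vW nw.
have : d w != 1.
  apply: contraNneq nbw => dw1; apply/exists_inP.
  by apply: leaf_case => //; exact: nbrW wN.
by case: (d w) => [|[|[|n]]].
Qed.

(** Otherwise [x], [p] and the leaf form a triple with a big member; whether [p] is small decides
    which of [x] and [p] comes first. *)
Lemma leaf_three y x : y \in W -> d y = 1 -> x \in N y -> d x = 3 ->
  forall p, p \in N x -> p != y -> 3 < d p.
Proof.
move=> yW dy xN dx p pN py; rewrite ltnNge; apply/negP=> dp.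
have [nx np] := (neq_nbr xN, neq_nbr pN); have [xW pW] := (nbrW xN, nbrW pN).
case: (leqP (d p) 2) => dp2.
  have tr : triple e W x p y by apply: tripleI; rewrite ?nx ?np //; move: dx dp2 dy; clear; lia.
  by apply: (triple_contra (y := x) (w := x) tr); rewrite ?inE ?eqxx ?orbT ?dx.
have tr : triple e W p x y by apply: tripleI; rewrite ?nx ?np //; move: dx dp dy; clear; lia.
by apply: (triple_contra (y := x) (w := x) tr); rewrite ?inE ?eqxx ?orbT ?dx.
Qed.

Lemma leaf_four y x : y \in W -> d y = 1 -> x \in N y -> d x = 4 ->
  forall p, p \in N x -> p != y -> 2 < d p.
Proof.
move=> yW dy xN dx p pN py; rewrite ltnNge; apply/negP=> dp.
have [nx np] := (neq_nbr xN, neq_nbr pN); have [xW pW] := (nbrW xN, nbrW pN).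
have tr : triple e W x p y by apply: tripleI; rewrite ?nx ?np //; move: dx dp dy; clear; lia.
by apply: (triple_contra (y := x) (w := x) tr); rewrite ?inE ?eqxx ?orbT ?dx.
Qed.

(** Otherwise [h, u2, u1] is a triple: both neighbours of [u1] belong to it, and at most one of
    those of [u2] does not. *)
Lemma double_big h u1 u2 : h \in W -> 2 < d h -> u1 \in N h -> d u1 = 2 ->
  u2 \in N u1 -> d u2 = 2 -> 3 + (e h u2) < d h.
Proof.
move=> hW dh u1N d1 u2N d2; rewrite ltnNge; apply/negP=> dh3.
have [n1 n2] := (neq_nbr u1N, neq_nbr u2N); have [W1 W2] := (nbrW u1N, nbrW u2N).
have hu2 : h != u2 by apply: contraTneq dh => ->; rewrite d2.
have tr : triple e W h u2 u1 by apply: tripleI; rewrite ?n1 ?n2 ?d1 ?d2 //; lia.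
by apply: (triple_contra (y := h) (w := h) tr); rewrite ?inE ?eqxx ?orbT.
Qed.

Lemma no_triangle t a b : t \in W -> d t = 2 -> a \in N t -> b \in N t ->
  d a = 3 -> d b = 3 -> a != b -> e a b = false.
Proof.
move=> tW dt aN bN da db ab; apply/negP=> eab.
have [na nb] := (neq_nbr aN, neq_nbr bN); have [aW bW] := (nbrW aN, nbrW bN).
have tr : triple e W a b t by apply: tripleI; rewrite ?na ?nb ?dt ?eab //; lia.
by apply: (triple_contra (y := a) (w := a) tr); rewrite ?inE ?eqxx ?orbT ?da.
Qed.

End Structure.

(** * Discharging from big to small vertices *)

Section Discharging.
Variables (T : finType) (e : rel T).
Hypotheses (esym : symmetric e).
Variables (W : {set T}) (w : T -> T -> nat).

Notation N := (nbr e W).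
Notation d := (dg e W).
Notation B := (big e W).
Notation S := (small e W).

Definition isolated := [set u in W | d u == 0].

(* [slack_of c v] is twice the charge [c (d v - 2) - 1] of a big vertex [v], minus the
   amounts [w v u] that [v] pays to its small neighbours [u]. *)
Definition payment v := \sum_(u in N v :&: S) w v u.
Definition slack_of c v := 2 * c * (d v - 2) - 2 - payment v.

Lemma sum_paid : (forall u, u \in S -> 0 < d u -> \sum_(v in N u :&: B) w v u = 2) ->
  \sum_(v in B) payment v + 2 * #|isolated| = 2 * #|S|.
Proof.
move=> w2; rewrite /payment.
rewrite (exchange_big_dep (mem S)) /=; last by move=> v u _ /setIP[].
have -> : 2 * #|S| = \sum_(u in S) 2 by rewrite sum_nat_const mulnC.
have -> : 2 * #|isolated| = \sum_(u in S) (if d u == 0 then 2 else 0).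
  rewrite -big_mkcondr /= sum_nat_const mulnC; congr (_ * _); apply: eq_card => u.
  rewrite inE -[RHS]/((u \in S) && (d u == 0)) in_small.
  by case: (u \in W) => //=; case: eqP => [->|]; rewrite ?andbF.
rewrite -big_split; apply: eq_bigr => u uS /=.
have eqN : \sum_(i in B | u \in N i :&: S) w i u = \sum_(v in N u :&: B) w v u.
  apply: eq_bigl => v; have uW : u \in W by move: uS; rewrite in_small => /andP[].
  rewrite in_setI uS andbT !in_setI !in_nbr uW esym.
  by case: (boolP (v \in B)); rewrite ?andbF //= in_big => /andP[-> _]; rewrite andbT.
rewrite eqN; case: eqP => [d0|d0]; last by rewrite w2 //; lia.
rewrite big1 // => v; rewrite in_setI => /andP[vN _].
by move: d0; rewrite /dg => /eqP; rewrite cards_eq0 => /eqP E; rewrite E inE in vN.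
Qed.

Lemma sum_big_excess : \sum_(v in B) (d v - 2) = excess e W.
Proof.
rewrite /excess [RHS](bigID (mem B)) /= [X in _ + X]big1 ?addn0.
  by apply: eq_bigl => v; rewrite in_big; case: (v \in W).
by move=> v /andP[vW]; rewrite in_big vW /= -leqNgt; lia.
Qed.

Lemma card_big_small : #|W| = #|B| + #|S|.
Proof.
rewrite /small -(cardsID B W); congr (_ + _); apply: eq_card => v.
by rewrite !inE; case: (v \in W).
Qed.

(** Double counting of the payments; the bound on [payment] keeps the truncated subtraction in
    [slack_of] exact. With [c] equal to half of eps_k, the bound on the excess leaves a total slack
    of at most 4, plus 2 per isolated vertex. *)
Lemma sum_slack c : (forall u, u \in S -> 0 < d u -> \sum_(v in N u :&: B) w v u = 2) ->
  (forall v, v \in B -> 2 + payment v <= 2 * c * (d v - 2)) ->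
  \sum_(v in B) slack_of c v + 2 * #|W| = 2 * c * excess e W + 2 * #|isolated|.
Proof.
move=> w2 le; have := sum_paid w2.
have eqs : \sum_(v in B) slack_of c v + \sum_(v in B) (2 + payment v) = 2 * c * excess e W.
  rewrite -big_split -sum_big_excess big_distrr /=; apply: eq_bigr => v vB.
  by have := le v vB; rewrite /slack_of; lia.
have -> : \sum_(v in B) payment v = \sum_(v in B) (2 + payment v) - 2 * #|B|.
  by rewrite big_split /= sum_nat_const; lia.
have : 2 * #|B| <= \sum_(v in B) (2 + payment v) by rewrite big_split /= sum_nat_const; lia.
by rewrite card_big_small -eqs; lia.
Qed.

Lemma sum_sub (g : T -> nat) (s : seq T) :
  uniq s -> {subset s <= B} -> sumn (map g s) <= \sum_(v in B) g v.
Proof.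
move=> us sB; rewrite sumnE big_map big_uniq //= [leqRHS](bigID (mem s)) /=.
apply: leq_trans (leq_addr _ _); rewrite leq_eqVlt; apply/orP; left; apply/eqP.
by apply: eq_bigl => v; case vs: (v \in s); rewrite ?andbF // andbT; symmetry; apply: sB.
Qed.

Lemma paid_le c v (A : {set T}) : (forall u, u \in N v :&: S -> w v u <= c) ->
  N v :&: S \subset A -> payment v <= c * #|A|.
Proof.
move=> wc sub; apply: leq_trans (_ : \sum_(u in N v :&: S) c <= _).
  by apply: leq_sum => u; apply: wc.
by rewrite sum_nat_const mulnC leq_mul2l subset_leq_card // orbT.
Qed.

Lemma small_subD1 v x : x \in B -> N v :&: S \subset N v :\ x.
Proof.
move=> xB; apply/subsetP=> u /setIP[uN uS]; rewrite in_setD1 uN andbT.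
by apply: contraTneq uS => ->; rewrite inE xB.
Qed.

End Discharging.

(** * Small vertices as inner vertices of threads between big ones *)

Section Threads.
Variables (T : finType) (e : rel T).
Hypotheses (esym : symmetric e) (eirr : irreflexive e) (degen : degenerate2 e).
Variables (k : nat) (W : {set T}) (m : nat).
Hypotheses (k34 : k = 3 \/ k = 4) (ltk : k < #|W|).
Hypotheses (chW : charge_le e W m) (irr : ~ reducible e k W m).

Notation N := (nbr e W).
Notation d := (dg e W).
Notation B := (big e W).
Notation S := (small e W).

Lemma isolated_le1 : #|isolated e W| <= 1.
Proof.
apply/card_le1_eqP=> x y; rewrite !inE => /andP[xW /eqP dx] /andP[yW /eqP dy].
by apply: (isolated_unique esym eirr degen k34 ltk chW irr).
Qed.

Lemma bigP v : reflect (v \in W /\ 2 < d v) (v \in B).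
Proof. by rewrite in_big; apply: andP. Qed.

Lemma smallP v : reflect (v \in W /\ d v <= 2) (v \in S).
Proof. by rewrite in_small; apply: andP. Qed.

Lemma small_or_big v : v \in W -> (v \in S) = (v \notin B).
Proof. by move=> vW; rewrite in_small in_big vW /= leqNgt. Qed.

Lemma small_big_nbrs u : u \in S -> 0 < d u -> 0 < #|N u :&: B| <= 2.
Proof.
move=> /smallP[uW du] d0; apply/andP; split; last first.
  exact: leq_trans (subset_leq_card (subsetIl _ _)) du.
have [h hN dh] := small_has_big esym eirr degen k34 ltk chW irr uW du d0.
by apply/card_gt0P; exists h; rewrite in_setI hN in_big (nbrW hN).
Qed.

Lemma nbrC u v : v \in W -> u \in N v -> v \in N u.
Proof. by move=> vW uN; rewrite in_nbr vW esym (nbrE uN). Qed.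

Lemma nbr_pair u p : d u = 2 -> p \in N u -> exists q, [/\ q != p, q \in N u & N u = [set p; q]].
Proof.
move=> du pN; have [a [b [ab aN bN E]]] := two_nbrs du.
move: pN; rewrite {1}E !inE => /orP[]/eqP->.
  by exists b; rewrite eq_sym.
by exists a; rewrite setUC.
Qed.

Lemma middle_nbr h u : h \in B -> u \in N h -> d u = 2 -> #|N u :&: B| != 1 ->
  exists h2, [/\ h2 != h, h2 \in B, h2 \in N u & N u = [set h; h2]].
Proof.
move=> hB uN du nB; have [hW dh] := bigP _ hB.
have hNu := nbrC hW uN; have [q [qh qN E]] := nbr_pair du hNu.
exists q; split=> //; apply: contraNT nB => qB.
suff -> : N u :&: B = [set h] by rewrite cards1.
apply/setP=> x; rewrite E !inE -in_big; case: (x =P h) => [->|_] /=.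
  by have := hB; rewrite in_big.
by case: (x =P q) => //= ->; apply/negbTE; move: qB; rewrite in_big.
Qed.

(** The other neighbour [u2] is small and needs a big neighbour itself, so a thread with two inner
    vertices arises; [double_big] applies at both ends. *)
Lemma double_nbr h u : h \in B -> u \in N h -> d u = 2 -> #|N u :&: B| = 1 ->
  exists u2 h2, [/\ [/\ u2 != h, u2 \in S, d u2 = 2 & N u = [set h; u2]],
    [/\ h2 != u, h2 \in B & N u2 = [set u; h2]], 3 + e h u2 < d h & 3 + e h2 u < d h2].
Proof.
move=> hB uN du oneB; have [hW dh] := bigP _ hB; have uW := nbrW uN.
have hNu := nbrC hW uN; have [u2 [u2h u2N E]] := nbr_pair du hNu.
have u2W := nbrW u2N.
have u2S : u2 \in S.
  rewrite small_or_big //; apply/negP=> u2B.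
  have : [set h; u2] \subset N u :&: B.
    by apply/subsetP=> x; rewrite !inE => /orP[]/eqP->; rewrite -in_nbr -in_big ?hNu ?u2N.
  by move/subset_leq_card; rewrite oneB cards2 eq_sym u2h.
have [_ d2] := smallP _ u2S; have uNu2 := nbrC uW u2N.
have d20 : 0 < d u2 by apply/card_gt0P; exists u.
have [h2 h2N dh2] := small_has_big esym eirr degen k34 ltk chW irr u2W d2 d20.
have h2u : h2 != u by apply: contraTneq dh2 => ->; rewrite du.
have d22 : d u2 = 2.
  apply/eqP; rewrite eqn_leq d2; have : [set u; h2] \subset N u2.
    by apply/subsetP=> x /set2P[]->.
  by move/subset_leq_card; rewrite cards2 eq_sym h2u.
have [q [qu qN E2]] := nbr_pair d22 uNu2.
have qh2 : h2 = q by move: h2N; rewrite E2 !inE (negbTE h2u) => /eqP.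
rewrite -qh2 in E2; have h2W := nbrW h2N; exists u2, h2; split=> //.
- by split=> //; rewrite in_big h2W.
- exact: (double_big esym eirr degen k34 ltk chW irr hW dh uN du u2N d22).
- exact: (double_big esym eirr degen k34 ltk chW irr h2W dh2 (nbrC u2W h2N) d22 uNu2 du).
Qed.

Lemma leaf_big y : y \in W -> d y = 1 -> exists2 x, x \in B & N y = [set x].
Proof.
move=> yW dy; have [||x xN dx] := small_has_big esym eirr degen k34 ltk chW irr yW.
- by rewrite dy.
- by rewrite dy.
by exists x; [rewrite in_big (nbrW xN) | rewrite (one_nbr dy xN)].
Qed.

Lemma small_leaf_or_two h u : h \in W -> u \in N h -> u \in S -> d u = 1 \/ d u = 2.
Proof.
move=> hW uN /smallP[_ du]; have : 0 < d u by apply/card_gt0P; exists h; apply: nbrC.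
by case: (d u) du => [|[|[|n]]] // _ _; [left | right].
Qed.

End Threads.

(** [permP] compares counts of an arbitrary predicate; once its values on the entries are
    generalized to numbers, linear arithmetic decides. *)
Ltac perm_lia := apply/permP=> ? /=;
  repeat match goal with |- context [nat_of_bool ?b] => generalize (nat_of_bool b); intro end;
  clear; lia.

(** * The exceptional graphs *)

Section Exceptions.
Variables (T : finType) (e : rel T) (W : {set T}).
Notation N := (nbr e W).

(* Two vertices joined by [n] paths with two internal vertices each. *)
Definition theta n h1 h2 :=
  [/\ [/\ h1 \in W, h2 \in W, h1 != h2, #|N h1| = n & #|N h2| = n],
      W = [set h1; h2] :|: (N h1 :|: N h2),
      forall u, u \in N h1 -> exists u2, [/\ u2 \in N h2, N u = [set h1; u2] & N u2 = [set u; h2]]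
    & forall u, u \in N h2 -> exists u2, [/\ u2 \in N h1, N u = [set h2; u2] & N u2 = [set u; h1]]].

(* A component isomorphic to [K_{2,3}]. *)
Definition k23 a b t1 t2 t3 :=
  [/\ uniq [:: a; b; t1; t2; t3], {subset [:: a; b; t1; t2; t3] <= W},
      N a = [set t1; t2; t3], N b = [set t1; t2; t3]
    & {in [:: t1; t2; t3], forall t, N t = [set a; b]}].

(* A cubic multigraph on [a, b, c, d], with [a] and [c] joined by a single edge,
   all of whose edges are subdivided once. *)
Definition subdivided_cubic a b c d t t' p q p' q' :=
  let s := [:: t; b; d; t'; a; p; q; c; p'; q'] in
  [/\ uniq s, W = [set x in s], N a = [set t; p; q], N c = [set t; p'; q'] &
     [/\ N t = [set a; c], N t' = [set b; d],
         {in [:: p; q], forall x, exists2 y, y \in [:: b; d] & N x = [set a; y]}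
       & {in [:: p'; q'], forall x, exists2 y, y \in [:: b; d] & N x = [set c; y]}]].
End Exceptions.

(** * Irreducible sets for k = 3 *)

Section Three.
Variables (T : finType) (e : rel T).
Hypotheses (esym : symmetric e) (eirr : irreflexive e) (degen : degenerate2 e).
Variables (W : {set T}) (m : nat).
Hypotheses (ltk : 3 < #|W|) (chW : charge_le e W m) (irr : ~ reducible e 3 W m).
Hypothesis ex3 : 3 * excess e W <= #|W| + 2.

Notation N := (nbr e W).
Notation d := (dg e W).
Notation B := (big e W).
Notation S := (small e W).
Notation k3 := (or_introl _ (erefl 3)).

Definition pay3 (v u : T) := if #|N u :&: B| == 1 then 2 else 1.
Notation paid := (payment e W pay3).
Notation slack := (slack_of e W pay3 3).

Lemma pay3_sum u : u \in S -> 0 < d u -> \sum_(v in N u :&: B) pay3 v u = 2.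
Proof.
move=> uS d0; have := small_big_nbrs esym eirr degen k3 ltk chW irr uS d0.
by rewrite /pay3 sum_nat_const; case: eqP => [->|] //; lia.
Qed.

Lemma pay3_le2 v u : pay3 v u <= 2.
Proof. by rewrite /pay3; case: ifP. Qed.

Lemma paid3_le v (A : {set T}) : N v :&: S \subset A -> paid v <= 2 * #|A|.
Proof. by apply: paid_le => u _; apply: pay3_le2. Qed.

Lemma paid3_le_deg v : paid v <= 2 * d v.
Proof. exact/paid3_le/subsetIl. Qed.

Lemma paid3_le_deg1 v x : x \in N v -> x \in B -> paid v <= 2 * (d v - 1).
Proof.
move=> xN xB; have := paid3_le (small_subD1 v xB).
by have := cardsD1 x (N v); rewrite xN -/(dg _ _ _); lia.
Qed.

(** By [leaf_three] and [leaf_four] all other neighbours of [x] are big, so [x] pays the leaf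
    alone. *)
Lemma paid3_leaf y x : y \in W -> d y = 1 -> N y = [set x] -> x \in B -> d x <= 4 ->
  paid x <= 2.
Proof.
move=> yW dy Ny xB dx; have [xW dx2] := bigP _ _ _ xB.
have xN : x \in N y by rewrite Ny inE.
suff : N x :&: S \subset [set y] by move/paid3_le; rewrite cards1.
apply/subsetP=> p /setIP[pN pS]; rewrite inE; apply: contraT => py.
have : 2 < d p.
  have [dx3|dx4] : d x = 3 \/ d x = 4 by lia.
    by have := leaf_three esym eirr degen k3 ltk chW irr yW dy xN dx3 pN py; lia.
  exact: (leaf_four esym eirr degen k3 ltk chW irr yW dy xN dx4 pN py).
by move: pS; rewrite in_small => /andP[_]; lia.
Qed.

(** A payment of 2 would make [v] the end of a thread with two inner vertices, which requires degree
    at least 4. *)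
Lemma pay3_one v u : v \in B -> u \in N v -> d u = 2 -> d v = 3 -> pay3 v u = 1.
Proof.
move=> vB uN du dv; rewrite /pay3; case: eqP => // oneB.
have [u2 [h2 [_ _ + _]]] := double_nbr esym eirr degen k3 ltk chW irr vB uN du oneB.
lia.
Qed.

Lemma paid3_at3 v : v \in B -> d v = 3 -> paid v <= 3.
Proof.
move=> vB dv; have [vW _] := bigP _ _ _ vB.
case: (boolP [exists y in N v :&: S, d y == 1]) => [/exists_inP[y /setIP[yN yS] /eqP dy]|].
  have [yW _] := smallP _ _ _ yS; have [x _ Ny] := leaf_big esym eirr degen k3 ltk chW irr yW dy.
  have := nbrC esym vW yN; rewrite Ny inE => /eqP vx; rewrite -vx in Ny.
  have := paid3_leaf yW dy Ny vB; lia.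
move/exists_inPn=> noleaf; rewrite -dv -[d v]mul1n; apply: paid_le; last exact: subsetIl.
move=> u uNS; have /setIP[uN uS] := uNS; rewrite pay3_one //.
by have := noleaf u uNS; case: (small_leaf_or_two esym vW uN uS) => -> .
Qed.

Lemma paid3_bound v : v \in B -> 2 + paid v <= 2 * 3 * (d v - 2).
Proof.
move=> vB; have [vW dv] := bigP _ _ _ vB; have := paid3_le_deg v.
have [dv3|] : d v = 3 \/ 3 < d v by lia.
  by have := paid3_at3 vB dv3; lia.
lia.
Qed.

Lemma slack3_seq (s : seq T) : uniq s -> {subset s <= B} ->
  sumn (map slack s) <= 4 + 2 * #|isolated e W|.
Proof.
move=> us sB; apply: leq_trans (sum_sub slack us sB) _.
by have := sum_slack esym pay3_sum paid3_bound; lia.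
Qed.

Lemma slack3_pair a b : a \in B -> b \in B -> a != b -> slack a + slack b <= 4 + 2 * #|isolated e W|.
Proof.
move=> aB bB ab; have := slack3_seq (s := [:: a; b]); rewrite /= inE ab addn0; apply=> //.
by move=> x; rewrite !inE -!in_big => /orP[]/eqP->.
Qed.

(** With an isolated vertex, some small vertex lies between two vertices of degree at least 4 whose
    slacks are at least 6 each, while only 4 + 2 is available. *)
Lemma no_isolated_three z : z \in W -> 0 < d z.
Proof.
move=> zW; rewrite lt0n; apply/eqP=> dz.
have [u [h [hW dh uN du]]] := exists_small_big esym eirr degen k3 ltk chW irr.
have iso := isolated_struct esym eirr degen k3 ltk chW irr zW dz.
have big_slack v : v \in B -> 3 < d v -> 6 <= slack v.
  move=> vB dv; have [vW dv2] := bigP _ _ _ vB.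
  suff : paid v <= 1 * d v by rewrite /slack; lia.
  apply: paid_le; last exact: subsetIl.
  move=> x /setIP[xN xS]; have [xW dx] := smallP _ _ _ xS.
  have [d2 H] := iso x v vW dv2 xN dx; rewrite /pay3; case: eqP => // one.
  have [u2 [h2 [[_ _ d2' E] _ _ _]]] := double_nbr esym eirr degen k3 ltk chW irr vB xN d2 one.
  by have := H u2; rewrite E !inE eqxx orbT d2' => /(_ isT).
have [d2 H] := iso u h hW dh uN du; have [p [q [pq pN qN _]]] := two_nbrs d2.
have B4 x : x \in N u -> (x \in B) /\ 3 < d x.
  by move=> xN; have := H x xN; rewrite in_big (nbrW xN) /=; split=> //; lia.
have [pB dp] := B4 p pN; have [qB dq] := B4 q qN.
have := slack3_pair pB qB pq; have := big_slack p pB dp; have := big_slack q qB dq.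
by have := isolated_le1 esym eirr degen k3 ltk chW irr; lia.
Qed.

Lemma isolated0_three : #|isolated e W| = 0.
Proof.
apply: eq_card0 => z; rewrite !inE; case zW: (z \in W) => //=.
by have := no_isolated_three zW; case: (d z).
Qed.

Lemma slack3_le4 a : a \in B -> slack a <= 4.
Proof.
move=> aB; have := slack3_seq (s := [:: a]); rewrite /= addn0 isolated0_three; apply=> //.
by move=> x; rewrite !inE -in_big => /eqP->.
Qed.

Lemma slack3_pair_le4 a b : a \in B -> b \in B -> a != b -> slack a + slack b <= 4.
Proof. by move=> aB bB /(slack3_pair aB bB); rewrite isolated0_three. Qed.

(** Only degree 3 keeps the slack of the neighbour [x] within 4. Then its other two neighbours have
    degree at least 4 and pay nothing to the big vertex [x], which leaves them a slack of at least 4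
    each. *)
Lemma no_leaf y : y \in W -> d y != 1.
Proof.
move=> yW; apply/eqP=> dy; have [x xB Ny] := leaf_big esym eirr degen k3 ltk chW irr yW dy.
have [xW dx] := bigP _ _ _ xB; have xN : x \in N y by rewrite Ny inE.
have := slack3_le4 xB; rewrite /slack => slx; have px := paid3_le_deg x.
have pl := paid3_leaf yW dy Ny xB; have dx3 : d x = 3 by lia.
have l3 := leaf_three esym eirr degen k3 ltk chW irr yW dy xN dx3.
have [p [q [pN qN pq py qy]]] : exists p q, [/\ p \in N x, q \in N x, p != q, p != y & q != y].
  have /eqP/cards2P[p [q [pq E]]] : #|N x :\ y| = 2.
    by have := cardsD1 y (N x); rewrite (nbrC esym yW xN) -/(dg _ _ _) dx3; lia.
  have : p \in N x :\ y by rewrite E !inE eqxx.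
  have : q \in N x :\ y by rewrite E !inE eqxx orbT.
  by rewrite !in_setD1 => /andP[? ?] /andP[? ?]; exists p, q.
have slp z : z \in N x -> z != y -> z \in B /\ 4 <= slack z.
  move=> zN zy; have dz := l3 z zN zy.
  have zB : z \in B by rewrite in_big (nbrW zN) (ltnW dz).
  have le := paid3_le_deg1 (nbrC esym xW zN) xB.
  by split=> //; rewrite /slack; move: le dz; clear; lia.
have [[pB sp] [qB sq]] := (slp p pN py, slp q qN qy).
by have := slack3_pair_le4 pB qB pq; move: sp sq; clear; lia.
Qed.

Lemma small_two u : u \in S -> d u = 2.
Proof.
by move=> /smallP[uW du]; have := no_leaf uW; have := no_isolated_three uW; lia.
Qed.

Lemma slack3_pos v : v \in B -> 0 < slack v.
Proof.
move=> vB; have [vW dv] := bigP _ _ _ vB; have := paid3_le_deg v; rewrite /slack.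
have [dv3|] : d v = 3 \/ 3 < d v by lia.
  by have := paid3_at3 vB dv3; lia.
lia.
Qed.

Lemma big_le4 v : v \in B -> d v <= 4.
Proof.
move=> vB; have := slack3_le4 vB; have := paid3_le_deg v; rewrite /slack; lia.
Qed.

(** Degree 4 leaves slack 2 even if all payments are 2, and 6 if none is. So some thread with two
    inner vertices leads to a second vertex of degree 4. These two use up the total of 4: all their
    payments are 2, and no third big vertex fits, as its slack would be positive. *)
Lemma theta_of_four v : v \in B -> d v = 4 -> exists v', theta e W 4 v v'.
Proof.
move=> vB dv; have [vW dv2] := bigP _ _ _ vB.
have sl4 x : x \in B -> d x = 4 -> 2 <= slack x.
  by move=> xB dx; have := paid3_le_deg x; rewrite /slack dx; lia.
have [u uNS /eqP payu] : exists2 u, u \in N v :&: S & pay3 v u == 2.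
  apply/exists_inP; apply: contraT => /exists_inPn H.
  have : paid v <= 1 * d v.
    apply: paid_le; last exact: subsetIl.
    by move=> u uNS; have := H u uNS; have := pay3_le2 v u; clear; lia.
  by have := slack3_le4 vB; rewrite /slack dv; clear; lia.
have /setIP[uN uS] := uNS.
have dbl x y : x \in B -> d x = 4 -> y \in N x :&: S -> pay3 x y = 2 ->
    exists y2 x2, [/\ x2 != x, x2 \in B, d x2 = 4, y2 \in N x2 & [/\ N y = [set x; y2], N y2 = [set y; x2] & y2 \in S]].
  move=> xB dx /setIP[yN yS] pay2; have one : #|N y :&: B| = 1 by move: pay2; rewrite /pay3; case: eqP.
  have [y2 [x2 [[y2x y2S dy2 Ny] [x2y x2B Ny2] lt1 lt2]]] :=
    double_nbr esym eirr degen k3 ltk chW irr xB yN (small_two yS) one.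
  have [xW _] := bigP _ _ _ xB; have [x2W _] := bigP _ _ _ x2B.
  have [y2W _] := smallP _ _ _ y2S.
  have y2N : y2 \in N x2 by apply: nbrC; rewrite // Ny2 !inE eqxx orbT.
  exists y2, x2; split=> //; last 1 first.
  - by have := big_le4 x2B; move: lt2; clear; lia.
  (* If the thread returned to [x], the edge from [x] to [y2] would raise the required degree to
     5. *)
  apply: contraTneq lt1 => x2x; rewrite x2x in y2N x2B *; rewrite (nbrE y2N); have := big_le4 x2B; clear; lia.
have [u2 [v' [v'v v'B dv' _ _]]] := dbl v u vB dv uNS payu.
have [sv sv'] := (sl4 v vB dv, sl4 v' v'B dv').
have := slack3_pair_le4 vB v'B; rewrite eq_sym v'v => /(_ isT) sum4.
have all2 x : x \in B -> d x = 4 -> slack x = 2 -> forall y, y \in N x -> y \in S /\ pay3 x y = 2.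
  move=> xB dx sx y yN; have px : paid x = 8 by have := paid3_le_deg x; move: sx; rewrite /slack dx; clear; lia.
  have yS : y \in S.
    rewrite (small_or_big _ (nbrW yN)); apply/negP=> yB.
    by have := paid3_le_deg1 yN yB; rewrite px dx.
  split=> //; apply/eqP; rewrite eqn_leq pay3_le2 leqNgt; apply/negP=> py.
  move: px; suff : paid x < 8 by clear; lia.
  have : paid x <= 1 + 2 * #|(N x :&: S) :\ y|.
    rewrite /payment (big_setD1 y) /=; last by rewrite in_setI yN.
    apply: leq_add; first by move: py; clear; lia.
    by rewrite mulnC -sum_nat_const; apply: leq_sum => z _; apply: pay3_le2.
  have := cardsD1 y (N x :&: S); rewrite in_setI yN yS /=.
  have := subset_leq_card (subsetIl (N x) S); rewrite -/(dg _ _ _) dx; clear; lia.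
have onlyB x : x \in B -> x = v \/ x = v'.
  move=> xB; case: (x =P v) => [|/eqP xv]; first by left.
  case: (x =P v') => [|/eqP xv']; first by right.
  have := slack3_seq (s := [:: v; v'; x]); rewrite /= !inE negb_or (eq_sym v v') v'v.
  rewrite (eq_sym v x) xv (eq_sym v' x) xv' isolated0_three => /(_ isT).
  have sub : {subset [:: v; v'; x] <= B} by move=> z; rewrite in_cons in_cons mem_seq1 => /or3P[]/eqP->.
  by move/(_ sub); have := slack3_pos xB; move: sv sv'; clear; lia.
have [v'W _] := bigP _ _ _ v'B.
have thread x x' : x \in B -> d x = 4 -> slack x = 2 -> (forall z, z \in B -> z = x \/ z = x') ->
    forall y, y \in N x -> exists y2, [/\ y2 \in N x', N y = [set x; y2] & N y2 = [set y; x']].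
  move=> xB dx sx only y yN; have [yS pay2] := all2 x xB dx sx y yN.
  have [|y2 [x2 [x2x x2B _ y2N [Ny Ny2 _]]]] := dbl x y xB dx _ pay2; first by rewrite in_setI yN.
  case: (only x2 x2B) => E; first by rewrite E eqxx in x2x.
  by exists y2; rewrite -E.
exists v'; split.
- by split=> //; rewrite eq_sym.
- apply/setP=> x; rewrite !in_setU !in_set1; apply/idP/idP; last first.
    by case/orP=> [/orP[]/eqP->|/orP[]/nbrW].
  move=> xW; case xB: (x \in B); first by case: (onlyB x xB) => ->; rewrite eqxx ?orbT.
  have xS : x \in S by rewrite small_or_big ?xB.
  have := small_big_nbrs esym eirr degen k3 ltk chW irr xS (no_isolated_three xW).
  case/andP=> /card_gt0P[h /setIP[hN hB]] _.
  by case: (onlyB h hB) => E; rewrite -E (nbrC esym xW hN) ?orbT.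
- by apply: thread => //; move: sv sv' sum4; clear; lia.
- by apply: thread => //; [move: sv sv' sum4; clear; lia | move=> z /onlyB[]; [right|left]].
Qed.

Hypothesis all3 : forall v, v \in B -> d v = 3.

Lemma big_partner a u : a \in B -> u \in N a -> u \in S ->
  exists x, [/\ x \in B, x != a & N u = [set a; x]].
Proof.
move=> aB uN uS; have du := small_two uS.
have [|x [xa xB xN E]] := middle_nbr esym aB uN du; last by exists x.
by have := pay3_one aB uN du (all3 aB); rewrite /pay3; case: eqP.
Qed.

Lemma paid_all3 a : a \in B -> paid a = #|N a :&: S|.
Proof.
move=> aB; rewrite /payment -sum1_card; apply: eq_bigr => u /setIP[uN uS].
by rewrite pay3_one //; [apply: small_two | apply: all3].
Qed.

(** Two adjacent vertices of degree 3 have slack at least 2 each and are thus the only big ones;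
    some small vertex is then adjacent to both, which [no_triangle] forbids. *)
Lemma nbr_all3 a u : a \in B -> u \in N a -> u \in S.
Proof.
move=> aB uN; rewrite (small_or_big _ (nbrW uN)); apply/negP=> uB.
have [aW _] := bigP _ _ _ aB; have aNu := nbrC esym aW uN.
have sl2 x y : x \in B -> y \in B -> y \in N x -> 2 <= slack x.
  move=> xB yB yN; rewrite /slack (all3 xB) paid_all3 //.
  have := subset_leq_card (small_subD1 x yB); have := cardsD1 y (N x).
  by rewrite yN -/(dg _ _ _) (all3 xB); clear; lia.
have [sa su] := (sl2 a u aB uB uN, sl2 u a uB aB aNu).
have au : a != u by rewrite eq_sym (nbr_neq eirr uN).
have only x : x \in B -> x = a \/ x = u.
  move=> xB; case: (x =P a) => [|/eqP xa]; first by left.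
  case: (x =P u) => [|/eqP xu]; first by right.
  have sub : {subset [:: a; u; x] <= B}.
    by move=> z; rewrite in_cons in_cons mem_seq1 => /or3P[]/eqP->.
  have := slack3_seq _ sub; rewrite /= !inE negb_or au (eq_sym a x) xa (eq_sym u x) xu isolated0_three.
  by move=> /(_ isT); have := slack3_pos xB; move: sa su; clear; lia.
have [t [h [hW dh tN dt]]] := exists_small_big esym eirr degen k3 ltk chW irr.
have hB : h \in B by rewrite in_big hW.
have tS : t \in S by rewrite in_small (nbrW tN).
have [x [xB xh E]] := big_partner hB tN tS.
have [hNt xNt] : h \in N t /\ x \in N t by rewrite E !inE !eqxx orbT.
have hx : h != x by rewrite eq_sym.
have nhx := no_triangle esym eirr degen k3 ltk chW irr (nbrW tN) (small_two tS) hNt xNt (all3 hB) (all3 xB) hx.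
have eau := nbrE uN; have eua := nbrE aNu.
case: (only h hB) (only x xB) nhx hx => -> [] ->; rewrite ?eau ?eua ?eqxx //.
Qed.

(** All slacks equal 1 and the excess is |B|, so the slack identity reads |B| + 2|W| = 6|B|; the
    bound on |B| then follows from [ex3]. *)
Lemma card_all3 : 2 * #|W| = 5 * #|B| /\ #|B| <= 4.
Proof.
have := sum_slack esym pay3_sum paid3_bound; rewrite isolated0_three.
have -> : \sum_(v in B) slack v = #|B|.
  rewrite -sum1_card; apply: eq_bigr => v vB; rewrite /slack (all3 vB) paid_all3 //.
  have -> : N v :&: S = N v by apply/setIidPl/subsetP=> u; apply: nbr_all3.
  by rewrite -/(dg _ _ _) (all3 vB).
have -> : excess e W = #|B|.
  by rewrite -sum_big_excess -sum1_card; apply: eq_bigr => v vB; rewrite (all3 vB).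
by move: ex3; rewrite -sum_big_excess (eq_bigr (fun=> 1)) ?sum1_card => [|v vB]; rewrite ?all3 //; clear; lia.
Qed.

Lemma three_nbrs a t : a \in B -> t \in N a ->
  exists p q, [/\ uniq [:: t; p; q], p \in N a, q \in N a & N a = [set t; p; q]].
Proof.
move=> aB tN; have /eqP/cards2P[p [q [pq E]]] : #|N a :\ t| = 2.
  by have := cardsD1 t (N a); rewrite tN -/(dg _ _ _) all3 //; clear; lia.
have : p \in N a :\ t by rewrite E !inE eqxx.
have : q \in N a :\ t by rewrite E !inE eqxx orbT.
rewrite !in_setD1 => /andP[qt qN] /andP[pt pN]; exists p, q; split=> //.
  by rewrite /= !inE negb_or eq_sym pt eq_sym qt pq.
by rewrite -setUA -E setD1K.
Qed.

(** A third big vertex forces |B| = 4 and |W| = 10. Nine vertices are the four big ones and the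
    neighbours of [a] and [c]; the tenth can only lie between [b] and [d]. *)
Lemma cubic_split a c t p q xp xq : a \in B -> c \in B -> c != a ->
  uniq [:: t; p; q] -> N a = [set t; p; q] -> N t = [set a; c] ->
  xp \in B -> xq \in B -> xp != a -> xq != a -> xp != c -> xq != c ->
  N p = [set a; xp] -> N q = [set a; xq] ->
  exists b d t' p' q', subdivided_cubic e W a b c d t t' p q p' q'.
Proof.
move=> aB cB ca us Na Nt xpB xqB xpa xqa xpc xqc Np Nq.
have [aW _] := bigP _ _ _ aB; have [cW _] := bigP _ _ _ cB.
have [cW2 leB] := card_all3.
have cBD : #|B| = 2 + #|(B :\ a) :\ c|.
  by rewrite (cardsD1 a) aB (cardsD1 c (B :\ a)) in_setD1 ca cB addnA.
have cB4 : #|B| = 4.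
  have : 0 < #|(B :\ a) :\ c| by apply/card_gt0P; exists xp; rewrite !in_setD1 xpc xpa.
  by move: cW2 leB cBD; clear; lia.
have /eqP/cards2P[b [d' [bd EB]]] : #|(B :\ a) :\ c| = 2 by move: cB4 cBD; clear; lia.
have other x : x \in B -> x != a -> x != c -> x \in [:: b; d'].
  move=> xB xa xc; have : x \in (B :\ a) :\ c by rewrite !in_setD1 xa xc.
  by rewrite EB !inE.
have [bB dB] : b \in (B :\ a) :\ c /\ d' \in (B :\ a) :\ c by rewrite EB !inE !eqxx orbT.
move: bB dB; rewrite !in_setD1 => /and3P[bc ba bB] /and3P[dc da dB].
have cNt : c \in N t by rewrite Nt !inE eqxx orbT.
have tNa : t \in N a by rewrite Na !inE eqxx.
have tNc := nbrC esym (nbrW tNa) cNt.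
have [p' [q' [us' p'N q'N Nc]]] := three_nbrs cB tNc.
have far x : x \in N c -> x != t -> x \notin N a.
  move=> xN xt; rewrite Na !inE (negbTE xt) /=; apply/negP=> /orP[]/eqP E.
    have := nbrC esym cW xN; rewrite E Np !inE (negbTE ca) /= => /eqP cx.
    by rewrite cx eqxx in xpc.
  have := nbrC esym cW xN; rewrite E Nq !inE (negbTE ca) /= => /eqP cx.
  by rewrite cx eqxx in xqc.
have [p't q't] : p' != t /\ q' != t.
  by move: us'; rewrite /= !inE negb_or => /andP[/andP[tp tq] _]; rewrite eq_sym tp eq_sym tq.
have fp := far p' p'N p't; have fq := far q' q'N q't.
have part x : x \in N c -> x \notin N a -> exists2 y, y \in [:: b; d'] & N x = [set c; y].
  move=> xN xa; have [y [yB yc Ny]] := big_partner cB xN (nbr_all3 cB xN).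
  exists y => //; apply: other => //; apply: contraNneq xa => ya.
  by rewrite (nbrC esym (nbrW xN)) // Ny ya !inE eqxx orbT.
have [pNa qNa] : p \in N a /\ q \in N a by rewrite Na !inE !eqxx !orbT.
have aS x : x \in N a -> x \in S := nbr_all3 aB.
have cS x : x \in N c -> x \in S := nbr_all3 cB.
have ne x y : x \in N a -> y \notin N a -> x != y.
  by move=> xN; apply: contraNneq => <-.
have us5 : uniq [:: t; p; q; p'; q'].
  move: us us'; rewrite /= !inE !negb_or => /and3P[/andP[tp tq] pq _].
  move=> /and3P[/andP[tp' tq'] pq' _].
  by rewrite tp tq pq tp' tq' pq' !ne.
have usB : uniq [:: b; d'; a; c] by rewrite /= !inE !negb_or bd ba bc da dc eq_sym ca.
have BW x : x \in B -> x \in W by case/bigP.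
have uniq_sep s : uniq s -> {subset s <= S} -> uniq ([:: b; d'; a; c] ++ s).
  move=> uS sS; rewrite cat_uniq usB uS andbT /=; apply/hasPn=> x /sS xS.
  have [_ dx] := smallP _ _ _ xS; apply/negP; rewrite !inE => H.
  suff /bigP[_] : x \in B by rewrite ltnNge dx.
  by case/or4P: H => /eqP->.
pose s9 := [:: b; d'; a; c; t; p; q; p'; q'].
have us9 : uniq s9.
  apply: (uniq_sep [:: t; p; q; p'; q']) => // x.
  by rewrite 4!in_cons mem_seq1 => /orP[|/or4P[]] /eqP->;
    [exact: aS | exact: aS | exact: aS | exact: cS | exact: cS].
have c10 : #|W| = 10 by move: cW2; rewrite cB4; clear; lia.
have [t'] : exists t', t' \in W :\: [set x in s9].
  apply/card_gt0P; rewrite cardsD; have := subset_leq_card (subsetIr W [set x in s9]).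
  by rewrite [#|[set x in s9]|]cardsE (card_uniqP us9) c10 /=; clear; lia.
rewrite in_setD in_set => /andP[t's t'W].
have t'S : t' \in S.
  rewrite (small_or_big _ t'W); apply: contra t's => t'B; rewrite !inE.
  have [->|t'a] := eqVneq t' a; first by rewrite ?orbT.
  have [->|t'c] := eqVneq t' c; first by rewrite ?orbT.
  by have := other t' t'B t'a t'c; rewrite !inE => /orP[]->; rewrite ?orbT.
have t'Na : t' \notin N a.
  by rewrite Na !inE; apply: contra t's; rewrite !inE => /orP[/orP[]|] ->; rewrite ?orbT.
have t'Nc : t' \notin N c.
  by rewrite Nc !inE; apply: contra t's; rewrite !inE => /orP[/orP[]|] ->; rewrite ?orbT.
have Nt' : N t' = [set b; d'].
  have := small_big_nbrs esym eirr degen k3 ltk chW irr t'S (no_isolated_three t'W).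
  case/andP=> /card_gt0P[h /setIP[hN hB]] _; have t'Nh := nbrC esym t'W hN.
  have [x [xB xh E]] := big_partner hB t'Nh t'S.
  have xN : x \in N t' by rewrite E !inE eqxx orbT.
  have in_bd y : y \in B -> y \in N t' -> y \in [:: b; d'].
    move=> yB yN; have t'y := nbrC esym t'W yN; apply: other => //.
      by apply: contraNneq t'Na => <-.
    by apply: contraNneq t'Nc => <-.
  have := in_bd h hB hN; have := in_bd x xB xN; move: xh; rewrite E !inE.
  by move=> xh /orP[]/eqP xE /orP[]/eqP hE; move: xh; rewrite xE hE ?eqxx // setUC.
pose s10 := [:: t; b; d'; t'; a; p; q; c; p'; q'].
have us10 : uniq s10.
  have -> : uniq s10 = uniq (t' :: s9).
    by apply: perm_uniq; perm_lia.
  by rewrite cons_uniq t's.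
exists b, d', t', p', q'; split=> //.
- apply/eqP; rewrite eq_sym eqEcard c10 cardsE (card_uniqP us10) /= andbT.
  apply/subsetP=> x; rewrite in_set; apply: (allP (a := mem W)).
  rewrite /= (nbrW tNa) (nbrW pNa) (nbrW qNa) (nbrW p'N) (nbrW q'N) t'W cW aW.
  by rewrite !BW.
- split=> // x; rewrite !inE => /orP[]/eqP->.
  + by exists xp => //; apply: other.
  + by exists xq => //; apply: other.
  + exact: part.
  + exact: part.
Qed.

(** The three threads at [a] end at [x], [y] and [z]. If these coincide the component is K_{2,3};
    otherwise one end differs from the other two and is joined to [a] by a single thread. *)
Lemma cubic_cases :
  (exists a b t1 t2 t3, k23 e W a b t1 t2 t3 /\ (#|W| = 5 \/ #|W| = 10)) \/
  (exists a b c d t t' p q p' q', subdivided_cubic e W a b c d t t' p q p' q').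
Proof.
have [t [a [aW da tN dt]]] := exists_small_big esym eirr degen k3 ltk chW irr.
have aB : a \in B by rewrite in_big aW.
have [p [q [us pN qN Na]]] := three_nbrs aB tN.
have aS x : x \in N a -> x \in S := nbr_all3 aB.
have [x [xB xa Nt]] := big_partner aB tN (aS t tN).
have [y [yB ya Np]] := big_partner aB pN (aS p pN).
have [z [zB za Nq]] := big_partner aB qN (aS q qN).
have nb u v : N u = [set a; v] -> u \in W -> u \in N v.
  by move=> E uW; apply: (nbrC esym uW); rewrite E !inE eqxx orbT.
have [xy|xy] := eqVneq x y; have [xz|xz] := eqVneq x z; have [yz|yz] := eqVneq y z.
- left; exists a, x, t, p, q; split.
    subst y z; split=> //.
    + have xS u : u \in N a -> u != x.
        by move=> /aS uS; apply: contraTneq uS => ->; rewrite small_or_big ?xB //; case/bigP: xB.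
      have aN u : u \in N a -> u != a by apply: nbr_neq.
      move: us; rewrite /= !inE !negb_or => /and3P[/andP[tp tq] pq _].
      by rewrite tp tq pq eq_sym xa !(eq_sym a) !(eq_sym x) !aN ?xS.
    + by move=> u; rewrite !inE => /orP[|/or4P[]]/eqP->; rewrite ?(nbrW tN) ?(nbrW pN) ?(nbrW qN) //;
         case/bigP: xB.
    + apply/eqP; rewrite eq_sym eqEcard -Na -/(dg _ _ x) -/(dg _ _ a) !all3 // leqnn andbT Na.
      by apply/subsetP=> u; rewrite !inE => /orP[/orP[]|]/eqP->; rewrite -in_nbr nb ?(nbrW tN) ?(nbrW pN) ?(nbrW qN).
    + by move=> u; rewrite !inE => /or3P[]/eqP->.
  have [cW leB] := card_all3; have : 0 < #|B| by apply/card_gt0P; exists a.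
  by move: cW leB; clear; lia.
- by rewrite -xy xz eqxx in yz.
- by rewrite xy yz eqxx in xz.
- right; have us' : uniq [:: q; t; p].
    by rewrite -(rot_uniq 1) /=; move: us; rewrite /= !inE !negb_or => /and3P[/andP[-> ->] -> _].
  have Na' : N a = [set q; t; p] by rewrite Na setUC setUA.
  have [b [d' [t' [p' [q' H]]]]] := cubic_split aB zB za us' Na' Nq xB yB xa ya xz yz Nt Np.
  by exists a, b, z, d', q, t', t, p, p', q'.
- by rewrite xz yz eqxx in xy.
- right; have us' : uniq [:: p; t; q].
    by move: us; rewrite /= !inE !negb_or (eq_sym p t) => /and3P[/andP[-> ->] -> _].
  have Na' : N a = [set p; t; q] by rewrite Na (setUC [set t]).
  have zy : z != y by rewrite eq_sym.
  have [b [d' [t' [p' [q' H]]]]] := cubic_split aB yB ya us' Na' Np xB zB xa za xy zy Nt Nq.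
  by exists a, b, y, d', p, t', t, q, p', q'.
- right; have yx : y != x by rewrite eq_sym.
  have zx : z != x by rewrite eq_sym.
  have [b [d' [t' [p' [q' H]]]]] := cubic_split aB xB xa us Na Nt yB zB ya za yx zx Np Nq.
  by exists a, b, x, d', t, t', p, q, p', q'.
- right; have yx : y != x by rewrite eq_sym.
  have zx : z != x by rewrite eq_sym.
  have [b [d' [t' [p' [q' H]]]]] := cubic_split aB xB xa us Na Nt yB zB ya za yx zx Np Nq.
  by exists a, b, x, d', t, t', p, q, p', q'.
Qed.

End Three.

(** * Irreducible sets for k = 4 *)

Section Four.
Variables (T : finType) (e : rel T).
Hypotheses (esym : symmetric e) (eirr : irreflexive e) (degen : degenerate2 e).
Variables (W : {set T}) (m : nat).
Hypotheses (ltk : 4 < #|W|) (chW : charge_le e W m) (irr : ~ reducible e 4 W m).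

Notation N := (nbr e W).
Notation d := (dg e W).
Notation B := (big e W).
Notation S := (small e W).
Notation k4 := (or_intror (4 = 3) (erefl 4)).

(** A full greedy order: at most 3, 2, 1 and 0 neighbours outside. Unlike a triple, it has to gain 2
    by itself. *)
Definition quad y1 y2 y3 y4 :=
  [/\ uniq [:: y1; y2; y3; y4], {subset [:: y1; y2; y3; y4] <= W},
      d y1 <= 3 + (e y1 y2 + e y1 y3 + e y1 y4),
      d y2 <= 2 + (e y1 y2 + e y2 y3 + e y2 y4)
    & d y3 <= 1 + (e y1 y3 + e y2 y3 + e y3 y4) /\ d y4 <= e y1 y4 + e y2 y4 + e y3 y4].

Lemma quad_nocharge y1 y2 y3 y4 : quad y1 y2 y3 y4 ->
  ~ charge_le e (W :\: [set x in [:: y1; y2; y3; y4]]) (m - 2).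
Proof.
case=> us sub d1 d2 [d3 d4] ch; apply: irr; exists [:: y1; y2; y3; y4]; split=> //.
have := dgD e y1 us sub; have := dgD e y2 us sub.
have := dgD e y3 us sub; have := dgD e y4 us sub.
rewrite /= !eirr /= (esym y2 y1) (esym y3 y1) (esym y3 y2) (esym y4 y1) (esym y4 y2) (esym y4 y3).
move=> E4 E3 E2 E1; apply/and5P; split=> //; [move: E1 d1|move: E2 d2|move: E3 d3|move: E4 d4];
  by clear; lia.
Qed.

Lemma quad_sub y1 y2 y3 y4 (A : {set T}) : {subset A <= [:: y1; y2; y3; y4]} ->
  W :\: [set x in [:: y1; y2; y3; y4]] \subset W :\: A.
Proof. by move=> sA; apply: setDS; apply/subsetP=> x xA; rewrite in_set sA. Qed.

Lemma quad_big4 y y1 y2 y3 y4 : quad y1 y2 y3 y4 -> y \in [:: y1; y2; y3; y4] -> 3 < d y -> False.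
Proof.
move=> q ys dy; apply: (quad_nocharge q); have [_ sub _ _ _] := q.
have yW := sub y ys; have sy : {subset [set y] <= [:: y1; y2; y3; y4]} by move=> x /set1P->.
apply: charge_le_sub (quad_sub sy) _ => //.
by apply: charge_leW (charge_le_del esym eirr yW chW); move: dy; clear; lia.
Qed.

Lemma quad_two_big a b y1 y2 y3 y4 : quad y1 y2 y3 y4 ->
  a \in [:: y1; y2; y3; y4] -> b \in [:: y1; y2; y3; y4] -> a != b ->
  2 < d a -> 2 < d b -> False.
Proof.
move=> q ain bin ab da db; apply: (quad_nocharge q); have [_ sub _ _ _] := q.
have sy : {subset [set a; b] <= [:: y1; y2; y3; y4]} by move=> x /set2P[]->.
apply: charge_le_sub (quad_sub sy) _ => //.
have -> : W :\: [set a; b] = (W :\ a) :\ b by rewrite setDDl.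
exact: charge_del2 (sub a ain) (sub b bin) ab da db chW.
Qed.

Lemma small_big_neq x y : x \in S -> y \in B -> (x != y) * (y != x).
Proof.
move=> /smallP[_ dx] /bigP[_ dy]; have xy : x != y by apply: contraTneq dy => <-; rewrite -leqNgt.
by rewrite xy eq_sym xy.
Qed.

Lemma big_small_neq x y : x \in B -> y \in S -> (x != y) * (y != x).
Proof. by move=> xB yS; rewrite !(small_big_neq yS xB). Qed.

(** Under these bounds [b, a, y, t] is a quadruple with two big members: [t] has both neighbours in
    it and [y] at least one. *)
Lemma sole t a b y : t \in S -> a \in B -> b \in B -> a != b -> N t = [set a; b] ->
  y \in S -> y != t -> e a y || e b y -> d b <= 4 + e b y -> d a <= 3 + e a y -> False.
Proof.
move=> tS aB bB ab Nt yS yt eaby db da.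
have [aN bN] : a \in N t /\ b \in N t by rewrite Nt !inE !eqxx orbT.
have [na nb] := (neq_nbr esym eirr aN, neq_nbr esym eirr bN).
have dt : d t = 2 by rewrite /dg Nt cards2 ab.
have [tW _] := smallP _ _ _ tS; have [yW dy] := smallP _ _ _ yS.
have [aW da2] := bigP _ _ _ aB; have [bW db2] := bigP _ _ _ bB.
have q : quad b a y t.
  split.
  - rewrite /= !inE !negb_or (eq_sym b a) ab na nb yt.
    by rewrite !(small_big_neq yS aB) !(small_big_neq yS bB).
  - by move=> x; rewrite !inE => /or4P[]/eqP->.
  - by rewrite nb; move: db; clear; lia.
  - by rewrite na; move: da; clear; lia.
  - rewrite dt na nb; split; last by clear; lia.
    by move: dy eaby; clear; case: (e a y); case: (e b y) => //=; lia.
by apply: (quad_two_big (a := a) (b := b) q) => //; rewrite !inE eqxx ?orbT.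
Qed.

(** Otherwise [h, y, u2, u1] is a quadruple; [h] alone gains 2 if its degree is at least 4, and
    degree 3 contradicts [double_big]. *)
Lemma double_quad h u1 u2 y : h \in B -> u1 \in N h -> d u1 = 2 -> u2 \in N u1 -> d u2 = 2 ->
  y \in W -> y \notin [:: h; u2; u1] -> d y <= 2 + (e y h + (e y u2 + e y u1)) ->
  4 + e h u2 + e h y < d h.
Proof.
move=> hB u1N d1 u2N d2 yW; rewrite !inE !negb_or => /and3P[yh yu2 yu1] dy.
have [hW dh] := bigP _ _ _ hB; rewrite ltnNge; apply/negP=> dh4.
have [n1 n2] := (neq_nbr esym eirr u1N, neq_nbr esym eirr u2N).
have hu2 : h != u2 by apply: contraTneq dh => ->; rewrite d2.
have q : quad h y u2 u1.
  split.
  - by rewrite /= !inE !negb_or (eq_sym h y) yh hu2 n1 yu2 yu1 n2.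
  - by move=> x; rewrite !inE => /or4P[]/eqP->; rewrite ?n1 ?n2.
  - by rewrite n1; move: dh4; clear; lia.
  - by rewrite (esym h y); move: dy; clear; lia.
  - by rewrite n1 d1 d2 n2; clear; lia.
case: (leqP (d h) 3) => dh3.
  by have := double_big esym eirr degen k4 ltk chW irr hW dh u1N d1 u2N d2; move: dh3; clear; lia.
by apply: (quad_big4 (y := h) q) => //; rewrite inE eqxx.
Qed.

Lemma double_five h u1 u2 : h \in B -> u1 \in N h -> d u1 = 2 -> u2 \in N u1 -> d u2 = 2 ->
  4 + e h u2 < d h.
Proof.
move=> hB u1N d1 u2N d2; have [hW dh] := bigP _ _ _ hB.
have [n1 n2] := (neq_nbr esym eirr u1N, neq_nbr esym eirr u2N).
have hu2 : h != u2 by apply: contraTneq dh => ->; rewrite d2.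
have us : uniq [:: h; u2; u1] by rewrite /= !inE !negb_or hu2 n1 n2.
have [W1 W2] := (nbrW u1N, nbrW u2N).
have [y [yW ys dy]] := light3 degen k4 ltk hW W2 W1 us.
by have := double_quad hB u1N d1 u2N d2 yW ys dy; clear; lia.
Qed.

Lemma double_other h u1 u2 y : h \in B -> u1 \in N h -> d u1 = 2 -> u2 \in N u1 -> d u2 = 2 ->
  y \in N h -> y \in S -> y != u1 -> y != u2 -> 5 + e h u2 < d h.
Proof.
move=> hB u1N d1 u2N d2 yN yS yu1 yu2; have [yW dy] := smallP _ _ _ yS.
have ys : y \notin [:: h; u2; u1] by rewrite !inE !negb_or yu1 yu2 (small_big_neq yS hB).
have dy' : d y <= 2 + (e y h + (e y u2 + e y u1)) by move: dy; clear; lia.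
have := double_quad hB u1N d1 u2N d2 yW ys dy'.
by rewrite (nbrE yN); clear; lia.
Qed.

(** Otherwise [h, y, y', l] is a quadruple in which [h] alone gains 2. *)
Lemma leaf_quad h l y' y : h \in B -> l \in N h -> d l = 1 -> y' \in N h -> y' \in S -> y' != l ->
  y \in W -> y \notin [:: h; y'; l] -> d y <= 2 + (e y h + (e y y' + e y l)) ->
  3 < d h -> 5 + e h y < d h.
Proof.
move=> hB lN dl y'N y'S y'l yW; rewrite !inE !negb_or => /and3P[yh yy' yl] dy dh3.
have [hW dh] := bigP _ _ _ hB; rewrite ltnNge; apply/negP=> dh4.
have [n1 n2] := (neq_nbr esym eirr lN, neq_nbr esym eirr y'N).
have [_ dy'] := smallP _ _ _ y'S.
have q : quad h y y' l.
  split.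
  - by rewrite /= !inE !negb_or (eq_sym h y) yh n2 n1 yy' yl y'l.
  - by move=> x; rewrite !inE => /or4P[]/eqP->; rewrite ?n1 ?n2.
  - by rewrite n1 n2; move: dh4; clear; lia.
  - by rewrite (esym h y); move: dy; clear; lia.
  - by rewrite n1 n2 dl; move: dy'; clear; lia.
by apply: (quad_big4 (y := h) q) => //; rewrite inE eqxx.
Qed.

Lemma leaf_other h l y' : h \in B -> l \in N h -> d l = 1 -> y' \in N h -> y' \in S -> y' != l ->
  3 < d h -> 5 < d h.
Proof.
move=> hB lN dl y'N y'S y'l dh3; have [hW _] := bigP _ _ _ hB.
have [n1 n2] := (neq_nbr esym eirr lN, neq_nbr esym eirr y'N).
have us : uniq [:: h; y'; l] by rewrite /= !inE !negb_or n2 n1 y'l.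
have [y [yW ys dy]] := light3 degen k4 ltk hW (nbrW y'N) (nbrW lN) us.
by have := leaf_quad hB lN dl y'N y'S y'l yW ys dy dh3; clear; lia.
Qed.

Lemma leaf_two_others h l y' y : h \in B -> l \in N h -> d l = 1 ->
  y' \in N h -> y' \in S -> y' != l -> y \in N h -> y \in S -> y != l -> y != y' ->
  3 < d h -> 6 < d h.
Proof.
move=> hB lN dl y'N y'S y'l yN yS yl yy' dh3; have [yW dy] := smallP _ _ _ yS.
have ys : y \notin [:: h; y'; l] by rewrite !inE !negb_or yl yy' (small_big_neq yS hB).
have := leaf_quad hB lN dl y'N y'S y'l yW ys; rewrite (nbrE yN); apply=> //.
by move: dy; clear; lia.
Qed.

Hypothesis ex4 : excess e W <= 2 * (#|W| %/ 4) + minn (#|W| %% 4) 2.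

(** The share of a vertex of degree [a] for a small vertex whose other neighbour has degree [b].
    Opposite shares add up to 2. A vertex of degree 3 has only 2 to spend, so a vertex of degree at
    least 5 on the other side takes over its share. *)
Definition pay_deg a b :=
  if a == 3 then (if 4 < b then 0 else 1) else if 4 < a then (if b == 3 then 2 else 1) else 1.
(** For [u] with two big neighbours the sum has one term, that of the neighbour other than [v]. *)
Definition pay4 (v u : T) :=
  if #|N u :&: B| == 1 then 2 else \sum_(x in N u :\ v) pay_deg (d v) (d x).
Notation paid := (payment e W pay4).
Notation slack := (slack_of e W pay4 2).

Lemma pay_deg_le2 a b : pay_deg a b <= 2.
Proof. by rewrite /pay_deg; do !case: ifP. Qed.

Lemma pay4_mid v u x : v \in B -> x \in B -> x != v -> N u = [set v; x] ->
  pay4 v u = pay_deg (d v) (d x).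
Proof.
move=> vB xB xv Nu; rewrite /pay4.
have -> : N u :&: B = [set v; x].
  by rewrite Nu; apply/setIidPl/subsetP=> y /set2P[]->.
rewrite cards2 (eq_sym v) xv /= Nu.
have -> : [set v; x] :\ v = [set x].
  by apply/setP=> y; rewrite !inE; case: (y =P v) => [->|//]; rewrite eq_sym (negbTE xv).
by rewrite big_set1.
Qed.

Lemma mid v u : v \in B -> u \in N v -> u \in S -> #|N u :&: B| != 1 ->
  exists x, [/\ x \in B, x != v, N u = [set v; x] & pay4 v u = pay_deg (d v) (d x)].
Proof.
move=> vB uN uS one; have [vW _] := bigP _ _ _ vB.
have [du|du] := small_leaf_or_two esym vW uN uS.
  case/negP: one; rewrite (one_nbr du (nbrC esym vW uN)).
  have -> : [set v] :&: B = [set v] by apply/setIidPl/subsetP=> y /set1P->.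
  by rewrite cards1.
have [x [xv xB _ E]] := middle_nbr esym vB uN du one.
by exists x; split=> //; apply: pay4_mid.
Qed.

Lemma pay4_le2 v u : v \in B -> u \in N v :&: S -> pay4 v u <= 2.
Proof.
move=> vB /setIP[uN uS]; case: (#|N u :&: B| =P 1) => [one|/eqP one].
  by rewrite /pay4 one.
by have [x [_ _ _ ->]] := mid vB uN uS one; apply: pay_deg_le2.
Qed.

Lemma paid4_le v (A : {set T}) : v \in B -> N v :&: S \subset A -> paid v <= 2 * #|A|.
Proof. by move=> vB; apply: paid_le => u; apply: pay4_le2. Qed.

Lemma paid4_le2 v u : v \in B -> N v :&: S \subset [set u] -> paid v <= 2.
Proof. by move=> vB /(paid4_le vB); rewrite cards1. Qed.

Lemma paid4_le_deg v : v \in B -> paid v <= 2 * d v.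
Proof. by move=> vB; apply: paid4_le; rewrite ?subsetIl. Qed.

Lemma pay4_sum u : u \in S -> 0 < d u -> \sum_(v in N u :&: B) pay4 v u = 2.
Proof.
move=> uS d0; have := small_big_nbrs esym eirr degen k4 ltk chW irr uS d0.
have [uW du] := smallP _ _ _ uS.
case: (#|N u :&: B| =P 1) => [one _|/eqP one].
  by rewrite (eq_bigr (fun=> 2)) ?sum_nat_const ?one // => v _; rewrite /pay4 one.
case/andP=> c0 c2; have /eqP/cards2P[a [b [ab E]]] : #|N u :&: B| = 2.
  by move: one c0 c2; clear; case: #|_| => [|[|[|n]]].
have /setIP[aN aB] : a \in N u :&: B by rewrite E !inE eqxx.
have /setIP[bN bB] : b \in N u :&: B by rewrite E !inE eqxx orbT.
have Nu : N u = [set a; b].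
  apply/eqP; rewrite eq_sym eqEcard cards2 ab du andbT.
  by apply/subsetP=> x /set2P[]->.
have ba : b != a by rewrite eq_sym.
rewrite E big_setU1 ?inE //= big_set1 (pay4_mid aB bB ba Nu) (pay4_mid bB aB ab); last by rewrite setUC.
have [_ da] := bigP _ _ _ aB; have [_ db] := bigP _ _ _ bB.
by move: da db; rewrite /pay_deg; clear; do !case: ifP; lia.
Qed.

Definition leaf l := (l \in W) && (d l == 1).

Lemma leaf_alone v l : v \in B -> leaf l -> l \in N v -> d v <= 5 -> N v :&: S \subset [set l].
Proof.
move=> vB /andP[lW /eqP dl] lN dv5; have [vW dv] := bigP _ _ _ vB.
have vNl := nbrC esym vW lN.
apply/subsetP=> p /setIP[pN pS]; rewrite inE; apply: contraT => pl; have [_ dp] := smallP _ _ _ pS.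
have [dv3|[dv4|dv5']] : d v = 3 \/ d v = 4 \/ d v = 5 by move: dv dv5; clear; lia.
- have := leaf_three esym eirr degen k4 ltk chW irr lW dl vNl dv3 pN pl.
  by move: dp; clear; lia.
- have := leaf_four esym eirr degen k4 ltk chW irr lW dl vNl dv4 pN pl.
  by move: dp; clear; lia.
- by have := leaf_other vB lN dl pN pS pl; rewrite dv5' => /(_ isT).
Qed.

Lemma one_double v u : v \in B -> u \in N v -> u \in S -> #|N u :&: B| = 1 -> ~~ leaf u ->
  exists u2 h2, [/\ [/\ u2 != v, u2 \in S, d u2 = 2 & N u = [set v; u2]],
    [/\ h2 != u, h2 \in B & N u2 = [set u; h2]], 4 + e v u2 < d v & 4 + e h2 u < d h2].
Proof.
move=> vB uN uS one nleaf; have [vW _] := bigP _ _ _ vB.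
have [du|du] := small_leaf_or_two esym vW uN uS.
  by rewrite /leaf (nbrW uN) du in nleaf.
have [u2 [h2 [[u2v u2S d2 Nu] [h2u h2B Nu2] _ _]]] :=
  double_nbr esym eirr degen k4 ltk chW irr vB uN du one.
have [u2W _] := smallP _ _ _ u2S.
have u2N : u2 \in N u by rewrite Nu !inE eqxx orbT.
have h2N : h2 \in N u2 by rewrite Nu2 !inE eqxx orbT.
exists u2, h2; split=> //.
  exact: double_five vB uN du u2N d2.
exact: double_five h2B (nbrC esym u2W h2N) d2 (nbrC esym (nbrW uN) u2N) du.
Qed.

Lemma sole_sub v t x : v \in B -> t \in N v -> t \in S -> x \in B -> x != v -> N t = [set v; x] ->
  d x <= 4 -> d v <= 4 \/ (d v <= 5 /\ d x = 3) -> N v :&: S \subset [set t].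
Proof.
move=> vB tN tS xB xv Nt dx dv; apply/subsetP=> y /setIP[yN yS]; rewrite inE.
apply: contraT => yt; exfalso; have evy := nbrE yN; have vx : v != x by rewrite eq_sym.
(* [sole] allows degree 4 at one end and 3 at the other, plus one at an end adjacent to [y]; the
   roles of [v] and [x] are assigned accordingly. *)
have [dx3|dx3] : d x = 3 \/ d x <> 3 by move: dx; clear; lia.
  apply: (sole (t := t) (a := x) (b := v) (y := y)) => //; rewrite ?evy ?orbT //.
  - by rewrite setUC.
  - by move: dv; clear; lia.
  - by rewrite dx3.
apply: (sole (t := t) (a := v) (b := x) (y := y)) => //; rewrite ?evy ?orbT //.
  by move: dx; clear; lia.
by move: dv dx3; clear; lia.
Qed.

(** No thread with two inner vertices starts at degree 3, so each small neighbour lies between [v]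
    and a big [x]. A nonzero payment means that [x] has degree at most 4, and then [sole_sub] leaves
    no other small neighbour. *)
Lemma paid4_at3_noleaf v : v \in B -> d v = 3 -> (forall u, u \in N v -> ~~ leaf u) ->
  (forall u, u \in N v :&: S -> pay4 v u = 0) \/
  (exists u, N v :&: S = [set u] /\ pay4 v u = 1).
Proof.
move=> vB dv nleaf.
have mid3 u : u \in N v :&: S -> exists x, [/\ x \in B, x != v, N u = [set v; x] & pay4 v u = pay_deg 3 (d x)].
  move=> /setIP[uN uS]; case: (#|N u :&: B| =P 1) => [one|/eqP one].
    have [u2 [h2 [_ _ + _]]] := one_double vB uN uS one (nleaf u uN).
    by rewrite dv; clear; lia.
  by have := mid vB uN uS one; rewrite dv.
case: (boolP [exists u in N v :&: S, pay4 v u != 0]) => [/exists_inP[u uNS pu]|/exists_inPn H].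
  right; exists u; have [x [xB xv Nu E]] := mid3 u uNS; have /setIP[uN uS] := uNS.
  move: pu; rewrite E /pay_deg /=; case: ltnP => // dx _; split=> //.
  apply/eqP; rewrite eqEsubset sub1set uNS andbT.
  by apply: sole_sub Nu dx _ => //; left; rewrite dv.
by left=> u /H; rewrite negbK => /eqP.
Qed.

Lemma paid4_at3 v : v \in B -> d v = 3 -> paid v <= 2.
Proof.
move=> vB dv; case: (boolP [exists l in N v, leaf l]) => [/exists_inP[l lN ll]|/exists_inPn nl].
  by apply: paid4_le2 (leaf_alone vB ll lN _) => //; rewrite dv.
case: (paid4_at3_noleaf vB dv nl) => [H|[u [E _]]].
  by rewrite /payment big1.
by apply: (paid4_le2 (u := u)) => //; rewrite E.
Qed.

Lemma paid4_at3_le1 v : v \in B -> d v = 3 -> (forall u, u \in N v -> ~~ leaf u) -> paid v <= 1.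
Proof.
move=> vB dv nl; case: (paid4_at3_noleaf vB dv nl) => [H|[u [E pu]]].
  by rewrite /payment big1.
by rewrite /payment E big_set1 pu.
Qed.

Lemma paid4_at3_eq0 v u x : v \in B -> d v = 3 -> u \in N v -> u \in S -> N u = [set v; x] ->
  x \in B -> x != v -> 4 < d x -> paid v = 0.
Proof.
move=> vB dv uN uS Nu xB xv dx; have uNS : u \in N v :&: S by rewrite in_setI uN.
have du : d u = 2 by rewrite /dg Nu cards2 eq_sym xv.
have nl l : l \in N v -> ~~ leaf l.
  move=> lN; apply/negP=> ll; have dv5 : d v <= 5 by rewrite dv.
  have := subsetP (leaf_alone vB ll lN dv5) u uNS; rewrite inE => /eqP ul.
  by case/andP: ll => _; rewrite -ul du.
case: (paid4_at3_noleaf vB dv nl) => [H|[u' [E pu]]]; first by rewrite /payment big1.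
move: uNS; rewrite E inE => /eqP uu; move: pu.
by rewrite -uu (pay4_mid vB xB xv Nu) dv /pay_deg /= dx.
Qed.

Lemma paid4_at4 v : v \in B -> d v = 4 -> paid v <= 4 /\
  forall u x, u \in N v -> u \in S -> N u = [set v; x] -> x \in B -> x != v -> d x <= 4 -> paid v <= 1.
Proof.
move=> vB dv; case: (boolP [exists l in N v, leaf l]) => [/exists_inP[l lN ll]|/exists_inPn nl].
  have dv5 : d v <= 5 by rewrite dv.
  have sub := leaf_alone vB ll lN dv5; split; first by have := paid4_le2 vB sub; clear; lia.
  move=> u x uN uS Nu xB xv _; have : u \in N v :&: S by rewrite in_setI uN.
  move/(subsetP sub); rewrite inE => /eqP ul; case/andP: ll => _.
  by rewrite -ul /dg Nu cards2 (eq_sym v) xv.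
have pay1 u : u \in N v :&: S -> pay4 v u <= 1.
  move=> /setIP[uN uS]; case: (#|N u :&: B| =P 1) => [one|/eqP one].
    have [u2 [h2 [_ _ + _]]] := one_double vB uN uS one (nl u uN).
    by rewrite dv; clear; lia.
  by have [x [_ _ _ ->]] := mid vB uN uS one; rewrite dv.
split; first by have := paid_le pay1 (subsetIl _ _); rewrite -/(dg _ _ _) dv.
move=> u x uN uS Nu xB xv dx; rewrite -(cards1 u) -[#|_|]mul1n; apply: paid_le => //.
by apply: sole_sub Nu dx _ => //; left; rewrite dv.
Qed.

(** A payment of 2 goes to a leaf, into a thread with two inner vertices or towards degree 3; each
    time the recipient is the only small neighbour. Otherwise there are at most five payments of at
    most 1. *)
Lemma paid4_at5 v : v \in B -> d v = 5 -> paid v <= 5.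
Proof.
move=> vB dv; have dv5 : d v <= 5 by rewrite dv.
have le2 u : N v :&: S \subset [set u] -> paid v <= 5.
  by move/(paid4_le2 vB); clear; lia.
case: (boolP [exists l in N v, leaf l]) => [/exists_inP[l lN ll]|/exists_inPn nl].
  exact: le2 (leaf_alone vB ll lN dv5).
case: (boolP [exists u in N v :&: S, pay4 v u == 2]) => [/exists_inP[u uNS /eqP pu]|/exists_inPn H].
  apply: (le2 u); have /setIP[uN uS] := uNS; case: (#|N u :&: B| =P 1) => [one|/eqP one].
    have [u2 [h2 [[u2v u2S d2 Nu] _ dd _]]] := one_double vB uN uS one (nl u uN).
    have du : d u = 2 by rewrite /dg Nu cards2 eq_sym u2v.
    have u2N : u2 \in N u by rewrite Nu !inE eqxx orbT.
    apply/subsetP=> y /setIP[yN yS]; rewrite inE; apply: contraT => yu.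
    have yu2 : y != u2 by apply: contraTneq dd => <-; rewrite (nbrE yN) dv.
    by have := double_other vB uN du u2N d2 yN yS yu yu2; rewrite dv; clear; lia.
  have [x [xB xv Nu E]] := mid vB uN uS one; move: pu; rewrite E dv /pay_deg /=.
  case: eqP => // dx3 _; apply: sole_sub Nu _ _ => //; first by rewrite dx3.
  by right; rewrite dv dx3.
have := paid_le (c := 1) (w := pay4) (A := N v) _ (subsetIl _ _).
rewrite -/(dg _ _ _) dv; apply=> u uNS.
by have := pay4_le2 vB uNS; have := H u uNS; clear; lia.
Qed.

Lemma paid4_bound v : v \in B -> 2 + paid v <= 2 * 2 * (d v - 2).
Proof.
move=> vB; have [vW dv] := bigP _ _ _ vB.
have [d3|[d4|[d5|d6]]] : d v = 3 \/ d v = 4 \/ d v = 5 \/ 5 < d v by move: dv; clear; lia.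
- by have := paid4_at3 vB d3; rewrite d3; clear; lia.
- by have [+ _] := paid4_at4 vB d4; rewrite d4; clear; lia.
- by have := paid4_at5 vB d5; rewrite d5; clear; lia.
- by have := paid4_le_deg vB; move: d6; clear; lia.
Qed.

Lemma slack4_sum : \sum_(v in B) slack v + 2 * #|W| = 2 * 2 * excess e W + 2 * #|isolated e W|.
Proof. by have := sum_slack esym pay4_sum paid4_bound. Qed.

(** In all residues modulo 4, [ex4] gives at most 2|W| + 4 for four times the excess, with equality
    possible at residue 2 only. *)
Lemma slack4_seq (s : seq T) : uniq s -> {subset s <= B} ->
  sumn (map slack s) <= 4 + 2 * #|isolated e W|.
Proof.
move=> us sB; apply: leq_trans (sum_sub slack us sB) _.
by have := slack4_sum; move: ex4; clear; lia.
Qed.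

Lemma subset_big2 a b : a \in B -> b \in B -> {subset [:: a; b] <= B}.
Proof. by move=> aB bB z; rewrite in_cons mem_seq1 => /orP[]/eqP->. Qed.

Lemma subset_big3 a b c : a \in B -> b \in B -> c \in B -> {subset [:: a; b; c] <= B}.
Proof. by move=> aB bB cB z; rewrite in_cons => /orP[/eqP->|/subset_big2->]. Qed.

Lemma slack4_pair a b : a \in B -> b \in B -> a != b -> slack a + slack b <= 4 + 2 * #|isolated e W|.
Proof.
by move=> aB bB ab; have := slack4_seq _ (subset_big2 aB bB); rewrite /= inE ab addn0; apply.
Qed.

Lemma slack4_ge2 v : v \in B -> 3 < d v -> 2 <= slack v.
Proof.
move=> vB dv; rewrite /slack_of.
have [d4|[d5|d6]] : d v = 4 \/ d v = 5 \/ 5 < d v by move: dv; clear; lia.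
- by have [+ _] := paid4_at4 vB d4; rewrite d4; clear; lia.
- by have := paid4_at5 vB d5; rewrite d5; clear; lia.
- by have := paid4_le_deg vB; move: d6; clear; lia.
Qed.

(** With an isolated vertex, some small vertex lies between two vertices of degree at least 4; one
    of them has slack at least 5 and the other at least 2, while only 4 + 2 is available. *)
Lemma no_isolated_four z : z \in W -> 0 < d z.
Proof.
move=> zW; rewrite lt0n; apply/eqP=> dz.
have [u [h [hW dh uN du]]] := exists_small_big esym eirr degen k4 ltk chW irr.
have iso := isolated_struct esym eirr degen k4 ltk chW irr zW dz.
have pay1 v x : v \in B -> x \in N v :&: S -> exists y, [/\ y \in B, y != v, N x = [set v; y], 3 < d y & pay4 v x = pay_deg (d v) (d y)].
  move=> vB /setIP[xN xS]; have [vW dv] := bigP _ _ _ vB; have [xW dx] := smallP _ _ _ xS.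
  have [d2 H] := iso x v vW dv xN dx; case: (#|N x :&: B| =P 1) => [one|/eqP one].
    have [u2 [h2 [[_ _ d2' E] _ _ _]]] := double_nbr esym eirr degen k4 ltk chW irr vB xN d2 one.
    by have := H u2; rewrite E !inE eqxx orbT d2' => /(_ isT).
  have [y [yB yv Ny E]] := mid vB xN xS one; exists y; split=> //.
  by apply: H; rewrite Ny !inE eqxx orbT.
have slack5 v : v \in B -> 4 < d v -> 5 <= slack v.
  move=> vB dv; suff : paid v <= 1 * d v by rewrite /slack_of; move: dv; clear; lia.
  apply: paid_le; last exact: subsetIl.
  move=> x xNS; have [y [_ _ _ dy ->]] := pay1 v x vB xNS; rewrite /pay_deg.
  by move: dv dy; clear; do !case: ifP => //; lia.
have slack44 v x y : v \in B -> x \in N v -> x \in S -> N x = [set v; y] -> y \in B -> y != v ->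
    d v = 4 -> d y = 4 -> 5 <= slack v.
  move=> vB xN xS Nx yB yv dv dy; have [_ H] := paid4_at4 vB dv.
  have := H x y xN xS Nx yB yv; rewrite dy => /(_ isT).
  by rewrite /slack_of dv; clear; lia.
have hB : h \in B by rewrite in_big hW.
have uS : u \in S by rewrite in_small (nbrW uN).
have uNS : u \in N h :&: S by rewrite in_setI uN.
have [x [xB xh Nu dx _]] := pay1 h u hB uNS.
have dh4 : 3 < d h.
  by have [_ H] := iso u h hW dh uN du; apply: H; rewrite Nu !inE eqxx.
have uNx : u \in N x by apply: nbrC; rewrite ?(nbrW uN) // Nu !inE eqxx orbT.
have hx : h != x by rewrite eq_sym.
have := slack4_pair hB xB hx; have := isolated_le1 esym eirr degen k4 ltk chW irr.
suff : 7 <= slack h + slack x by clear; lia.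
have [sh sx] := (slack4_ge2 hB dh4, slack4_ge2 xB dx).
case: (ltnP 4 (d h)) => dh5; first by have := slack5 h hB dh5; move: sx; clear; lia.
case: (ltnP 4 (d x)) => dx5; first by have := slack5 x xB dx5; move: sh; clear; lia.
have [eh ex] : d h = 4 /\ d x = 4 by move: dh4 dh5 dx dx5; clear; lia.
by have := slack44 h u x hB uN uS Nu xB xh eh ex; move: sx; clear; lia.
Qed.

Lemma isolated0_four : #|isolated e W| = 0.
Proof.
apply: eq_card0 => z; rewrite !inE; case zW: (z \in W) => //=.
by have := no_isolated_four zW; case: (d z).
Qed.

Lemma slack4_seq_le4 (s : seq T) : uniq s -> {subset s <= B} -> sumn (map slack s) <= 4.
Proof. by move=> us sB; have := slack4_seq us sB; rewrite isolated0_four. Qed.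

Lemma slack4_le4 a : a \in B -> slack a <= 4.
Proof.
move=> aB; have := @slack4_seq_le4 [:: a] isT; rewrite /= addn0; apply.
by move=> z; rewrite mem_seq1 => /eqP->.
Qed.

Lemma slack4_pair_le4 a b : a \in B -> b \in B -> a != b -> slack a + slack b <= 4.
Proof. by move=> aB bB ab; have := slack4_pair aB bB ab; rewrite isolated0_four. Qed.

Lemma slack4_triple_le4 a b c : a \in B -> b \in B -> c \in B -> a != b -> a != c -> b != c ->
  slack a + slack b + slack c <= 4.
Proof.
move=> aB bB cB ab ac bc; have := slack4_seq_le4 _ (subset_big3 aB bB cB).
by rewrite /= !inE negb_or ab ac bc addn0 addnA; apply.
Qed.

Lemma leaf_three_nbrs x l : x \in B -> d x = 3 -> l \in N x -> leaf l ->
  exists p q, [/\ p != q, p \in N x, q \in N x & [/\ p \in B, q \in B, 3 < d p & 3 < d q]].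
Proof.
move=> xB dx lN /andP[lW /eqP dl]; have [xW _] := bigP _ _ _ xB.
have l3 := leaf_three esym eirr degen k4 ltk chW irr lW dl (nbrC esym xW lN) dx.
have /eqP/cards2P[p [q [pq E]]] : #|N x :\ l| = 2.
  by have := cardsD1 l (N x); rewrite lN -/(dg _ _ _) dx; clear; lia.
have : p \in N x :\ l by rewrite E !inE eqxx.
have : q \in N x :\ l by rewrite E !inE eqxx orbT.
rewrite !in_setD1 => /andP[ql qN] /andP[pl pN]; exists p, q.
have [dp dq] := (l3 p pN pl, l3 q qN ql).
by rewrite !in_big (nbrW pN) (nbrW qN) (ltnW dp) (ltnW dq).
Qed.

(** Only a vertex of degree 3 with a leaf can spend its whole charge, and then [leaf_three]
    describes its other neighbours. *)
Lemma slack4_eq0 x : x \in B -> slack x = 0 ->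
  exists p q, [/\ p != q, p \in N x, q \in N x & [/\ p \in B, q \in B, 3 < d p & 3 < d q]].
Proof.
move=> xB sx; have [xW dx] := bigP _ _ _ xB.
have dx3 : d x = 3.
  case: (leqP (d x) 3) => dx3; first by move: dx dx3; clear; lia.
  by have := slack4_ge2 xB dx3; rewrite sx.
case: (boolP [exists l in N x, leaf l]) => [/exists_inP[l lN ll]|/exists_inPn nl].
  exact: leaf_three_nbrs xB dx3 lN ll.
by have := paid4_at3_le1 xB dx3 nl; move: sx; rewrite /slack_of dx3; clear; lia.
Qed.

Lemma big_deg v : v \in B -> d v <= 7 /\ d v != 5.
Proof.
move=> vB; have := slack4_le4 vB; rewrite /slack_of; case: (d v =P 5) => [d5|].
  by have := paid4_at5 vB d5; rewrite d5; clear; lia.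
by have := paid4_le_deg vB; clear; lia.
Qed.

(* With [d v = 7] and all the charge at [v], the graph has 8 vertices and excess 5. *)
Lemma no_seven v : v \in B -> d v != 7.
Proof.
move=> vB; apply/eqP=> d7.
have sv : slack v = 4.
  by have := slack4_le4 vB; have := paid4_le_deg vB; rewrite /slack_of d7; clear; lia.
have only x : x \in B -> x = v.
  move=> xB; apply/eqP; apply: contraT => xv; have vx : v != x by rewrite eq_sym.
  have sx : slack x = 0 by have := slack4_pair_le4 vB xB vx; rewrite sv; clear; lia.
  have [p [q [pq _ _ [pB qB dp dq]]]] := slack4_eq0 xB sx.
  have := slack4_pair_le4 pB qB pq; have := slack4_ge2 pB dp; have := slack4_ge2 qB dq.
  have [pv|pv] := eqVneq p v.
    by rewrite pv sv; clear; lia.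
  by have := slack4_pair_le4 pB vB pv; rewrite sv; clear; lia.
have BE : B = [set v].
  by apply/setP=> x; rewrite inE; apply/idP/eqP => [/only|->].
have := slack4_sum; rewrite isolated0_four -sum_big_excess BE !big_set1 sv d7 /= => eq8.
have n8 : #|W| = 8 by move: eq8; clear; lia.
by move: ex4; rewrite n8 -sum_big_excess BE big_set1 d7.
Qed.

(** Beside a leaf there is room for at most one more small neighbour, so the slack would be at least
    14 - 4, more than 4. *)
Lemma six_leaf v l : v \in B -> d v = 6 -> l \in N v -> ~~ leaf l.
Proof.
move=> vB d6 lN; apply/negP=> ll; have /andP[lW /eqP dl] := ll.
have sub : exists y, N v :&: S \subset [set l; y].
  case: (boolP [exists y in N v :&: S, y != l]) => [/exists_inP[y /setIP[yN yS] yl]|/exists_inPn H].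
    exists y; apply/subsetP=> z /setIP[zN zS]; rewrite !inE; apply: contraT.
    rewrite negb_or => /andP[zl zy].
    by have := leaf_two_others vB lN dl yN yS yl zN zS zl zy; rewrite d6 => /(_ isT).
  by exists l; apply/subsetP=> z /H; rewrite negbK => /eqP->; rewrite !inE eqxx.
have [y /(paid4_le vB)] := sub; have := slack4_le4 vB; rewrite /slack_of d6.
by rewrite cards2; case: (_ != _); clear; lia.
Qed.

Definition full_payers v := [set u in N v :&: S | pay4 v u == 2].

Lemma paid4_full_payers v : v \in B -> paid v <= #|N v :&: S| + #|full_payers v|.
Proof.
move=> vB; rewrite /payment -[X in _ <= X + _]sum1_card -sum1_card.
have -> : \sum_(i in full_payers v) 1 = \sum_(i in N v :&: S) (pay4 v i == 2 : nat).
  rewrite big_mkcond [RHS]big_mkcond; apply: eq_bigr => u _.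
  by rewrite [u \in full_payers v]inE; case: (u \in _); case: eqP.
rewrite -big_split /=; apply: leq_sum => u uNS.
by have := pay4_le2 vB uNS; case: eqP; clear; lia.
Qed.

(** The slack is 14 minus the payments and at most 4, so six payments of at most 2 have to reach
    10. *)
Lemma card_full_payers v : v \in B -> d v = 6 -> 4 <= #|full_payers v|.
Proof.
move=> vB d6; have := paid4_full_payers vB; have := slack4_le4 vB; rewrite /slack_of d6.
by have := subset_leq_card (subsetIl (N v) S); rewrite -/(dg _ _ _) d6; clear; lia.
Qed.

Lemma full_payer_cases v u : v \in B -> d v = 6 -> u \in full_payers v ->
  (exists u2 h2, [/\ [/\ u2 != v, u2 \in S, d u2 = 2 & N u = [set v; u2]],
     [/\ h2 \in B, d h2 = 6 & N u2 = [set u; h2]] & h2 != v]) \/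
  (exists a, [/\ a \in B, a != v, N u = [set v; a], d a = 3 & slack a = 2]).
Proof.
move=> vB d6; rewrite inE => /andP[uNS /eqP pu]; have /setIP[uN uS] := uNS.
have [vW _] := bigP _ _ _ vB.
case: (#|N u :&: B| =P 1) => [one|/eqP one].
  left; have [u2 [h2 [[u2v u2S d2 Nu] [h2u h2B Nu2] _ dh2]]] :=
    one_double vB uN uS one (six_leaf vB d6 uN).
  exists u2, h2; split=> //.
    have [le7 n5] := big_deg h2B; have n7 := no_seven h2B.
    by split=> //; move: le7 n5 n7 dh2; clear; lia.
  apply/eqP=> h2v; have evu2 : e v u2.
    have : h2 \in N u2 by rewrite Nu2 !inE eqxx orbT.
    by rewrite h2v => /nbrE; rewrite esym.
  (* If the thread returned to [v], another small neighbour [y] would by [double_other] require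
     degree above 6. *)
  have [y yP] : exists y, y \in (full_payers v :\ u) :\ u2.
    apply/card_gt0P; have := card_full_payers vB d6; have := cardsD1 u (full_payers v).
    have := cardsD1 u2 (full_payers v :\ u); case: (_ \in _); case: (_ \in _); clear; lia.
  move: yP; rewrite !in_setD1 inE => /and3P[yu2 yu /andP[/setIP[yN yS] _]].
  have du : d u = 2 by rewrite /dg Nu cards2 eq_sym u2v.
  have u2N : u2 \in N u by rewrite Nu !inE eqxx orbT.
  by have := double_other vB uN du u2N d2 yN yS yu yu2; rewrite evu2 d6.
right; have [a [aB av Nu E]] := mid vB uN uS one; move: pu; rewrite E d6 /pay_deg /=.
case: eqP => // da _; exists a; split=> //.
have uNa : u \in N a by apply: nbrC; rewrite ?(nbrW uN) // Nu !inE eqxx orbT.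
have va : v != a by rewrite eq_sym.
have Nu' : N u = [set a; v] by rewrite setUC.
by rewrite /slack_of da (paid4_at3_eq0 aB da uNa uS Nu' vB va) ?d6.
Qed.

(** In the other case [v] and the degree-3 vertex [a] use up the total of 4. Of the at least four
    vertices in [full_payers v], one is not among the three neighbours of [a] and leads to a third
    vertex of slack at least 2. *)
Lemma full_payer_double v u : v \in B -> d v = 6 -> u \in full_payers v ->
  exists u2 h2, [/\ [/\ u2 != v, u2 \in S, d u2 = 2 & N u = [set v; u2]],
     [/\ h2 \in B, d h2 = 6 & N u2 = [set u; h2]] & h2 != v].
Proof.
move=> vB d6 uP; have [//|[a [aB av Nu da sa]]] := full_payer_cases vB d6 uP; exfalso.
have d63 : 3 < d v by rewrite d6.
have sv := slack4_ge2 vB d63; have va : v != a by rewrite eq_sym.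
have [y yP] : exists y, y \in full_payers v :\: N a.
  apply/card_gt0P; rewrite cardsD; have := card_full_payers vB d6.
  by have := subset_leq_card (subsetIr (full_payers v) (N a)); rewrite -/(dg _ _ _) da; clear; lia.
move: yP; rewrite in_setD => /andP[yNa yP].
have [[y2 [h2 [_ [h2B dh2 _] h2v]]]|[a' [a'B a'v Ny da' sa']]] := full_payer_cases vB d6 yP.
  have ah2 : a != h2 by apply/eqP=> ah2; rewrite -ah2 da in dh2.
  have vh2 : v != h2 by rewrite eq_sym.
  have dh3 : 3 < d h2 by rewrite dh2.
  have := slack4_triple_le4 vB aB h2B va vh2 ah2; have := slack4_ge2 h2B dh3.
  by rewrite sa; move: sv; clear; lia.
have aa' : a != a'.
  apply: contraNneq yNa => aa'; have yW : y \in W by move: yP; rewrite inE => /andP[/setIP[/nbrW]].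
  by apply: (nbrC esym yW); rewrite Ny -aa' !inE eqxx orbT.
have va' : v != a' by rewrite eq_sym.
by have := slack4_triple_le4 vB aB a'B va va' aa'; rewrite sa sa'; move: sv; clear; lia.
Qed.

(** Slack 2 is the minimum at degree 6, so [v] and [v'] use up the total of 4. A third big vertex
    would have slack 0 and hence a neighbour of degree above 3, necessarily [v] or [v'], all of
    whose neighbours are small. *)
Lemma theta_of_six v : v \in B -> d v = 6 -> exists v', theta e W 6 v v'.
Proof.
move=> vB d6; have [vW _] := bigP _ _ _ vB.
have sl6 x : x \in B -> d x = 6 -> 2 <= slack x.
  by move=> xB dx; apply: slack4_ge2; rewrite ?dx.
have [u uP] : exists u, u \in full_payers v by apply/card_gt0P; apply: leq_trans (card_full_payers vB d6).
have [_ [v' [_ [v'B dv' _] v'v]]] := full_payer_double vB d6 uP.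
have [v'W _] := bigP _ _ _ v'B; have vv' : v != v' by rewrite eq_sym.
have sum4 := slack4_pair_le4 vB v'B vv'; have [sv sv'] := (sl6 v vB d6, sl6 v' v'B dv').
have all2 x : x \in B -> d x = 6 -> slack x = 2 -> forall y, y \in N x -> y \in full_payers x.
  move=> xB dx sx y yN; have px : paid x = 12.
    by have := paid4_le_deg xB; move: sx; rewrite /slack_of dx; clear; lia.
  have le6 : #|N x :&: S| <= 6 by rewrite -dx subset_leq_card ?subsetIl.
  have sub : full_payers x \subset N x by apply/subsetP=> z; rewrite inE => /andP[/setIP[]].
  have : full_payers x == N x.
    rewrite eqEcard sub -/(dg _ _ _) dx; have := paid4_full_payers xB; move: px le6; clear; lia.
  by move/eqP->.
have only x : x \in B -> x = v \/ x = v'.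
  move=> xB; case: (x =P v) => [|/eqP xv]; first by left.
  case: (x =P v') => [|/eqP xv']; first by right.
  have [vx v'x] : v != x /\ v' != x by rewrite eq_sym xv eq_sym xv'.
  have sx : slack x = 0 by have := slack4_triple_le4 vB v'B xB vv' vx v'x; move: sv sv'; clear; lia.
  have [p [q [pq pN qN [pB qB dp dq]]]] := slack4_eq0 xB sx.
  have far y : y \in B -> 3 < d y -> y \in N x -> y = v \/ y = v'.
    move=> yB dy yN; case: (y =P v) => [|/eqP yv]; first by left.
    case: (y =P v') => [|/eqP yv']; first by right.
    have [vy v'y] : v != y /\ v' != y by rewrite eq_sym yv eq_sym yv'.
    have := slack4_triple_le4 vB v'B yB vv' vy v'y; have := slack4_ge2 yB dy.
    by move: sv sv'; clear; lia.
  have xW : x \in W by case/bigP: xB.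
  have contra y : y \in B -> d y = 6 -> slack y = 2 -> y \in N x -> False.
    move=> yB dy sy /(nbrC esym xW)/(all2 y yB dy sy).
    by rewrite inE => /andP[/setIP[_ /smallP[_]]]; case/bigP: xB => _; clear; lia.
  exfalso; case: (far p pB dp pN) => pE; rewrite pE in pN.
    by apply: (contra v) => //; move: sum4 sv sv'; clear; lia.
  by apply: (contra v') => //; move: sum4 sv sv'; clear; lia.
have thread x x' : x \in B -> d x = 6 -> slack x = 2 -> (forall z, z \in B -> z = x \/ z = x') ->
    forall y, y \in N x -> exists y2, [/\ y2 \in N x', N y = [set x; y2] & N y2 = [set y; x']].
  move=> xB dx sx onlyx y yN; have [xW _] := bigP _ _ _ xB.
  have [y2 [x2 [[y2x y2S d2 Ny] [x2B _ Ny2] x2x]]] := full_payer_double xB dx (all2 x xB dx sx y yN).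
  have [E|E] := onlyx x2 x2B; first by rewrite E eqxx in x2x.
  rewrite {}E in Ny2; exists y2; split=> //.
  by apply: nbrC; [exact: esym | case/smallP: y2S | rewrite Ny2 !inE eqxx orbT].
exists v'; split.
- by split.
- apply/setP=> x; rewrite !in_setU !in_set1; apply/idP/idP; last first.
    by case/orP=> [/orP[]/eqP->|/orP[]/nbrW].
  move=> xW; case xB: (x \in B); first by case: (only x xB) => ->; rewrite eqxx ?orbT.
  have xS : x \in S by rewrite small_or_big ?xB.
  have := small_big_nbrs esym eirr degen k4 ltk chW irr xS (no_isolated_four xW).
  case/andP=> /card_gt0P[h /setIP[hN hB]] _.
  by case: (only h hB) => E; rewrite -E (nbrC esym xW hN) ?orbT.
- by apply: thread => //; move: sv sv' sum4; clear; lia.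
- by apply: thread => //; [move: sv sv' sum4; clear; lia | move=> z /only[]; [right|left]].
Qed.

(** Degree 4 would have slack at least 4 and is excluded first. Then all big vertices have degree 3
    and positive slack, so there are at most four; around a small [u] between [h] and [x] this
    forces a common big neighbour [z], and [h, x, z, u] is a quadruple with two big members. *)
Lemma not_all_le4 : (forall v, v \in B -> d v <= 4) -> False.
Proof.
move=> le4.
have sl4 v : v \in B -> d v = 4 -> 4 <= slack v.
  move=> vB dv; have [_ H] := paid4_at4 vB dv; rewrite /slack_of dv.
  suff : paid v <= 2 by clear; lia.
  case: (boolP [exists l in N v, leaf l]) => [/exists_inP[l lN ll]|/exists_inPn nl].
    by apply: paid4_le2 (leaf_alone vB ll lN _) => //; rewrite dv.
  case: (set_0Vmem (N v :&: S)) => [E|[u /setIP[uN uS]]].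
    by rewrite /payment E big_set0.
  case: (#|N u :&: B| =P 1) => [one|/eqP one].
    by have [? [? [_ _ + _]]] := one_double vB uN uS one (nl u uN); rewrite dv; clear; lia.
  have [x [xB xv Nu _]] := mid vB uN uS one.
  by have := H u x uN uS Nu xB xv (le4 x xB); clear; lia.
have no44 a b : a \in B -> b \in B -> a != b -> d a = 4 -> d b = 4 -> False.
  move=> aB bB ab da db; have := slack4_pair_le4 aB bB ab.
  by have := sl4 a aB da; have := sl4 b bB db; clear; lia.
have eq4 v : v \in B -> 3 < d v -> d v = 4.
  by move=> vB dv; have := le4 v vB; move: dv; clear; lia.
have pos x : x \in B -> 0 < slack x.
  move=> xB; rewrite lt0n; apply/eqP=> /(slack4_eq0 xB)[p [q [pq _ _ [pB qB dp dq]]]].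
  exact: no44 pB qB pq (eq4 p pB dp) (eq4 q qB dq).
have all3 v : v \in B -> d v = 3.
  move=> vB; have [vW dv] := bigP _ _ _ vB; have := le4 v vB; case: (d v =P 4) => [d4 _|].
    have sv := sl4 v vB d4; exfalso.
    (* As the only big vertex, [v] must have a leaf, which is then its only small neighbour; its
       remaining neighbours are neither small nor big. *)
    have alone x : x \in B -> x = v.
      move=> xB; apply/eqP; apply: contraT => xv; have := slack4_pair_le4 xB vB xv.
      by have := pos x xB; move: sv; clear; lia.
    have [l [lN ll]] : exists l, l \in N v /\ leaf l.
      case: (boolP [exists l in N v, leaf l]) => [/exists_inP[l lN ll]|/exists_inPn nl].
        by exists l.
      have := slack4_le4 vB; rewrite /slack_of d4; suff : paid v <= 1 by clear; lia.
      case: (set_0Vmem (N v :&: S)) => [E|[u /setIP[uN uS]]].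
        by rewrite /payment E big_set0.
      case: (#|N u :&: B| =P 1) => [one|/eqP one].
        by have [? [? [_ _ + _]]] := one_double vB uN uS one (nl u uN); rewrite d4; clear; lia.
      have [x [xB xv Nu _]] := mid vB uN uS one.
      by rewrite (alone x xB) eqxx in xv.
    have v5 : d v <= 5 by rewrite d4.
    have sub := leaf_alone vB ll lN v5.
    have [p] : exists p, p \in N v :\ l.
      by apply/card_gt0P; have := cardsD1 l (N v); rewrite lN -/(dg _ _ _) d4; clear; lia.
    rewrite in_setD1 => /andP[pl pN]; case pB: (p \in B).
      by have := nbr_neq eirr pN; rewrite (alone p pB) eqxx.
    have : p \in N v :&: S by rewrite in_setI pN small_or_big ?pB ?(nbrW pN).
    by move/(subsetP sub); rewrite inE (negbTE pl).
  by move: dv; clear; lia.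
have no_leaf3 v l : v \in B -> l \in N v -> ~~ leaf l.
  move=> vB lN; apply/negP=> ll.
  have [p [q [_ _ _ [pB _ dp _]]]] := leaf_three_nbrs vB (all3 v vB) lN ll.
  by rewrite (all3 p pB) in dp.
have midx v u : v \in B -> u \in N v -> u \in S ->
    exists x, [/\ x \in B, x != v, N u = [set v; x] & N v :&: S \subset [set u]].
  move=> vB uN uS; case: (#|N u :&: B| =P 1) => [one|/eqP one].
    have [? [? [_ _ + _]]] := one_double vB uN uS one (no_leaf3 v u vB uN).
    by rewrite (all3 v vB); clear; lia.
  have [x [xB xv Nu _]] := mid vB uN uS one; exists x; split=> //.
  by apply: sole_sub Nu _ _ => //; [rewrite all3 | left; rewrite all3].
have [u [h [hW dh uN du]]] := exists_small_big esym eirr degen k4 ltk chW irr.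
have hB : h \in B by rewrite in_big hW.
have uS : u \in S by rewrite in_small (nbrW uN).
have uW := nbrW uN.
have [x [xB xh Nu subh]] := midx h u hB uN uS.
have hx : h != x by rewrite eq_sym.
have du2 : d u = 2 by rewrite /dg Nu cards2 hx.
have [hNu xNu] : h \in N u /\ x \in N u by rewrite Nu !inE !eqxx orbT.
have nhx := no_triangle esym eirr degen k4 ltk chW irr uW du2 hNu xNu (all3 h hB) (all3 x xB) hx.
have uNx := nbrC esym uW xNu.
have [_ [_ _ _ subx]] := midx x u xB uNx uS.
have bigs v : v \in B -> N v :&: S \subset [set u] -> u \in N v ->
    exists p q, [/\ p != q, p \in B, q \in B, p \in N v & q \in N v].
  move=> vB sub uv; have /eqP/cards2P[p [q [pq E]]] : #|N v :\ u| = 2.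
    by have := cardsD1 u (N v); rewrite uv -/(dg _ _ _) (all3 v vB); clear; lia.
  have : p \in N v :\ u by rewrite E !inE eqxx.
  have : q \in N v :\ u by rewrite E !inE eqxx orbT.
  rewrite !in_setD1 => /andP[qu qN] /andP[pu pN]; exists p, q.
  have inB y : y \in N v -> y != u -> y \in B.
    move=> yN yu; apply: contraT => yB; have : y \in N v :&: S.
      by rewrite in_setI yN small_or_big ?(nbrW yN).
    by move/(subsetP sub); rewrite inE (negbTE yu).
  by split=> //; apply: inB.
have [c [c' [cc' cB c'B cN c'N]]] := bigs h hB subh uN.
have [z [_ [_ zB _ zN _]]] := bigs x xB subx uNx.
have nz : z != h by apply: contraTneq (nbrE zN) => ->; rewrite esym nhx.
have zx := nbr_neq eirr zN; have [ch c'h] := (nbr_neq eirr cN, nbr_neq eirr c'N).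
have cx : c != x by apply: contraTneq (nbrE cN) => ->; rewrite nhx.
have c'x : c' != x by apply: contraTneq (nbrE c'N) => ->; rewrite nhx.
(* Otherwise five big vertices would have total slack at least 5. *)
have zcc' : (z == c) || (z == c').
  apply: contraT; rewrite negb_or => /andP[zc zc'].
  have us : uniq [:: h; x; c; c'; z].
    by rewrite /= !inE !negb_or hx (eq_sym h) ch (eq_sym h) c'h (eq_sym h) nz (eq_sym x) cx
      (eq_sym x) c'x (eq_sym x) zx cc' (eq_sym c) zc (eq_sym c') zc'.
  have sub : {subset [:: h; x; c; c'; z] <= B}.
    by apply/allP; rewrite /= hB xB cB c'B zB.
  have := slack4_seq_le4 us sub; rewrite /=.
  have := pos h hB; have := pos x xB; have := pos c cB; have := pos c' c'B; have := pos z zB.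
  by clear; lia.
have zNh : z \in N h by case/orP: zcc' => /eqP->.
have q : quad h x z u.
  have [[zu _] [hu _] [xu _]] := And3 (big_small_neq zB uS) (big_small_neq hB uS) (big_small_neq xB uS).
  split.
  - by rewrite /= !inE !negb_or hx (eq_sym h z) nz hu (eq_sym x z) zx xu zu.
  - by apply/allP; rewrite /= hW uW (nbrW zN) (nbrW xNu).
  - by rewrite (all3 h hB); clear; lia.
  - by rewrite (all3 x xB) (nbrE uNx); clear; lia.
  - by rewrite (all3 z zB) (nbrE zNh) (nbrE zN) du2 (nbrE uN) (nbrE uNx); clear; lia.
by apply: (quad_two_big (a := h) (b := x) q) => //; rewrite ?inE ?eqxx ?orbT ?all3.
Qed.

Lemma four_theta : exists v v', theta e W 6 v v'.
Proof.
case: (boolP [exists v in B, 4 < d v]) => [/exists_inP[v vB dv]|/exists_inPn H].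
  have [le7 n5] := big_deg vB; have n7 := no_seven vB.
  have d6 : d v = 6 by move: dv le7 n5 n7; clear; lia.
  by exists v; apply: theta_of_six.
by case: not_all_le4 => v /H; rewrite -leqNgt.
Qed.

End Four.

(** * Distinct representatives of colour lists *)

Section Representatives.
Variable C : finType.
Implicit Types A B D F : {set C}.

Lemma pick_out A F : #|F| < #|A| -> exists2 x, x \in A & x \notin F.
Proof.
move=> lt; have [x] : exists x, x \in A :\: F.
  apply/card_gt0P; rewrite cardsD; have := subset_leq_card (subsetIr A F).
  by move: lt; clear; lia.
by rewrite in_setD => /andP[xF xA]; exists x.
Qed.

(** Failure would force both sets to consist of [F] and one common element. *)
Lemma pick2 A B F n : #|F| <= n -> n < #|A| -> n < #|B| -> A != B \/ n.+1 < #|A| ->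
  exists x y, [/\ x \in A, y \in B, x \notin F, y \notin F & x != y].
Proof.
move=> Fn nA nB ne; have [x xA xF] := pick_out (leq_ltn_trans Fn nA).
have [y yB yF] := pick_out (leq_ltn_trans Fn nB).
case: (x =P y) => [xy|/eqP xy]; last by exists x, y.
rewrite -{}xy {y} in yB yF.
case: (boolP [exists z in A :\: F, z != x]) => [/exists_inP[z /setDP[zA zF] zx]|/exists_inPn HA].
  by exists z, x.
case: (boolP [exists z in B :\: F, z != x]) => [/exists_inP[z /setDP[zB zF] zx]|/exists_inPn HB].
  by exists x, z; rewrite eq_sym zx.
have sub D : (forall z, z \in D :\: F -> ~~ (z != x)) -> D \subset x |: F.
  move=> H; apply/subsetP=> z zD; rewrite !inE; case zF: (z \in F); rewrite ?orbT //.
  by have := H z; rewrite inE zF zD negbK => ->.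
have cF : #|x |: F| <= n.+1 by rewrite cardsU1 xF.
have eqD D : n < #|D| -> (forall z, z \in D :\: F -> ~~ (z != x)) -> D = x |: F.
  by move=> nD H; apply/eqP; rewrite eqEcard sub //; apply: leq_trans cF nD.
case: ne => [|lt]; first by rewrite (eqD A nA HA) (eqD B nB HB) eqxx.
by have := subset_leq_card (sub A HA); move: cF lt; clear; lia.
Qed.

(** [A] and [B] are the lists at two neighbours of a hub with list [D], and [c] is the colour of its
    third neighbour. If A = B has two elements, the hub takes a colour [c0] outside [A]; otherwise
    any hub colour other than [c] works. *)
Lemma flexible A B D : 1 < #|A| -> 1 < #|B| -> 2 < #|D| ->
  exists c0, forall c, c != c0 -> exists x y z,
    [/\ x \in A, y \in B, z \in D & [/\ z != c, x != y, x != z & y != z]].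
Proof.
move=> cA cB cD.
case: (boolP ((A != B) || (2 < #|A|))) => [/orP H|].
  have [c0 _ _] := @pick_out D set0 (leq_ltn_trans (eq_leq (cards0 _)) (ltnW (ltnW cD))).
  exists c0 => c _; have [|z zD zc] := @pick_out D [set c]; first by rewrite cards1 (ltnW cD).
  have [|x [y [xA yB xz yz xy]]] := @pick2 A B [set z] 1 _ cA cB H; first by rewrite cards1.
  by move: xz yz zc; rewrite !inE => xz yz zc; exists x, y, z.
rewrite negb_or negbK -leqNgt => /andP[/eqP <- cA2].
have [c0 c0D c0A] := pick_out (leq_ltn_trans cA2 cD); exists c0 => c cc0.
have /eqP/cards2P[x [y [xy E]]] : #|A| = 2 by move: cA cA2; clear; lia.
have [xA yA] : x \in A /\ y \in A by rewrite E !inE !eqxx orbT.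
exists x, y, c0; split=> //; split=> //; first by rewrite eq_sym.
  by apply: contraNneq c0A => <-.
by apply: contraNneq c0A => <-.
Qed.

(* If [A :\ x = B :\ y] with [x \in A], [y \in B] and [x != y], then [(x, y)] is the
   only element of [clash A B]. *)
Definition clash A B : {set C * C} :=
  [set p | (A :\: B == [set p.1]) && (B :\: A == [set p.2])].

Lemma card_clash A B : #|clash A B| <= 1.
Proof.
apply/card_le1_eqP=> -[x y] [x' y']; rewrite !inE /= => /andP[/eqP-> /eqP->].
by move=> /andP[/eqP/set1_inj-> /eqP/set1_inj->].
Qed.

(** If the shortened lists agree and [x] lies in [A], then [x] is the only element of [A] outside
    [B] and [y] the only one of [B] outside [A]. If [x] is not in [A], that list is not
    shortened. *)
Lemma no_clash A B x y n : #|A| = n.+1 -> #|B| = n.+1 -> x != y -> (x, y) \notin clash A B ->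
  A :\ x != B :\ y \/ n < #|A :\ x|.
Proof.
move=> cA cB xy; case: (boolP (x \in A)) => [xA|xA]; last first.
  by right; have := cardsD1 x A; rewrite (negbTE xA) cA add0n => <-.
move=> nc; left; apply: contra nc => /eqP E.
have inE' z : (z != x) && (z \in A) = (z != y) && (z \in B) by rewrite -!in_setD1 E.
have yB : y \in B.
  by have := cardsD1 y B; have := cardsD1 x A; rewrite xA cA cB E; case: (y \in B); clear; lia.
have xB : x \notin B by have := inE' x; rewrite eqxx xy /= => <-.
have yA : y \notin A by have := inE' y; rewrite eqxx eq_sym xy /= => ->.
rewrite inE; apply/andP; split; apply/eqP/setP=> z; rewrite !inE; have := inE' z.
  by case: (z =P x) => [->|_] /=; [rewrite xA xB | move=> ->; case: (z \in B); rewrite ?andbF].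
by case: (z =P y) => [->|_] /=; [rewrite yA yB | move=> <-; case: (z \in A); rewrite ?andbF].
Qed.

Lemma avoid_clashes (s : seq ({set C} * {set C})) (P : {set C * C}) : size s < #|P| ->
  exists2 p, p \in P & forall A B, (A, B) \in s -> p \notin clash A B.
Proof.
elim: s P => [|[A B] s IH] P /= lt.
  by have /card_gt0P[p pP] := lt; exists p.
have [|p] := IH (P :\: clash A B).
  rewrite cardsD ltn_subRL; apply: leq_ltn_trans lt; rewrite -add1n leq_add2r.
  exact: leq_trans (subset_leq_card (subsetIr _ _)) (card_clash A B).
rewrite in_setD => /andP[pc pP] H; exists p => // A' B'.
by rewrite inE => /orP[/eqP[-> ->]|/H].
Qed.

Lemma card_offdiag A B : #|A| * #|B| - #|A| <= #|setX A B :\: [set (x, x) | x in A]|.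
Proof.
rewrite cardsD cardsX leq_sub2l //; apply: leq_trans (subset_leq_card (subsetIr _ _)) _.
exact: leq_imset_card.
Qed.
End Representatives.

(** * Extending colourings by explicit lists of colours *)

Section Extensions.
Variables (T : finType) (e : rel T).
Hypotheses (esym : symmetric e) (eirr : irreflexive e).
Variables (k : nat) (C : finType) (L : T -> {set C}).
Hypotheses (k0 : 0 < k) (hL : forall v, #|L v| = k).

Lemma list_fun (s : seq T) (cs : seq C) (c0 : C) : uniq s -> size cs = size s -> uniq cs ->
  exists g : T -> C, [/\ map g s = cs, {in s &, injective g}
    & {in s, forall y, (y, g y) \in zip s cs}].
Proof.
move=> us sz uc; exists (fun y => nth c0 cs (index y s)); split.
- by elim: s cs sz {uc} us => [|y s IH] [|c cs] //= [sz] /andP[ys us];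
    rewrite eqxx /=; congr (_ :: _); rewrite -[RHS](IH cs sz us); apply/eq_in_map=> x xs;
    case: eqP => // yx; rewrite yx xs in ys.
- move=> x y xs ys /eqP; rewrite nth_uniq ?sz ?index_mem // => /eqP E.
  by rewrite -(nth_index x xs) E nth_index.
- move=> y ys; rewrite -[X in (X, _)](nth_index y ys) -nth_zip ?sz //.
  by rewrite mem_nth // size_zip sz minnn index_mem.
Qed.

Definition fits (W : {set T}) f (p : T * C) :=
  p.2 \in L p.1 /\ {in nbr e W p.1, forall w, f w != p.2}.

Lemma proper_list (W : {set T}) (s : seq T) (cs : seq C) f (c0 : C) :
  proper_on e L W f -> uniq s -> size cs = size s -> uniq cs ->
  {in s, forall y, y \notin W} -> {in zip s cs, forall p, fits W f p} ->
  exists f', [/\ proper_on e L (W :|: [set x in s]) f', {in W, f' =1 f} & map f' s = cs].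
Proof.
move=> fP us sz uc sW H; have [g [gcs gi gz]] := list_fun c0 us sz uc.
have [|| f' [f'P f'W f's]] := proper_on_add esym eirr fP sW gi.
- by move=> y /gz/H[].
- by move=> y /gz/H[].
by exists f'; split=> //; rewrite -gcs; apply/eq_in_map.
Qed.

Lemma good_list (W : {set T}) (s : seq T) (cs : seq C) f (c0 : C) :
  good e k L W f -> uniq s -> size s = k -> size cs = k -> uniq cs ->
  {in s, forall y, y \notin W} -> {in zip s cs, forall p, fits W f p} ->
  exists f', [/\ good e k L (W :|: [set x in s]) f', {in W, f' =1 f} & map f' s = cs].
Proof.
move=> fG us ss sc uc sW H; have [g [gcs gi gz]] := list_fun c0 us (etrans sc (Logic.eq_sym ss)) uc.
have [|| f' [f'P f'W f's]] := good_add esym eirr k0 fG us ss sW gi.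
- by move=> y /gz/H[].
- by move=> y /gz/H[].
by exists f'; split=> //; rewrite -gcs; apply/eq_in_map.
Qed.

Lemma good_set1 t c : 1 < k -> c \in L t -> good e k L [set t] (fun=> c).
Proof.
move=> k1 cL; split; last first.
  by apply: balanced_inj; rewrite ?cards1 // => x y /set1P-> /set1P->.
split=> [v /set1P->//|v w /set1P-> /set1P->]; by rewrite eirr.
Qed.
End Extensions.

Section Exceptional.
Variables (T : finType) (e : rel T).
Hypotheses (esym : symmetric e) (eirr : irreflexive e).
Variables (k : nat) (C : finType) (L : T -> {set C}).
Hypotheses (hL : forall v, #|L v| = k).

Definition allowed (s : seq T) f (p : T * C) :=
  p.2 \in L p.1 /\ forall w, w \in s -> e p.1 w -> f w != p.2.

Lemma uniq_cat_notin (s s' : seq T) y : uniq (s ++ s') -> y \in s' -> y \notin s.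
Proof. by rewrite cat_uniq => /and3P[_ /hasPn H _] /H. Qed.

Lemma uniq_catl (s s' : seq T) : uniq (s ++ s') -> uniq s.
Proof. by rewrite cat_uniq => /and3P[]. Qed.

Lemma good_cat (s0 s : seq T) (cs : seq C) f : 0 < k -> good e k L [set x in s0] f ->
  uniq (s0 ++ s) -> size s = k -> size cs = k -> uniq cs ->
  {in zip s cs, forall p, allowed s0 f p} ->
  exists f', [/\ good e k L [set x in s0 ++ s] f', {in s0, f' =1 f} & map f' s = cs].
Proof.
move=> k0 fG us ss sc uc H; have c0 : C by by case: cs sc {uc H} => [sc|//]; move: k0; rewrite -sc.
have [|||f' [f'G f'W f's]] := good_list esym eirr k0 c0 fG _ ss sc uc.
- by move: us; rewrite cat_uniq => /and3P[].
- by move=> y ys; rewrite in_set (uniq_cat_notin us ys).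
- move=> p /H[pL pN]; split=> // w; rewrite in_nbr in_set => /andP[]; exact: pN.
exists f'; split=> //; last by move=> x xs; rewrite f'W ?in_set.
have <- // : [set x in s0] :|: [set x in s] = [set x in s0 ++ s].
by apply/setP=> x; rewrite !inE mem_cat.
Qed.

Lemma card_del1 (A : {set C}) c : #|A| - 1 <= #|A :\ c|.
Proof. by have := cardsD1 c A; case: (c \in A); lia. Qed.

End Exceptional.

(** * Colouring subdivided cubic multigraphs and K_{2,3} for k = 3 *)

Section ExceptionalThree.
Variables (T : finType) (e : rel T).
Hypotheses (esym : symmetric e) (eirr : irreflexive e).
Variables (C : finType) (L : T -> {set C}).
Hypotheses (hL : forall v, #|L v| = 3).

(** Of ten vertices [t] is the remainder, followed by the blocks [b, d, t'], then [a, p, q], then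
    [c, p', q']. The colours of [b] and [d] are chosen first, as they shorten the lists of
    [p, q, p', q']; by [flexible], [a] and [c] then forbid one colour of [t] each, and [t] has
    three. *)
Lemma cubic_colourable W a b c d t t' p q p' q' :
  subdivided_cubic e W a b c d t t' p q p' q' -> colourable e 3 L W.
Proof.
case=> us EW Na Nc [Nt Nt' Npq Npq'].
have inW x : x \in [:: t; b; d; t'; a; p; q; c; p'; q'] -> x \in W by rewrite EW in_set.
have nbE y A w : nbr e W y = A -> w \in W -> e y w -> w \in A by move=> <- wW eyw; rewrite in_nbr wW.
have L2 y z : 1 < #|L y :\ z| by have := card_del1 (L y) z; rewrite hL.
have [beta betaL] : exists x, x \in L b by apply/card_gt0P; rewrite hL.
have [del delL dbn] : exists2 x, x \in L d & x \notin [set beta].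
  by apply: pick_out; rewrite hL cards1.
have [th thL thn] : exists2 x, x \in L t' & x \notin [set beta; del].
  by apply: pick_out; rewrite hL cards2; case: (_ != _).
pose col x := if x == b then beta else del.
have mk x h : (exists2 y, y \in [:: b; d] & nbr e W x = [set h; y]) ->
    exists y, [/\ y \in [:: b; d], nbr e W x = [set h; y] & 1 < #|L x :\ col y|].
  by case=> y yb E; exists y.
have [xp [xpb Np cp]] := mk p a (Npq p (mem_head _ _)).
have [xq [xqb Nq cq]] := mk q a (Npq q (mem_last p [:: q])).
have [xp' [xpb' Np' cp']] := mk p' c (Npq' p' (mem_head _ _)).
have [xq' [xqb' Nq' cq']] := mk q' c (Npq' q' (mem_last p' [:: q'])).
have [|c1 H1] := flexible cp cq (D := L a); first by rewrite hL.
have [|c2 H2] := flexible cp' cq' (D := L c); first by rewrite hL.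
have [gam gamL] : exists2 x, x \in L t & x \notin [set c1; c2].
  by apply: pick_out; rewrite hL cards2; case: (_ != _).
rewrite !inE negb_or => /andP[/H1[rp [rq [ra [rpL rqL raL [rag rpq rpa rqa]]]]]].
move=> /H2[rp' [rq' [rc [rpL' rqL' rcL [rcg rpq' rpc rqc]]]]].
have g0 : good e 3 L [set x in [:: t]] (fun=> gam).
  have -> : [set x in [:: t]] = [set t] by apply/setP=> x; rewrite !inE.
  exact: good_set1.
have us1 : uniq ([:: t] ++ [:: b; d; t']) := uniq_catl (s := [:: t; b; d; t']) (s' := [:: a; p; q; c; p'; q']) us.
have us2 : uniq (([:: t] ++ [:: b; d; t']) ++ [:: a; p; q]) := uniq_catl (s := [:: t; b; d; t'; a; p; q]) (s' := [:: c; p'; q']) us.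
have nA y : y \in [:: a; p; q; c; p'; q'] -> y \notin [:: t; b; d; t'].
  exact: (@uniq_cat_notin _ [:: t; b; d; t'] [:: a; p; q; c; p'; q'] y us).
have nC y : y \in [:: c; p'; q'] -> y \notin [:: t; b; d; t'; a; p; q].
  exact: (@uniq_cat_notin _ [:: t; b; d; t'; a; p; q] [:: c; p'; q'] y us).
have [aA cA] : a \notin [:: t; b; d; t'] /\ c \notin [:: t; b; d; t'].
  by split; apply: nA; rewrite !inE eqxx ?orbT.
have [pA qA] : p \notin [:: t; b; d; t'] /\ q \notin [:: t; b; d; t'].
  by split; apply: nA; rewrite !inE eqxx ?orbT.
have cC : c \notin [:: t; b; d; t'; a; p; q] by apply: nC; rewrite !inE eqxx.
have [pC qC] : p' \notin [:: t; b; d; t'; a; p; q] /\ q' \notin [:: t; b; d; t'; a; p; q].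
  by split; apply: nC; rewrite !inE eqxx ?orbT.
have colE f x : x \in [:: b; d] -> f b = beta -> f d = del -> f x = col x.
  move=> xbd fb fd; rewrite /col; case: eqP => [->//|/eqP xb].
  by move: xbd; rewrite !inE (negbTE xb) => /eqP->.
have only (s0 : seq T) y h x w : nbr e W y = [set h; x] -> h \notin s0 -> {subset s0 <= W} ->
    w \in s0 -> e y w -> w = x.
  move=> Ny hs sW ws eyw; have := nbE y _ w Ny (sW w ws) eyw.
  by case/set2P=> // wh; rewrite -wh ws in hs.
have sub1 : {subset [:: t; b; d; t'] <= W}.
  by move=> x xs; apply: inW; move: xs; rewrite !inE => /or4P[]->; rewrite ?orbT.
have sub2 : {subset [:: t; b; d; t'; a; p; q] <= W}.
  move=> x xs; apply: inW; rewrite -[X in _ \in X]/([:: t; b; d; t'; a; p; q] ++ [:: c; p'; q']).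
  by rewrite mem_cat xs.
have [||f1 [f1G f10 [fb fd ft']]] :=
    good_cat esym eirr (isT : 0 < 3) g0 us1 (erefl _) (erefl _) (cs := [:: beta; del; th]).
- move: dbn thn; rewrite /= !inE !negb_or (eq_sym beta del) (eq_sym beta th) (eq_sym del th).
  by move=> -> /andP[-> ->].
- have noN y w : y \in [:: t; b; d; t'] -> w \in [:: t] -> e y w -> False.
    rewrite (mem_seq1 w) => ys /eqP-> eyt; have ety : e t y by rewrite esym.
    by have /set2P[] := nbE t _ y Nt (sub1 y ys) ety => E; [move: aA|move: cA]; rewrite -E ys.
  move=> z; rewrite !inE => /or3P[]/eqP->; split=> //= w wt ew;
    by case: (noN _ _ _ wt ew); rewrite !inE eqxx ?orbT.
have f1t : f1 t = gam by rewrite f10 ?mem_head.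
have [||f2 [f2G f20 [f2a f2p f2q]]] :=
    good_cat esym eirr (isT : 0 < 3) f1G us2 (erefl _) (erefl _) (cs := [:: ra; rp; rq]).
- by rewrite /= !inE !negb_or (eq_sym ra) rpa (eq_sym ra) rqa rpq.
- move: rpL rqL; rewrite !in_setD1 => /andP[rpc1 rpL] /andP[rqc1 rqL].
  move=> z; rewrite !inE => /or3P[]/eqP->; split=> //= w ws ew.
  + have := nbE a _ w Na (sub1 w ws) ew; rewrite !inE => /orP[/orP[]|] /eqP wE.
    * by rewrite wE f1t eq_sym.
    * by rewrite -wE ws in pA.
    * by rewrite -wE ws in qA.
  + by rewrite (only _ _ _ _ _ Np aA sub1 ws ew) (colE f1) // eq_sym.
  + by rewrite (only _ _ _ _ _ Nq aA sub1 ws ew) (colE f1) // eq_sym.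
have fE x : x \in [:: t; b; d; t'] -> f2 x = f1 x by apply: f20.
have [||f3 [f3G f30 _]] :=
    good_cat esym eirr (isT : 0 < 3) f2G (us : uniq ((([:: t] ++ [:: b; d; t']) ++ [:: a; p; q]) ++ [:: c; p'; q'])) (erefl _) (erefl _) (cs := [:: rc; rp'; rq']).
- by rewrite /= !inE !negb_or (eq_sym rc) rpc (eq_sym rc) rqc rpq'.
- move: rpL' rqL'; rewrite !in_setD1 => /andP[rpc1 rpL'] /andP[rqc1 rqL'].
  have f2b : f2 b = beta by rewrite fE // !inE eqxx orbT.
  have f2d : f2 d = del by rewrite fE // !inE eqxx !orbT.
  move=> z; rewrite !inE => /or3P[]/eqP->; split=> //= w ws ew.
  + have := nbE c _ w Nc (sub2 w ws) ew; rewrite !inE => /orP[/orP[]|] /eqP wE.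
    * by rewrite wE fE ?mem_head // f1t eq_sym.
    * by rewrite -wE ws in pC.
    * by rewrite -wE ws in qC.
  + by rewrite (only _ _ _ _ _ Np' cC sub2 ws ew) (colE f2) // eq_sym.
  + by rewrite (only _ _ _ _ _ Nq' cC sub2 ws ew) (colE f2) // eq_sym.
by exists f3; rewrite EW.
Qed.

(** Five is not a multiple of three, so [b, t3] are added first with the balance checked by hand,
    and [a, t1, t2] form an ordinary block. *)
Lemma k23_colourable (W : {set T}) a b t1 t2 t3 : k23 e W a b t1 t2 t3 -> #|W| = 5 \/ #|W| = 10 ->
  colourable e 3 L (W :\: [set x in [:: a; b; t1; t2; t3]]) -> colourable e 3 L W.
Proof.
case=> us sW Na Nb Nt cW; set K := [:: a; b; t1; t2; t3]; set W0 := W :\: _ => -[f0 [f0P [f0le f0cnt]]].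
have cW0 : #|W0| = 0 \/ #|W0| = 5.
  have : #|W| = #|W0| + 5.
    rewrite -(cardsID [set x in K] W) addnC; congr (_ + _).
    have -> : W :&: [set x in K] = [set x in K].
      by apply/setIidPr/subsetP=> x; rewrite in_set; apply: sW.
    by rewrite cardsE (card_uniqP us).
  by move: cW; clear; lia.
have nbE y A w : nbr e W y = A -> w \in W -> e y w -> w \in A by move=> <- wW eyw; rewrite in_nbr wW.
have L2 y z : 1 < #|L y :\ z| by have := card_del1 (L y) z; rewrite hL.
pose F := [set c | #|cls W0 f0 c| == (#|W0| %/ 3).+1].
(* At most two classes have top size, since their number is bounded by a remainder modulo 3. *)
have [beta betaL betaF] : exists2 x, x \in L b & x \notin F.
  by apply: pick_out; rewrite hL; apply: leq_ltn_trans f0cnt _; rewrite ltn_mod.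
have [|c0 H] := flexible (L2 t1 beta) (L2 t2 beta) (D := L a); first by rewrite hL.
have [gam gamL] : exists2 x, x \in L t3 & x \notin [set beta; c0].
  by apply: pick_out; rewrite hL cards2; case: (_ != _).
rewrite !inE negb_or => /andP[gb /H[r1 [r2 [ra [r1L r2L raL [rag r12 r1a r2a]]]]]].
have outK x : x \in W0 -> x \notin K by rewrite in_setD in_set => /andP[].
have subW0 x : x \in W0 -> x \in W by rewrite in_setD => /andP[].
have [t1K t2K t3K] : [/\ t1 \in K, t2 \in K & t3 \in K] by rewrite !inE !eqxx !orbT.
have [aK bK] : a \in K /\ b \in K by rewrite !inE !eqxx !orbT.
have [Nt1 Nt2 Nt3] : [/\ nbr e W t1 = [set a; b], nbr e W t2 = [set a; b] & nbr e W t3 = [set a; b]].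
  by split; apply: Nt; rewrite !inE eqxx ?orbT.
have bt3 : uniq [:: b; t3].
  by move: us; rewrite /= !inE !negb_or => /and5P[_ /and3P[_ _ ->]].
have [|||f1 [f1P f10 [f1b f1t3]]] := @proper_list _ e esym eirr _ L W0 [:: b; t3] [:: beta; gam] f0 beta f0P bt3 (erefl _).
- by rewrite /= inE eq_sym gb.
- by move=> y; rewrite !inE => /orP[]/eqP->; rewrite ?eqxx ?orbT.
- move=> z; rewrite !inE => /orP[]/eqP->; split=> //= w; rewrite in_nbr => /andP[wW0 ew];
    have := outK w wW0; have wW := subW0 w wW0.
    by have := nbE b _ w Nb wW ew; rewrite !inE => /orP[/orP[]|] ->; rewrite ?orbT.
  by have := nbE t3 _ w Nt3 wW ew; rewrite !inE => /orP[] ->; rewrite ?orbT.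
set W1 := W0 :|: _ in f1P; have cW1 : #|W1| = #|W0| + 2.
  rewrite cardsU; have -> : W0 :&: [set x in [:: b; t3]] = set0.
    apply/setP=> x; rewrite in_setI [in RHS]inE in_set; apply/andP=> -[/outK xK].
    by rewrite !inE => /orP[]/eqP xE; rewrite xE ?bK ?t3K in xK.
  have c2 : #|[set x in [:: b; t3]]| = 2 by rewrite cardsE (card_uniqP bt3).
  by rewrite cards0 c2 subn0.
have cls1 c : #|cls W1 f1 c| <= #|cls W0 f0 c| + ((beta == c) + (gam == c)).
  have sub : cls W1 f1 c \subset cls W0 f0 c :|: ((if beta == c then [set b] else set0) :|: (if gam == c then [set t3] else set0)).
    apply/subsetP=> x; rewrite [x \in cls W1 _ _]inE in_setU in_set => /andP[/orP[xW0|]].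
      by rewrite f10 // => fx; rewrite in_setU inE xW0 fx.
    by rewrite !inE => /orP[]/eqP->; rewrite ?f1b ?f1t3 => ->; rewrite !inE eqxx ?orbT.
  apply: leq_trans (subset_leq_card sub) _; apply: leq_trans (leq_of_leqif (leq_card_setU _ _)) _.
  rewrite leq_add2l; apply: leq_trans (leq_of_leqif (leq_card_setU _ _)) _.
  by apply: leq_add; case: ifP; rewrite ?cards1 ?cards0.
(* The size goes from 0 to 2 or from 5 to 7. In the second case the class of [beta] was not of top
   size, so only that of [gam] can reach 3, and 7 mod 3 = 1 such class is allowed. *)
have f1B : balanced 3 W1 f1.
  have betaF' : #|cls W0 f0 beta| != (#|W0| %/ 3).+1 by move: betaF; rewrite inE.
  rewrite /balanced cW1; case: cW0 => cW0; rewrite cW0 /= in f0le f0cnt betaF' *.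
    have none c : #|cls W0 f0 c| = 0.
      by apply/eqP; rewrite -leqn0 -cW0 subset_leq_card //; apply/subsetP=> x; rewrite inE => /andP[].
    have cls2 c : #|cls W1 f1 c| <= (beta == c) + (gam == c) by rewrite -[leqRHS]add0n -(none c).
    split=> [c|].
      have := cls2 c; case: (beta =P c) => [<-|_]; first by rewrite (negbTE gb); clear; lia.
      by case: (gam == c); clear; lia.
    apply: leq_trans (_ : #|[set beta; gam]| <= 2); last by rewrite cards2; case: (_ != _).
    apply: subset_leq_card; apply/subsetP=> c; rewrite !inE => /eqP E.
    by have := cls2 c; rewrite E !(eq_sym c); case: eqP => //; case: eqP.
  split=> [c|].
    have := cls1 c; have := f0le c; case: (beta =P c) => [<-|_].
      by rewrite (negbTE gb) /= => h1 h2; move: h1 h2 betaF'; clear; lia.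
    by case: (gam == c); clear; lia.
  apply: leq_trans (_ : #|[set gam]| <= 1); last by rewrite cards1.
  apply: subset_leq_card; apply/subsetP=> c; rewrite !inE => /eqP E.
  have := cls1 c; have := f0le c; rewrite E (eq_sym c).
  case: (beta =P c) => [<-|_].
    by rewrite (negbTE gb); move: betaF'; clear; lia.
  by case: (gam == c) => //; clear; lia.
have out1 x : x \in [:: a; t1; t2] -> x \notin W1.
  move=> xs; have xK : x \in K.
    by move: xs; rewrite !inE => /or3P[]->; rewrite ?orbT.
  rewrite in_setU in_setD in_set xK /= in_set.
  have := us; rewrite (_ : uniq K = uniq ([:: b; t3] ++ [:: a; t1; t2])).
    by move/uniq_cat_notin; apply.
  by apply: perm_uniq; perm_lia.
have [a1 [t11 t21]] : a \notin W1 /\ t1 \notin W1 /\ t2 \notin W1.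
  by split; [|split]; apply: out1; rewrite !inE eqxx ?orbT.
have W1W x : x \in W1 -> x \in W.
  rewrite in_setU => /orP[/subW0//|]; rewrite in_set !inE => /orP[]/eqP->; exact: sW.
have usA : uniq [:: a; t1; t2].
  move: us; rewrite /= !inE !negb_or => /and5P[/and4P[_ -> -> _] _ /andP[-> _] _ _] //.
have f1G : good e 3 L W1 f1 by [].
move: r1L r2L; rewrite !in_setD1 => /andP[r1b r1L] /andP[r2b r2L].
have [|||f [fG _ _]] := @good_list _ e esym eirr 3 _ L isT W1 [:: a; t1; t2] [:: ra; r1; r2] f1 beta f1G usA (erefl _) (erefl _).
- by rewrite /= !inE negb_or (eq_sym ra) r1a (eq_sym ra) r2a r12.
- exact: out1.
- move=> z; rewrite !inE => /or3P[]/eqP->; split=> //= w; rewrite in_nbr => /andP[wW1 ew];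
    have wW := W1W w wW1.
  + have := nbE a _ w Na wW ew; rewrite !inE => /orP[/orP[]|]/eqP wE.
    * by rewrite -wE wW1 in t11.
    * by rewrite -wE wW1 in t21.
    * by rewrite wE f1t3 eq_sym.
  + have := nbE t1 _ w Nt1 wW ew; rewrite !inE => /orP[]/eqP wE; first by rewrite -wE wW1 in a1.
    by rewrite wE f1b eq_sym.
  + have := nbE t2 _ w Nt2 wW ew; rewrite !inE => /orP[]/eqP wE; first by rewrite -wE wW1 in a1.
    by rewrite wE f1b eq_sym.
exists f; suff <- : W1 :|: [set x in [:: a; t1; t2]] = W by [].
apply/setP=> x; rewrite in_setU in_set; apply/orP/idP => [[/W1W//|]|xW].
  by move=> xs; apply: sW; move: xs; rewrite !inE => /or3P[]->; rewrite ?orbT.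
case: (boolP (x \in K)) => xK; last by left; rewrite in_setU in_setD in_set xK xW.
have : (x \in [:: b; t3]) || (x \in [:: a; t1; t2]).
  by move: xK; rewrite !inE => /orP[->|/or4P[]->]; rewrite ?orbT.
by case/orP=> xs; [left; rewrite in_setU in_set xs orbT | right].
Qed.

End ExceptionalThree.

(** * Theta graphs: their threads and their colouring *)

Section ThetaThreads.
Variables (T : finType) (e : rel T) (W : {set T}).
Hypotheses (esym : symmetric e) (eirr : irreflexive e).

Definition thread h1 h2 (p : T * T) :=
  nbr e W p.1 = [set h1; p.2] /\ nbr e W p.2 = [set p.1; h2].

Lemma theta_threads n h1 h2 : 2 < n -> theta e W n h1 h2 ->
  exists us vs, [/\ size us = n, size vs = n, uniq ([:: h1; h2] ++ us ++ vs),
    W = [set x in [:: h1; h2] ++ us ++ vs] & {in zip us vs, forall p, thread h1 h2 p}].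
Proof.
move=> n2 [[h1W h2W h12 c1 c2] EW T1 T2]; pose us := enum (nbr e W h1).
(* The partner of [u] on its thread; the default is not reached for neighbours of [h1]. *)
pose pi u := odflt u [pick v in nbr e W h2 | (nbr e W u == [set h1; v]) && (nbr e W v == [set u; h2])].
have piP u : u \in nbr e W h1 -> pi u \in nbr e W h2 /\ thread h1 h2 (u, pi u).
  move=> /T1[v [vN Nu Nv]]; rewrite /pi; case: pickP => [x /and3P[xN /eqP ? /eqP ?]|/(_ v)] //=.
  by rewrite vN Nu Nv !eqxx.
(* A hub adjacent to the other one would be an inner vertex of a thread and have degree at most
   2. *)
have h2N1 : h2 \notin nbr e W h1.
  by apply/negP=> /T1[v [_ E _]]; move: n2; rewrite -c2 E cards2; case: (_ != _).
have h1N2 : h1 \notin nbr e W h2.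
  by apply/negP=> /T2[v [_ E _]]; move: n2; rewrite -c1 E cards2; case: (_ != _).
have h1N1 : h1 \notin nbr e W h1 by rewrite in_nbr eirr andbF.
have h2N2 : h2 \notin nbr e W h2 by rewrite in_nbr eirr andbF.
have inj_pi : {in nbr e W h1 &, injective pi}.
  move=> u u' uN u'N E; have [_ [_ Nv]] := piP u uN; have [_ [_ Nv']] := piP u' u'N.
  have : u \in [set u'; h2] by rewrite -Nv' /= -E Nv /= !inE eqxx.
  by case/set2P=> // uh2; rewrite -uh2 uN in h2N1.
have vsP x : (x \in map pi us) = (x \in nbr e W h2).
  have sub : pi @: nbr e W h1 \subset nbr e W h2.
    by apply/subsetP=> y /imsetP[u uN ->]; case: (piP u uN).
  have /eqP <- : pi @: nbr e W h1 == nbr e W h2.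
    by rewrite eqEcard sub card_in_imset // c1 c2 leqnn.
  apply/mapP/imsetP => -[u uN ->]; exists u => //; first by rewrite mem_enum in uN.
  by rewrite mem_enum.
exists us, (map pi us); split.
- by rewrite -cardE.
- by rewrite size_map -cardE.
- rewrite cat_uniq; apply/and3P; split.
  + by rewrite /= inE h12.
  + apply/hasPn=> x; rewrite mem_cat mem_enum vsP !inE -!in_nbr => xN.
    apply/negP=> /orP[]/eqP xE; rewrite xE in xN.
      by rewrite (negbTE h1N1) (negbTE h1N2) in xN.
    by rewrite (negbTE h2N1) (negbTE h2N2) in xN.
  + rewrite cat_uniq enum_uniq map_inj_in_uniq ?enum_uniq ?andbT /=; last first.
      by move=> x y; rewrite !mem_enum; apply: inj_pi.
    apply/hasPn=> x; rewrite vsP mem_enum => xN2; apply/negP=> xN1.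
    have [v [vN Nx _]] := T1 x xN1.
    have : h2 \in nbr e W x by rewrite in_nbr h2W esym (nbrE xN2).
    by rewrite Nx => /set2P[hE|vE]; [rewrite hE eqxx in h12 | rewrite -vE (negbTE h2N2) in vN].
- by rewrite {1}EW; apply/setP=> x; rewrite in_set !in_setU !mem_cat vsP mem_enum !inE orbA.
- move=> p0 /(nthP (h1, h1))[i]; rewrite size_zip size_map minnn => lt.
  rewrite nth_zip ?size_map // (nth_map h1) // => <-.
  have : nth h1 us i \in us by rewrite mem_nth.
  by rewrite mem_enum => /piP[].
Qed.
End ThetaThreads.

Section ThetaColour.
Variables (T : finType) (e : rel T) (W : {set T}).
Hypotheses (esym : symmetric e) (eirr : irreflexive e).
Variables (C : finType) (L : T -> {set C}).

(* The colours of the hubs are chosen so that no thread is forced to use the same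
   [k - 1] colours on both of its vertices. *)
Lemma theta_hubs k (h1 h2 : T) (s : seq (T * T)) : (forall v, #|L v| = k) -> 2 < k ->
  size s <= 2 * k - 2 ->
  exists al be, [/\ al \in L h1, be \in L h2, al != be &
    {in s, forall p, L p.1 :\ al != L p.2 :\ be \/ k.-1 < #|L p.1 :\ al|}].
Proof.
move=> hL k2 ss; pose P := setX (L h1) (L h2) :\: [set (x, x) | x in L h1].
have [|[al be]] := @avoid_clashes C [seq (L p.1, L p.2) | p <- s] P.
  (* At least k(k - 1) pairs of distinct colours against at most 2k - 2 clashes, with k > 2. *)
  rewrite size_map; apply: leq_trans (card_offdiag _ _); rewrite !hL.
  apply: leq_ltn_trans ss _; move: k2; clear; nia.
rewrite in_setD in_setX /= => /andP[nd /andP[alL beL]] H; exists al, be.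
have ab : al != be by apply: contraNneq nd => <-; apply: imset_f.
split=> // p ps; apply: (no_clash (n := k.-1)) => //; rewrite ?hL ?prednK //.
- by move: k2; clear; lia.
- by move: k2; clear; lia.
by apply: H; apply/mapP; exists p.
Qed.

(** [v4] is the remainder 10 mod 3, followed by the blocks [h1, h2, u4], then [u1, v1, u2], then
    [v2, u3, v3]. Threads 1 and 3 lie inside a block beside one further colour, where the choice of
    the hub colours is needed; threads 2 and 4 are split. *)
Lemma theta3_colourable h1 h2 : (forall v, #|L v| = 3) -> theta e W 4 h1 h2 ->
  colourable e 3 L W.
Proof.
move=> hL th; have [us [vs [su sv uW EW thr]]] := theta_threads esym eirr (isT : 2 < 4) th.
have ss : size (zip us vs) <= 2 * 3 - 2 by rewrite size_zip su sv.
have [al [be [alL beL ab free]]] := theta_hubs h1 h2 hL isT ss.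
case: us su uW EW thr free ss => [|u1 [|u2 [|u3 [|u4 [|]]]]] //= _.
case: vs sv => [|v1 [|v2 [|v3 [|v4 [|]]]]] //= _ uW EW thr free _.
have [th1 th2 th3 th4] : [/\ thread e W h1 h2 (u1, v1), thread e W h1 h2 (u2, v2),
    thread e W h1 h2 (u3, v3) & thread e W h1 h2 (u4, v4)].
  by split; apply: thr; rewrite !inE eqxx ?orbT.
have fr1 := free (u1, v1) (mem_head _ _).
have fr3 : L u3 :\ al != L v3 :\ be \/ 2 < #|L u3 :\ al|.
  by apply: (free (u3, v3)); rewrite !inE eqxx ?orbT.
have L2 y z : 1 < #|L y :\ z| by have := card_del1 (L y) z; rewrite hL.
have [x4 x4L x4b] : exists2 x, x \in L u4 :\ al & x \notin [set be].
  by apply: pick_out; rewrite cards1.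
have [y4 y4L y4x] : exists2 x, x \in L v4 :\ be & x \notin [set x4].
  by apply: pick_out; rewrite cards1.
have [c2 c2L _] : exists2 x, x \in L u2 :\ al & x \notin (set0 : {set C}).
  by apply: pick_out; rewrite cards0 ltnW.
have [|c1 [d1 [c1L d1L c1c d1c c1d1]]] := pick2 (F := [set c2]) (n := 1) _ (L2 u1 al) (L2 v1 be) fr1.
  by rewrite cards1.
have [d2 d2L d2c] : exists2 x, x \in L v2 :\ be & x \notin [set c2].
  by apply: pick_out; rewrite cards1.
have [|c3 [d3 [c3L d3L c3d d3d c3d3]]] := pick2 (F := [set d2]) (n := 1) _ (L2 u3 al) (L2 v3 be) fr3.
  by rewrite cards1.
pose s10 := [:: v4; h1; h2; u4; u1; v1; u2; v2; u3; v3].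
have us10 : uniq s10.
  have <- : uniq [:: h1, h2, u1, u2, u3, u4, v1, v2, v3, v4 & [::]] = uniq s10.
    by apply: perm_uniq; perm_lia.
  exact: uW.
have EW' : W = [set x in s10].
  by rewrite EW; apply/setP=> x; rewrite !in_set; apply: perm_mem; perm_lia.
have nbE y A w : nbr e W y = A -> w \in s10 -> e y w -> w \in A.
  by move=> <- ws eyw; rewrite in_nbr eyw EW' in_set ws.
move: x4L y4L c1L d1L c2L d2L c3L d3L; rewrite !in_setD1.
move=> /andP[x4a x4L] /andP[y4b y4L] /andP[c1a c1L] /andP[d1b d1L] /andP[c2a c2L] /andP[d2b d2L].
move=> /andP[c3a c3L] /andP[d3b d3L].
move: x4b y4x c1c d1c d2c c3d d3d; rewrite !inE => x4b y4x c1c d1c d2c c3d d3d.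
have g0 : good e 3 L [set x in [:: v4]] (fun=> y4).
  have -> : [set x in [:: v4]] = [set v4] by apply/setP=> x; rewrite !inE.
  exact: good_set1.
have pre (s s' : seq T) : s ++ s' = s10 -> uniq s by move=> E; apply: (@uniq_catl _ s s'); rewrite E.
have sub (s s' : seq T) w : s ++ s' = s10 -> w \in s -> w \in s10 by move=> <-; rewrite mem_cat => ->.
have notin (s s' : seq T) y : s ++ s' = s10 -> y \in s' -> y \notin s.
  by move=> E; apply: uniq_cat_notin; rewrite E.
have hubL (s : seq T) u v w : thread e W h1 h2 (u, v) -> {subset s <= s10} -> v \notin s -> w \in s -> e u w -> w = h1.
  move=> [/= Nu _] sb vs ws euw; have /set2P[//|wv] := nbE u _ w Nu (sb w ws) euw.
  by rewrite -wv ws in vs.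
have hubR (s : seq T) u v w : thread e W h1 h2 (u, v) -> {subset s <= s10} -> u \notin s -> w \in s -> e v w -> w = h2.
  move=> [_ /= Nv] sb us ws evw; have /set2P[wu|//] := nbE v _ w Nv (sb w ws) evw.
  by rewrite -wu ws in us.
have E1 : [:: v4] ++ [:: h1; h2; u4; u1; v1; u2; v2; u3; v3] = s10 by [].
have E2 : [:: v4; h1; h2; u4] ++ [:: u1; v1; u2; v2; u3; v3] = s10 by [].
have E3 : [:: v4; h1; h2; u4; u1; v1; u2] ++ [:: v2; u3; v3] = s10 by [].
have h1v4 : e h1 v4 -> False.
  move=> eh; have [_ /= Nv] := th4; have : h1 \in nbr e W v4 by rewrite in_nbr esym eh EW' !inE eqxx ?orbT.
  by rewrite Nv => /set2P[] hE; move: us10; rewrite /s10 hE /= !inE !eqxx ?orbT /= ?andbF.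
have [||f1 [f1G f10 [f1h1 f1h2 f1u4]]] := good_cat esym eirr (isT : 0 < 3) g0
    (pre _ _ E2 : uniq ([:: v4] ++ [:: h1; h2; u4])) (erefl _) (erefl _) (cs := [:: al; be; x4]).
- by rewrite /= !inE negb_or ab (eq_sym al) x4a eq_sym x4b.
- move=> z; rewrite !inE => /or3P[]/eqP->; split=> //= w; rewrite inE => /eqP-> // eh;
    by case: (h1v4 eh).
have in2 w : w \in [:: v4; h1; h2; u4] -> w \in s10 := sub _ _ w E2.
have in3 w : w \in [:: v4; h1; h2; u4; u1; v1; u2] -> w \in s10 := sub _ _ w E3.
have [n2u1 n2v1 n2v2] : [/\ u1 \notin [:: v4; h1; h2; u4], v1 \notin [:: v4; h1; h2; u4]
    & v2 \notin [:: v4; h1; h2; u4]].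
  by split; apply: notin E2 _; rewrite !inE eqxx ?orbT.
have [n3u3 n3v3] : u3 \notin [:: v4; h1; h2; u4; u1; v1; u2] /\
    v3 \notin [:: v4; h1; h2; u4; u1; v1; u2].
  by split; apply: notin E3 _; rewrite !inE eqxx ?orbT.
have [||f2 [f2G f20 [f2u1 f2v1 f2u2]]] := good_cat esym eirr (isT : 0 < 3) f1G
    (pre _ _ E3 : uniq ([:: v4; h1; h2; u4] ++ [:: u1; v1; u2])) (erefl _) (erefl _) (cs := [:: c1; d1; c2]).
- by rewrite /= !inE negb_or c1d1 c1c d1c.
- move=> z; rewrite !inE => /or3P[]/eqP->; split=> //= w ws ew.
  + by rewrite (hubL _ _ _ _ th1 in2 n2v1 ws ew) f1h1 eq_sym.
  + by rewrite (hubR _ _ _ _ th1 in2 n2u1 ws ew) f1h2 eq_sym.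
  + by rewrite (hubL _ _ _ _ th2 in2 n2v2 ws ew) f1h1 eq_sym.
have f2h1 : f2 h1 = al by rewrite f20 // !inE eqxx ?orbT.
have f2h2 : f2 h2 = be by rewrite f20 // !inE eqxx ?orbT.
have [||f3 [f3G _ _]] := good_cat esym eirr (isT : 0 < 3) f2G
    (us10 : uniq ([:: v4; h1; h2; u4; u1; v1; u2] ++ [:: v2; u3; v3])) (erefl _) (erefl _) (cs := [:: d2; c3; d3]).
- by rewrite /= !inE negb_or (eq_sym d2) c3d (eq_sym d2) d3d c3d3.
- move=> z; rewrite !inE => /or3P[]/eqP->; split=> //= w ws ew.
  + have [_ /= Nv] := th2; have := nbE v2 _ w Nv (in3 w ws) ew => /set2P[]->.
      by rewrite f2u2 eq_sym.
    by rewrite f2h2 eq_sym.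
  + by rewrite (hubL _ _ _ _ th3 in3 n3v3 ws ew) f2h1 eq_sym.
  + by rewrite (hubR _ _ _ _ th3 in3 n3u3 ws ew) f2h2 eq_sym.
by exists f3; rewrite EW'.
Qed.

(** The hubs are the remainder 14 mod 4, and two threads make a block. Within a block one thread is
    coloured freely, and the other avoids its two colours with lists of size at least 3. *)
Lemma theta4_colourable h1 h2 : (forall v, #|L v| = 4) -> theta e W 6 h1 h2 ->
  colourable e 4 L W.
Proof.
move=> hL th; have [us [vs [su sv uW EW thr]]] := theta_threads esym eirr (isT : 2 < 6) th.
have ss : size (zip us vs) <= 2 * 4 - 2 by rewrite size_zip su sv.
have [al [be [alL beL ab free]]] := theta_hubs h1 h2 hL isT ss.
have L3 y z : 2 < #|L y :\ z| by have := card_del1 (L y) z; rewrite hL.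
have h12 : uniq [:: h1; h2] := uniq_catl (s' := us ++ vs) uW.
have step s0 f u1 v1 u2 v2 : good e 4 L [set x in s0] f -> f h1 = al -> f h2 = be ->
    h1 \in s0 -> h2 \in s0 -> {subset s0 <= W} -> uniq (s0 ++ [:: u1; v1; u2; v2]) ->
    (u1, v1) \in zip us vs -> (u2, v2) \in zip us vs ->
    exists f', [/\ good e 4 L [set x in s0 ++ [:: u1; v1; u2; v2]] f', f' h1 = al & f' h2 = be].
  move=> fG fh1 fh2 h1s h2s sW us0 z1 z2; have [[/= Nu1 Nv1] [/= Nu2 Nv2]] := (thr _ z1, thr _ z2).
  have [c2 c2L _] : exists2 x, x \in L u2 :\ al & x \notin (set0 : {set C}).
    by apply: pick_out; rewrite cards0 (ltn_trans _ (L3 _ _)).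
  have [d2 d2L d2c] : exists2 x, x \in L v2 :\ be & x \notin [set c2].
    by apply: pick_out; rewrite cards1 (ltn_trans _ (L3 _ _)).
  have [|c1 [d1 [c1L d1L c1c d1c c1d1]]] :=
    pick2 (F := [set c2; d2]) (n := 2) _ (L3 u1 al) (L3 v1 be) (free _ z1).
    by rewrite cards2; case: (_ != _).
  have out y : y \in [:: u1; v1; u2; v2] -> y \notin s0 by apply: uniq_cat_notin us0.
  have [nu1 nv1] : u1 \notin s0 /\ v1 \notin s0 by split; apply: out; rewrite !inE eqxx ?orbT.
  have [nu2 nv2] : u2 \notin s0 /\ v2 \notin s0 by split; apply: out; rewrite !inE eqxx ?orbT.
  have only y h x w : (nbr e W y = [set h; x] \/ nbr e W y = [set x; h]) -> x \notin s0 ->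
      w \in s0 -> e y w -> w = h.
    move=> Ny xs ws eyw; have : w \in nbr e W y by rewrite in_nbr sW.
    by case: Ny => -> /set2P[] // wx; rewrite -wx ws in xs.
  move: c1L d1L c2L d2L; rewrite !in_setD1.
  move=> /andP[c1a c1L] /andP[d1b d1L] /andP[c2a c2L] /andP[d2b d2L].
  move: c1c d1c d2c; rewrite !inE !negb_or => /andP[c1c c1d] /andP[d1c d1d] d2c.
  have [||f' [f'G f'0 _]] := good_cat esym eirr (isT : 0 < 4) fG us0 (erefl _) (erefl _) (cs := [:: c1; d1; c2; d2]).
  - by rewrite /= !inE !negb_or c1d1 c1c c1d d1c d1d (eq_sym c2) d2c.
  - move=> z; rewrite !inE => /or4P[]/eqP->; split=> //= w ws ew.
    + by rewrite (only _ _ _ _ (or_introl Nu1) nv1 ws ew) fh1 eq_sym.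
    + by rewrite (only _ _ _ _ (or_intror Nv1) nu1 ws ew) fh2 eq_sym.
    + by rewrite (only _ _ _ _ (or_introl Nu2) nv2 ws ew) fh1 eq_sym.
    + by rewrite (only _ _ _ _ (or_intror Nv2) nu2 ws ew) fh2 eq_sym.
  by exists f'; rewrite !f'0.
have [[h1W h2W n12 _ cN2] _ T1 _] := th.
have h12N : e h1 h2 = false.
  apply/negP=> eh; have /T1[v [_ E _]] : h2 \in nbr e W h1 by rewrite in_nbr h2W.
  by move: cN2; rewrite E cards2; case: (_ != _).
have WE x : x \in [:: h1; h2] ++ us ++ vs -> x \in W by move=> xs; rewrite EW in_set.
pose f0 x := if x == h1 then al else be.
have f0h1 : f0 h1 = al by rewrite /f0 eqxx.
have f0h2 : f0 h2 = be by rewrite /f0 eq_sym (negbTE n12).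
have g0 : good e 4 L [set x in [:: h1; h2]] f0.
  split.
    split=> [v|v w]; rewrite !in_set !inE => /orP[]/eqP->; rewrite ?f0h1 ?f0h2 //.
      by move=> /orP[]/eqP->; rewrite ?f0h1 ?f0h2 ?eirr.
    by move=> /orP[]/eqP->; rewrite ?f0h1 ?f0h2 ?eirr // eq_sym.
  apply: balanced_inj; first by rewrite cardsE (card_uniqP h12).
  move=> v w; rewrite !in_set !inE => /orP[]/eqP-> /orP[]/eqP-> //; rewrite ?f0h1 ?f0h2 => E;
    by rewrite E eqxx in ab.
case: us su uW EW thr free ss step WE => [|u1 [|u2 [|u3 [|u4 [|u5 [|u6 [|]]]]]]] //= _.
case: vs sv => [|v1 [|v2 [|v3 [|v4 [|v5 [|v6 [|]]]]]]] //= _ uW EW _ _ _ step WE.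
pose s14 := [:: h1; h2; u1; v1; u2; v2; u3; v3; u4; v4; u5; v5; u6; v6].
have perm : perm_eq [:: h1, h2, u1, u2, u3, u4, u5, u6, v1, v2, v3, v4, v5, v6 & [::]] s14.
  by perm_lia.
have us14 : uniq s14 by rewrite -(perm_uniq perm).
have EW' : W = [set x in s14].
  by rewrite EW; apply/setP=> x; rewrite !in_set; apply: perm_mem.
have sub (s s' : seq T) : s ++ s' = s14 -> {subset s <= W}.
  by move=> E x xs; rewrite EW' in_set -E mem_cat xs.
have pre (s s' : seq T) : s ++ s' = s14 -> uniq s by move=> E; apply: (@uniq_catl _ s s'); rewrite E.
have E0 : [:: h1; h2] ++ [:: u1; v1; u2; v2; u3; v3; u4; v4; u5; v5; u6; v6] = s14 by [].
have E1 : [:: h1; h2; u1; v1; u2; v2] ++ [:: u3; v3; u4; v4; u5; v5; u6; v6] = s14 by [].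
have E2 : [:: h1; h2; u1; v1; u2; v2; u3; v3; u4; v4] ++ [:: u5; v5; u6; v6] = s14 by [].
have [||||f1 [f1G f1h1 f1h2]] := step _ _ u1 v1 u2 v2 g0 f0h1 f0h2 _ _ (sub _ _ E0) (pre _ _ E1);
  rewrite ?inE ?eqxx ?orbT //.
have [||||f2 [f2G f2h1 f2h2]] := step _ _ u3 v3 u4 v4 f1G f1h1 f1h2 _ _ (sub _ _ E1) (pre _ _ E2);
  rewrite ?inE ?eqxx ?orbT //.
have [||||f3 [f3G _ _]] := step _ _ u5 v5 u6 v6 f2G f2h1 f2h2 _ _ (sub _ _ E2) us14;
  rewrite ?inE ?eqxx ?orbT //.
by exists f3; rewrite EW'.
Qed.

End ThetaColour.

(** * The induction on the number of vertices *)

Section Main.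
Variables (T : finType) (e : rel T).
Hypotheses (esym : symmetric e) (eirr : irreflexive e) (degen : degenerate2 e).
(** The charge that the potential bound allows on [n] vertices, after rounding and, for j = 4, after
    using the parity. *)
Definition budget j n := (j - 2) * (n %/ j) + minn (n %% j) (j - 2).

Lemma budgetD j n : 0 < j -> budget j (n + j) - (j - 2) = budget j n.
Proof.
move=> j0; rewrite /budget modnDr divnDr // divnn j0 addn1 mulnS.
by rewrite -addnA addKn.
Qed.

Lemma card_diff_seq (W : {set T}) (s : seq T) : uniq s -> {subset s <= W} ->
  #|W| = #|W :\: [set x in s]| + size s.
Proof.
move=> us sW; rewrite -(cardsID [set x in s] W) addnC; congr (_ + _).
have -> : W :&: [set x in s] = [set x in s].
  by apply/setIidPr/subsetP=> x; rewrite in_set; apply: sW.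
by rewrite cardsE (card_uniqP us).
Qed.

Lemma colourable_of_charge k (C : finType) (L : T -> {set C}) (W : {set T}) (c0 : C) :
  k = 3 \/ k = 4 -> (forall v, #|L v| = k) -> charge_le e W (budget k #|W|) -> colourable e k L W.
Proof.
move=> k34 hL; have k0 : 0 < k by case: k34 => ->.
have [n] := ubnP #|W|; elim: n W => [|n IH] W; first by rewrite ltn0.
move=> ltn chW; have [ltk|lek] := ltnP #|W| k; first exact (colourable_small eirr hL c0 ltk).
have [eqk|ltk] := eqVneq #|W| k.
  have EW : W :\: [set x in enum W] = set0.
    by apply/setP=> x; rewrite in_setD in_set mem_enum [in RHS]inE; case: (x \in W).
  apply: (greedy_colourable esym eirr hL k0 (enum_uniq W)).
  - by rewrite -cardE.
  - by move=> x; rewrite mem_enum.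
  - by rewrite EW greedy_set0.
  - by rewrite EW; apply: (colourable_small eirr hL c0); rewrite cards0.
have {lek}ltk : k < #|W| by rewrite ltn_neqAle eq_sym ltk.
case: (Classical_Prop.classic (reducible e k W (budget k #|W|))) => [[s [us ss sW gs chs]]|irr].
  have cW := card_diff_seq us sW; rewrite ss in cW.
  apply: (greedy_colourable esym eirr hL k0 us ss sW gs); apply: IH.
    by move: ltn cW k0; clear; lia.
  by move: chs; rewrite cW budgetD.
have exW : excess e W <= budget k #|W|.
  by have [X _ le] := chW; apply: leq_trans le; apply: leq_addr.
case: k34 => kE; move: kE => kE; last first.
  rewrite {}kE in hL ltk chW irr exW *.
  have [v [v' th]] := four_theta esym eirr degen ltk chW irr exW.
  exact (theta4_colourable esym eirr hL th).
rewrite {}kE in hL ltk chW irr exW IH k0 *.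
have ex3 : 3 * excess e W <= #|W| + 2 by move: exW; rewrite /budget; clear; lia.
case: (boolP [exists v in big e W, dg e W v == 4]) => [/exists_inP[v vB /eqP dv]|/exists_inPn n4].
  have [v' th] := theta_of_four esym eirr degen ltk chW irr ex3 vB dv.
  exact (theta3_colourable esym eirr hL th).
have all3 v : v \in big e W -> dg e W v = 3.
  move=> vB; have [_ dv] := bigP _ _ _ vB; have := n4 v vB.
  by have := big_le4 esym eirr degen ltk chW irr ex3 vB; move: dv; clear; lia.
have [[a [b [t1 [t2 [t3 [H cW]]]]]]|] := cubic_cases esym eirr degen ltk chW irr ex3 all3; last first.
  by move=> [a [b [c [d [t [t' [p [q [p' [q' H]]]]]]]]]]; exact (cubic_colourable esym eirr hL H).
apply: (k23_colourable esym eirr hL H cW); case: H => us sW Na Nb _.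
have cK := card_diff_seq us sW; have {}cK : #|W| = #|W :\: [set x in [:: a; b; t1; t2; t3]]| + 5 := cK.
case: cW => cW; rewrite cW in cK.
  by apply: (colourable_small eirr hL c0); move: cK; clear; lia.
have c5 : #|W :\: [set x in [:: a; b; t1; t2; t3]]| = 5 by move: cK; clear; lia.
apply: IH; first by rewrite c5; move: ltn; rewrite cW; clear; lia.
have [aW bW ab] : [/\ a \in W, b \in W & a != b].
  split; try by apply: sW; rewrite !inE eqxx ?orbT.
  by move: us; rewrite /= !inE !negb_or => /andP[/and4P[]].
have ut : uniq [:: t1; t2; t3] by case/and3P: us.
have c3 : #|[set t1; t2; t3]| = 3.
  have -> : [set t1; t2; t3] = [set x in [:: t1; t2; t3]] by apply/setP=> x; rewrite !inE orbA.
  by rewrite cardsE (card_uniqP ut).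
have [da db] : dg e W a = 3 /\ dg e W b = 3 by rewrite /dg Na Nb.
(* Going from 10 to 5 vertices lowers the budget from 4 to 2, and deleting the two big vertices
   already gains 2. *)
have := charge_del2 esym eirr aW bW ab _ _ chW; rewrite da db cW c5 => /(_ isT isT).
apply: charge_le_sub => //; apply/subsetP=> x; rewrite in_setD in_set => /andP[xK xW].
rewrite !in_setD1 xW andbT; move: xK; rewrite !inE !negb_or => /andP[-> /andP[-> _]] //.
Qed.

End Main.

Import Order.TTheory GRing.Theory Num.Theory.

(** * From the potential to degeneracy and charge *)

Section Potential.
Variables (T : finType) (e : rel T).
Hypotheses (esym : symmetric e) (eirr : irreflexive e).

(** A smallest cyclic set plays the role of a cycle component: another cyclic set misses it or
    contains it, because a nonempty intersection is again cyclic. One vertex is taken from each, and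
    each has at least 3. *)
Lemma cyclic_hitting (W Z : {set T}) : Z \subset W ->
  (forall x, x \in Z -> dg e W x = 2 /\ nbr e W x \subset Z) ->
  exists2 X : {set T}, 3 * #|X| <= #|Z| &
    forall K : {set T}, cyclic e W K -> K \subset Z -> ~~ [disjoint K & X].
Proof.
have [n] := ubnP #|Z|; elim: n Z => [|n IH] Z; first by rewrite ltn0.
move=> ltn ZW HZ; have [Z0|Z0] := eqVneq Z set0.
  exists set0; first by rewrite cards0.
  by move=> K /cyclicP[K0 _ _]; rewrite Z0 subset0 (negbTE K0).
have cZ : cyclic e W Z && (Z \subset Z) by rewrite subxx andbT; apply/cyclicP.
case: (arg_minnP (fun K : {set T} => #|K|) (P := fun K : {set T} => cyclic e W K && (K \subset Z)) cZ) => M.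
move=> /andP[/cyclicP[M0 MW HM] MZ] minM; have /set0Pn[x xM] := M0.
have cM : 3 <= #|M|.
  have [dx /subset_leq_card] := HM x xM; rewrite -/(dg _ _ _) dx => c2.
  have [_ sub] := HM x xM; have : nbr e W x \subset M :\ x.
    by rewrite subsetD1 sub in_nbr eirr andbF.
  by move/subset_leq_card; rewrite -/(dg _ _ _) dx; have := cardsD1 x M; rewrite xM; clear; lia.
have cD : #|Z| = #|Z :\: M| + #|M| by rewrite -(cardsID M Z) (setIidPr MZ) addnC.
have [||| X leX hX] := IH (Z :\: M).
- by move: ltn cD cM; clear; lia.
- by apply: subset_trans ZW; apply: subsetDl.
- move=> y /setDP[yZ yM]; have [dy nZ] := HZ y yZ; split=> //.
  apply/subsetP=> z zN; rewrite in_setD (subsetP nZ) // andbT; apply: contra yM => zM.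
  have [_ /subsetP nM] := HM z zM; apply: nM; apply: nbr_sym => //.
  exact: (subsetP ZW).
exists (x |: X).
  by have := cardsU1 x X; case: (x \notin X); move: leX cD cM; clear; lia.
move=> K cK KZ; have /cyclicP[K0 KW HK] := cK.
have [KM|/set0Pn KM] := eqVneq (K :&: M) set0.
  have KD : K \subset Z :\: M by rewrite subsetD KZ -setI_eq0 KM eqxx.
  by apply: contra (hX K cK KD) => dK; apply: disjointWr dK; apply: subsetUr.
have cKM : cyclic e W (K :&: M).
  apply/cyclicP; split; first exact/set0Pn.
    by apply: subset_trans KW; apply: subsetIl.
  move=> y /setIP[yK yM]; have [dy nK] := HK y yK; have [_ nM] := HM y yM.
  by rewrite subsetI nK nM.
have leM : #|M| <= #|K :&: M|.
  by apply: minM; rewrite cKM (subset_trans (subsetIl _ _) KZ).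
have /eqP EM : K :&: M == M by rewrite eqEcard subsetIr leM.
have xK : x \in K by move: xM; rewrite -EM => /setIP[].
by apply/pred0Pn; exists x; rewrite /= xK !inE eqxx.
Qed.

(** The handshake lemma: ordered adjacent pairs are grouped by the edge they span, two for each. *)
Lemma sum_dg (A : {set T}) : \sum_(v in A) dg e A v = 2 * induced_edges e A.
Proof.
pose P := [set p : T * T | (p.1 \in A) && (p.2 \in A) && e p.1 p.2].
have -> : \sum_(v in A) dg e A v = #|P|.
  rewrite -sum1_card (eq_bigr (fun v => \sum_(w in nbr e A v) 1)) => [|v _]; last first.
    by rewrite sum1_card.
  rewrite pair_big_dep /=; apply: eq_bigl => -[v w] /=.
  by rewrite !inE /= andbA.
rewrite -sum1_card (partition_big (fun p : T * T => [set p.1; p.2])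
  (mem [set E : {set T} | is_edge e E & E \subset A])) /=; last first.
  move=> [v w]; rewrite !inE /= => /andP[/andP[vA wA] evw]; apply/andP; split.
    by apply/existsP; exists v; apply/existsP; exists w; rewrite eqxx.
  by apply/subsetP=> x /set2P[]->.
rewrite (eq_bigr (fun=> 2)) => [|E]; first by rewrite sum_nat_const mulnC.
rewrite inE => /andP[/existsP[x /existsP[y /andP[/eqP-> exy]]] sub].
have xA : x \in A by apply: (subsetP sub); rewrite !inE eqxx.
have yA : y \in A by apply: (subsetP sub); rewrite !inE eqxx orbT.
have xy : x != y by apply: contraTneq exy => ->; rewrite eirr.
rewrite sum1_card -(_ : #|[set (x, y); (y, x)]| = 2).
  apply: eq_card => -[v w]; rewrite !inE /= -[LHS]/((_ \in P) && _) inE /= !xpair_eqE.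
  apply/andP/orP => [[/andP[/andP[vA wA] evw] /eqP E2]|].
    have vw : v != w by apply: contraTneq evw => ->; rewrite eirr.
    have : v \in [set x; y] by rewrite -E2 !inE eqxx.
    have : w \in [set x; y] by rewrite -E2 !inE eqxx orbT.
    move=> /set2P[wE|wE] /set2P[vE|vE]; rewrite wE vE ?eqxx; auto.
      by rewrite wE vE eqxx in vw.
    by rewrite wE vE eqxx in vw.
  case=> /andP[/eqP-> /eqP->]; split; rewrite ?xA ?yA //=; first by rewrite esym.
  by rewrite setUC.
by rewrite cards2 xpair_eqE (negbTE xy).
Qed.

Lemma rhoA_le k (A : {set T}) (b : int) : (rho e k <= b)%R -> (rhoA e k A <= b)%R.
Proof. by apply: le_trans; rewrite /rho; apply: (le_bigmax _ (fun A => rhoA e k A)). Qed.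

(** Minimum degree 3 on [A] would give potential at least (eps_k / 2 - 1)|A|, which exceeds 2
    because |A| is at least 3. *)
Lemma degenerate_of_rho k : k = 3 \/ k = 4 -> (rho e k <= 2)%R -> degenerate2 e.
Proof.
move=> k34 rk A A0; apply/exists_inP; apply: contraT => /exists_inPn H.
have d3 : \sum_(v in A) 3 <= \sum_(v in A) dg e A v.
  by apply: leq_sum => v vA; have := H v vA; clear; lia.
have /set0Pn[v vA] := A0.
have c3 : 3 <= #|A|.
  by have := H v vA; have := subset_leq_card (nbr_sub e A v); rewrite -/(dg _ _ _); clear; lia.
move: d3; rewrite sum_nat_const sum_dg => d3.
have := rhoA_le A rk; move: d3 c3; case: k34 => ->; rewrite /rhoA /nu /eps /half_eps /=.
  by clear; lia.
by clear; lia.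
Qed.

Lemma V1E : V1 e = [set v | dg e setT v == 1].
Proof.
apply/setP=> v; rewrite !inE /deg /dg; congr (_ == _).
by apply: eq_card => w; rewrite !inE.
Qed.

Lemma charge_of_rho k : k = 3 \/ k = 4 -> (rho e k <= 2 - sigma e k)%R ->
  charge_le e setT (budget k #|T|).
Proof.
move=> k34 rk; pose D := dg e setT.
pose Z := [set v | [exists K : {set T}, cyclic e setT K && (v \in K)]].
have ZP v : v \in Z -> D v = 2 /\ nbr e setT v \subset Z.
  rewrite inE => /existsP[K /andP[cK vK]]; have /cyclicP[_ _ HK] := cK.
  have [dv nK] := HK v vK; split=> //; apply/subsetP=> w wN.
  by rewrite inE; apply/existsP; exists K; rewrite cK (subsetP nK).
have [X leX hX] := cyclic_hitting (subsetT Z) ZP.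
(* What remains without the cycle components and the isolated vertices is a union of components, so
   degrees in it are unchanged. *)
pose A := [set v | (v \notin Z) && (0 < D v)].
have dA v : v \in A -> dg e A v = D v.
  rewrite inE => /andP[vZ dv]; apply: eq_card => w; rewrite !in_nbr in_setT /=.
  case ew: (e v w); rewrite ?andbF // andbT inE; apply/andP; split.
    apply: contra vZ => wZ; have [_ /subsetP nZ] := ZP w wZ.
    by apply: nZ; rewrite in_nbr in_setT esym.
  by apply/card_gt0P; exists v; rewrite in_nbr in_setT esym.
have exE : excess e setT = \sum_(v in A) (D v - 2).
  rewrite /excess [RHS]big_mkcond [LHS]big_mkcond; apply: eq_bigr => v _.
  rewrite in_setT inE; case: (boolP (v \in Z)) => [/ZP[dv _]|_] /=; first by rewrite -/D dv.
  by rewrite -/D; case: (D v).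
have V1A : A :&: V1 e = V1 e.
  apply/setIidPr/subsetP=> v; rewrite V1E !inE => /eqP dv; rewrite /D dv andbT.
  by apply/negP=> /existsP[K /andP[cK vK]]; have /cyclicP[_ _ /(_ v vK)[]] := cK; rewrite dv.
(* For d > 0 one has d + [d = 1] = (d - 2) + 2 with truncated subtraction. The sum over [A] gives
   the potential and shows that the excess has the parity of |V_1|. *)
have count : 2 * induced_edges e A + #|V1 e| = excess e setT + 2 * #|A|.
  rewrite -sum_dg exE -{1}V1A -sum1_card mulnC -sum_nat_const.
  have -> : \sum_(i in A :&: V1 e) 1 = \sum_(v in A) (D v == 1 : nat).
    rewrite big_mkcond [RHS]big_mkcond; apply: eq_bigr => v _.
    rewrite in_setI V1E; case: (v \in A) => //=.
    by rewrite inE -/(D v); case: eqP.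
  rewrite -!big_split /=; apply: eq_bigr => v vA; rewrite dA //.
  by move: vA; rewrite inE => /andP[_]; case: eqP; clear; lia.
have cardAZ : #|A| + #|Z| <= #|T|.
  rewrite -cardsT -(cardsID Z setT) setTI addnC leq_add2l; apply: subset_leq_card.
  by apply/subsetP=> v; rewrite in_setD in_setT [v \in A]inE andbT => /andP[].
exists X.
  move=> K cK; apply: (hX K) => //; apply/subsetP=> v vK.
  by rewrite inE; apply/existsP; exists K; rewrite cK.
have := rhoA_le A rk; rewrite /rhoA V1A; move: leX cardAZ count.
(* A cycle costs one unit of charge but brings at least three vertices. For k = 4 the parity term
   excludes the odd excess n / 2 + 1 when 4 divides n. *)
case: k34 => ->; rewrite /sigma /nu /eps /half_eps /budget /=; clear; first by lia.
by case: (boolP (odd #|V1 e|)); lia.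
Qed.

End Potential.

(** * From balanced to strongly equitable colourings *)

Section StronglyEquitable.
Variables (T : finType) (e : rel T) (k : nat) (C : finType) (L : T -> {set C}).

Lemma sum_cls (f : T -> C) : \sum_c #|[set v | f v == c]| = #|T|.
Proof.
rewrite -[RHS]sum1_card (partition_big f predT) //=; apply: eq_bigr => c _.
by rewrite sum1_card; apply: eq_card => v; rewrite inE.
Qed.

(** If k divides n = qk, no class exceeds q, and at most k classes have size q because together they
    have at most n vertices. Otherwise the ceiling is q + 1 and [modstar] is the remainder, as in
    [balanced]. *)
Lemma SE_of_good f : 0 < k -> good e k L setT f -> SE_Lcoloring e k L f.
Proof.
move=> k0 [[fL fP] [le cnt]]; split; first by move=> v; apply: fL; rewrite in_setT.
split; first by move=> v w; apply: fP; rewrite in_setT.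
have [n0|n0] := posnP #|T|; [by left | right].
have clsE c : cls setT f c = [set v | f v == c] by apply/setP=> v; rewrite !inE.
rewrite /ceildiv /modstar; rewrite cardsT in le cnt.
have {}le c : #|[set v | f v == c]| <= (#|T| %/ k).+1 by rewrite -clsE.
have {}cnt : #|[set c | #|[set v | f v == c]| == (#|T| %/ k).+1]| <= #|T| %% k.
  by apply: leq_trans cnt; apply: subset_leq_card; apply/subsetP=> c; rewrite !inE clsE.
have := divn_eq #|T| k; have := ltn_pmod #|T| k0.
set q := #|T| %/ k in le cnt *; set r := #|T| %% k in le cnt * => ltr En.
have [r0|r0] := posnP r.
  have q0 : 0 < q by move: n0 En; rewrite r0; case: q {le cnt} => //; lia.
  have cE : (#|T| + k - 1) %/ k = q.
    by rewrite En r0 addn0 -addnBA // divnMDl // (divn_small (m := k - 1)) ?addn0 //; lia.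
  have mE : ((#|T| + k - 1) %% k).+1 = k.
    by rewrite En r0 addn0 -addnBA // modnMDl modn_small; lia.
  rewrite cE mE; split=> [c|].
    have : [set c | #|[set v | f v == c]| == q.+1] == set0 by rewrite -cards_eq0 -leqn0 -r0.
    move=> /eqP/setP/(_ c); rewrite !inE => /negbT; have := le c; clear; lia.
  rewrite -(leq_pmul2r q0); apply: leq_trans (_ : \sum_c #|[set v | f v == c]| <= _).
    rewrite -sum_nat_const [leqRHS](bigID (mem [set c | #|[set v | f v == c]| == q])) /=.
    by apply: leq_trans (leq_addr _ _); apply: leq_sum => c; rewrite inE => /eqP->.
  by rewrite sum_cls En r0 addn0 mulnC.
have cE : (#|T| + k - 1) %/ k = q.+1.
  have -> : #|T| + k - 1 = q.+1 * k + r.-1 by rewrite mulSn; lia.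
  by rewrite divnMDl // divn_small ?addn0; lia.
have mE : ((#|T| + k - 1) %% k).+1 = r.
  have -> : #|T| + k - 1 = q.+1 * k + r.-1 by rewrite mulSn; lia.
  by rewrite modnMDl modn_small; lia.
by rewrite cE mE.
Qed.

End StronglyEquitable.

Theorem theorem2p1 (k : nat) (T : finType) (e : rel T) :
  (k = 3%N \/ k = 4%N) -> symmetric e -> irreflexive e ->
  (rho e k <= 2 - sigma e k)%R ->
  SE_choosable e k.
Proof.
move=> k34 esym eirr rk C L hL; have k0 : 0 < k by case: k34 => ->.
have rk2 : (rho e k <= 2)%R.
  apply: le_trans rk _; rewrite /sigma; case: (k == 3); first by rewrite subr0.
  by case: (odd _).
have degen := degenerate_of_rho esym eirr k34 rk2.
have [t _|T0] := pickP (mem T).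
  have [c0 _] : exists c, c \in L t by apply/card_gt0P; rewrite hL.
  have := charge_of_rho esym eirr k34 rk; rewrite -cardsT => ch.
  have [f fG] := colourable_of_charge esym eirr degen c0 k34 hL ch.
  by exists f; apply: SE_of_good.
(* On the empty graph there may be no colour at all, so the colouring comes from the absence of
   vertices. *)
exists (fun t => False_rect C (elimF idP (T0 t) isT)); split; first by move=> v; have := T0 v.
by split=> [v|]; [have := T0 v | left; apply: eq_card0].
Qed.
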